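(* Let $\rho$ be such that $\omega(1,\rho,1)=1+2\rho$. Suppose $\mathrm{M}^\star(n,n^\rho,n\mid n^{1-\rho})$ requires $n^{2+\rho-o(1)}$ time (even with randomization). Then for any $U\ge 2$, u-$\#_{\mathrm{mod}\,U}$APSP and u-$\#_{\le U}$APSP on directed unweighted $n$-vertex graphs require $n^{2+\rho-o(1)}$ time.
   Context: $\omega(a,b,c)$ is the smallest real $r$ such that an $n^a\times n^b$ by $n^b\times n^c$ integer matrix product can be computed in $O(n^{r+\epsilon})$ time for all $\epsilon>0$. $\mathrm{M}^\star(n_1,n_2,n_3\mid M)$: compute the Min-Plus product $C[i,j]=\min_k(A[i,k]+B[k,j])$ of an $n_1\times n_2$ and an $n_2\times n_3$ matrix with integer entries in $\{0,\dots,M\}$. For a directed unweighted graph let $C[u,v]$ be the number of shortest $u$-$v$ paths. u-$\#_{\mathrm{mod}\,U}$APSP: compute $C[u,v]\bmod U$ for all pairs; u-$\#_{\le U}$APSP: compute $\min\{C[u,v],U\}$ for all pairs. *)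

(* Defs.v *)
From mathcomp Require Import all_boot all_order all_algebra.
From mathcomp Require Import reals exp.

Set Implicit Arguments.
Unset Strict Implicit.
Unset Printing Implicit Defensive.

Import Order.TTheory GRing.Theory Num.Theory.

Local Open Scope ring_scope.

(** A program is a list of instructions acting on registers and on a
    random-access memory (a word RAM), at unit cost per instruction.  Cells
    hold signed words.  The word length is enforced by a bound [B]: an
    instruction that would put a value of absolute value at least [B] in a
    register crashes.  For inputs of parameter [n] we take [B = (n + 1) ^ c]
    with a constant [c] chosen together with the program, i.e. words of
    O(log n) bits.  Bitwise operations on such words are simulated by O(log n)
    arithmetic instructions, which is irrelevant to the exponents below. *)

Inductive binop := Add | Sub | Mul | Div.

Inductive instr :=
  | Const of nat & int
  | Arith of binop & nat & nat & nat
  | Read of nat & nat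
  | Write of nat & nat
  | Coin of nat
  | Jump of nat & nat.

Definition program := seq instr.

Record state := State { pc : nat; reg : nat -> int; mem : nat -> int }.

Definition upd (f : nat -> int) (k : nat) (v : int) : nat -> int :=
  fun i => if i == k then v else f i.

Definition eval_binop (o : binop) (x y : int) : int :=
  match o with
  | Add => x + y
  | Sub => x - y
  | Mul => x * y
  | Div => (x %/ y)%Z
  end.

Definition set_reg (B : nat) (s : state) (r : nat) (v : int) : option state :=
  if (`|v| < B)%N then Some (State (pc s).+1 (upd (reg s) r v) (mem s))
  else None.

Definition exec (B : nat) (coin : bool) (i : instr) (s : state) :
    option state :=
  match i with
  | Const r z => set_reg B s r z
  | Arith o r r1 r2 => set_reg B s r (eval_binop o (reg s r1) (reg s r2))
  | Read r r1 => if reg s r1 is Posz k then set_reg B s r (mem s k) else None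
  | Write r1 r2 =>
      if reg s r1 is Posz k
      then Some (State (pc s).+1 (reg s) (upd (mem s) k (reg s r2))) else None
  | Coin r => set_reg B s r (Posz coin)
  | Jump r l =>
      Some (State (if 0 < reg s r then l else (pc s).+1) (reg s) (mem s))
  end.

Definition halted (p : program) (s : state) : bool := (size p <= pc s)%N.

(* [None] is the crashed machine; a halted machine no longer changes. *)
Definition step (p : program) (B : nat) (s : option state) (coin : bool) :
    option state :=
  if s is Some s' then
    if halted p s' then s
    else exec B coin (nth (Const 0 0) p (pc s')) s'
  else None.

Definition init (input : seq int) : state :=
  State 0 (fun=> 0) (fun k => nth 0 input k).

(* Runs [size tape] steps; a fresh random bit is available at every step, and
   only the instruction [Coin] reads it.  Hence the uniform distribution on
   tapes of length [t] is that of the [t]-step executions. *)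
Definition run (p : program) (B : nat) (input : seq int) (tape : seq bool) :
    option state :=
  foldl (step p B) (Some (init input)) tape.

Definition terminates (p : program) (s : option state) : bool :=
  if s is Some s' then halted p s' else false.

Definition outputs (p : program) (s : option state) (out : seq int) : bool :=
  if s is Some s' then
    halted p s' && (mkseq (mem s') (size out) == out)
  else false.

Definition coin_free (p : program) : bool :=
  all (fun i => if i is Coin _ then false else true) p.

Record problem := Problem {
  instance : Type;
  admissible : pred instance;
  input : instance -> seq int;
  output : instance -> seq int }.

(* O(n ^ e) time for a family of problems indexed by the size parameter [n]. *)
Definition det_time {R : realType} (F : nat -> problem) (e : R) : Prop :=
  exists (p : program) (c : nat) (K : R), coin_free p /\
  forall n : nat, (0 < n)%N -> exists2 t : nat, t%:R <= K * n%:R `^ e &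
  forall x : instance (F n), admissible x ->
  forall tape : t.-tuple bool,
  outputs p (run p (n.+1 ^ c) (input x) tape) (output x).

(* Monte Carlo algorithms with two-sided error: the time bound holds for all
   coin tosses, and the output is correct with probability at least 2/3. *)
Definition rand_time {R : realType} (F : nat -> problem) (e : R) : Prop :=
  exists (p : program) (c : nat) (K : R),
  forall n : nat, (0 < n)%N -> exists2 t : nat, t%:R <= K * n%:R `^ e &
  forall x : instance (F n), admissible x ->
  (forall tape : t.-tuple bool,
     terminates p (run p (n.+1 ^ c) (input x) tape)) /\
  (2 * 2 ^ t <= 3 * #|[set tape : t.-tuple bool |
     outputs p (run p (n.+1 ^ c) (input x) tape) (output x)]|)%N.

(* [F] requires n ^ (e - o(1)) time, even with randomization: no algorithm is
   polynomially faster than n ^ e.  Deterministic algorithms are included. *)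
Definition requires_time {R : realType} (F : nat -> problem) (e : R) : Prop :=
  forall delta : R, 0 < delta -> ~ rand_time F (e - delta).

Definition row_major (m n : nat) (A : 'M[int]_(m, n)) : seq int :=
  [seq A i j | i <- enum 'I_m, j <- enum 'I_n].

Definition mx_le (m n : nat) (N : nat) (A : 'M[int]_(m, n)) : bool :=
  [forall i, forall j, (`|A i j| <= N)%N].

Definition matrix_product (n1 n2 n3 N : nat) : problem :=
  {| instance := 'M[int]_(n1, n2) * 'M[int]_(n2, n3);
     admissible := fun x => mx_le N x.1 && mx_le N x.2;
     input := fun x => [:: Posz n1; Posz n2; Posz n3] ++
                       row_major x.1 ++ row_major x.2;
     output := fun x => row_major (x.1 *m x.2) |}.

Definition npow {R : realType} (n : nat) (a : R) : nat :=
  Num.truncn (n%:R `^ a).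

(* As entries are stored in O(log n)-bit words, they range over the integers
   of absolute value at most n ^ d, for every constant d. *)
Definition mm_exponent {R : realType} (a b c r : R) : Prop :=
  forall (eps : R) (d : nat), 0 < eps ->
  det_time (fun n => matrix_product (npow n a) (npow n b) (npow n c) (n ^ d))
    (r + eps).

(* omega(a, b, c) as a relation: [r] is the smallest such exponent. *)
Definition is_omega {R : realType} (a b c r : R) : Prop :=
  mm_exponent a b c r /\ forall r' : R, mm_exponent a b c r' -> r <= r'.

(* The sums being at most 2M, the initial value 2M of the minimum is harmless
   as soon as 0 < n2. *)
Definition minplus_mx (n1 n2 n3 M : nat)
    (A : 'M['I_M.+1]_(n1, n2)) (B : 'M['I_M.+1]_(n2, n3)) : 'M[nat]_(n1, n3) :=
  \matrix_(i, j) \big[minn/(2 * M)%N]_(k < n2) (A i k + B k j)%N.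

Definition minplus_product (n1 n2 n3 M : nat) : problem :=
  {| instance := 'M['I_M.+1]_(n1, n2) * 'M['I_M.+1]_(n2, n3);
     admissible := predT;
     input := fun x => [:: Posz n1; Posz n2; Posz n3; Posz M] ++
       row_major (map_mx (fun a : 'I__ => Posz a) x.1) ++
       row_major (map_mx (fun a : 'I__ => Posz a) x.2);
     output := fun x => row_major (map_mx Posz (minplus_mx x.1 x.2)) |}.

Section Paths.
Variables (n : nat) (E : 'M[bool]_n).

(* [p] lists the vertices of the path after its origin [u], so that its
   length is [size p]. *)
Definition is_path (u v : 'I_n) (p : seq 'I_n) : bool :=
  [&& path (fun x y => E x y) u p, last u p == v & uniq (u :: p)].

(* No path on [n] vertices has more than [n] edges, so paths are elements of
   the finite type [n.-bseq 'I_n]. *)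
Definition is_shortest_path (u v : 'I_n) (p : n.-bseq 'I_n) : bool :=
  is_path u v p && [forall q : n.-bseq 'I_n, is_path u v q ==>
                                             (size p <= size q)%N].

Definition count_shortest_paths (u v : 'I_n) : nat :=
  #|[set p : n.-bseq 'I_n | is_shortest_path u v p]|.

End Paths.

(* The problem, on directed unweighted loopless graphs on [n] vertices given
   by their adjacency matrix, of computing [f C[u, v]] for all u, v. *)
Definition count_apsp (f : nat -> nat) (n : nat) : problem :=
  {| instance := 'M[bool]_n;
     admissible := fun E => [forall u, ~~ E u u];
     input := fun E =>
       Posz n :: row_major (map_mx (fun b : bool => Posz b) E);
     output := fun E =>
       row_major (\matrix_(u, v) Posz (f (count_shortest_paths E u v))) |}.

Definition count_apsp_mod (U : nat) : nat -> problem :=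
  count_apsp (fun k => k %% U)%N.

Definition count_apsp_le (U : nat) : nat -> problem :=
  count_apsp (fun k => minn k U).

(* Main.v *)
Require Import Defs.
From mathcomp Require Import all_boot all_order all_algebra.
From mathcomp Require Import reals exp.
From mathcomp Require Import zify ring lra boolp.
Set Implicit Arguments.
Unset Strict Implicit.
Unset Printing Implicit Defensive.
Import Order.TTheory GRing.Theory Num.Theory.
Local Open Scope ring_scope.

(** Let [0 < rho <= 1], [m = n ^ rho] and [M = n ^ (1 - rho)].  To find a [k]
    attaining the minimum of [A i k + B k j], draw O(log n ^ 2) random sets of
    inner indices, with densities [1/2, 1/4, 1/8, ...]; with high probability,
    for all [i, j] one of these sets contains exactly one optimal [k].  For
    each set and each bit position [b], build a graph in which [i] enters, for
    each [k] of the set, a chain of length [2M] at position [M - A i k], and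
    leaves it for [j] at position [M + B k j].  The length of a route is
    [A i k + B k j + 2].  Doubling the chain when the bit [b] of [k] is 1, the
    number of shortest paths from [i] to [j] is 1 or 2 according to this bit
    when the optimal [k] is unique.  Only [f 1 <> f 2] is used to tell the two
    cases apart.  As [m * M <= n], the disjoint union of these graphs has
    [n] vertices up to a power of [log n].  A round is correct with probability
    [3/4 * 2/3 = 1/2]; two rounds give [3/4].

    If [rho > 1], then [M = 0] for [n >= 2] and the Min-Plus product is
    constant, hence too easy.  If [rho <= 0], the conclusion asks for at most
    [n ^ 2] time, and the graph with all edges from even to odd vertices forces
    the machine to change [n ^ 2 / 4] cells. *)

(** Isolation is forced by the fact that path counts add up over all optimal inner indices, while
    only the counts 1 and 2 can be told apart. The number of optimal indices is unknown, hence the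
    geometric range of densities: one of them is within a constant factor of its inverse.

    Oracle errors are not detectable, but a decoded index only serves to evaluate an actual sum, so
    that errors are one-sided. Rounds are therefore combined by a minimum, not by a vote; a single
    round, correct with probability 1/2, would miss the threshold 2/3.

    The other obstacle is the machine: the reduction is one concrete program for all [n], and it
    must not crash even when the oracle answers nonsense, since the time bound holds for all coin
    tosses. Three nested scales control this: stored values are at most [V], all values of
    expressions are below the region size [G], and addresses and squares are below the word bound
    [B], thanks to [G ^ 2 < B]. All three are powers of [n + 1], and [V] also dominates the word
    bound of the oracle. *)

Local Notation memory := Defs.mem.

(** * Averages over coin tosses *)

(** Recursion on the first coin, rather than a sum over tuples, makes one machine step consume
    exactly one level; [avg_card] translates it into the counting used by [rand_time]. *)
Fixpoint avg (T : nat) (f : seq bool -> rat) : rat :=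
  if T is T'.+1 then
    (avg T' (fun z => f (true :: z)) + avg T' (fun z => f (false :: z))) / 2
  else f [::].

Lemma avgS T f : avg T.+1 f =
  (avg T (fun z => f (true :: z)) + avg T (fun z => f (false :: z))) / 2.
Proof. by []. Qed.

Lemma ler_avg T f g : (forall z, size z = T -> f z <= g z) ->
  avg T f <= avg T g.
Proof.
elim: T f g => [|T IH] f g le_fg /=; first exact: le_fg.
rewrite ler_pM2r // lerD //; apply: IH => z sz; apply: le_fg; rewrite /= sz //.
Qed.

Lemma eq_avg T f g : (forall z, size z = T -> f z = g z) -> avg T f = avg T g.
Proof.
by move=> fg; apply/eqP; rewrite eq_le !ler_avg // => z /fg ->.
Qed.

Lemma avg_cst T c : avg T (fun=> c) = c.
Proof. by elim: T => [|T IH] //=; rewrite IH; field. Qed.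

Lemma avg_affine T a b f : avg T (fun z => a + b * f z) = a + b * avg T f.
Proof.
by elim: T f => [|T IH] f //=; rewrite 2!IH; field.
Qed.

Lemma avg_card T (P : pred (seq bool)) :
  avg T (fun z => (P z)%:R) = #|[set t : T.-tuple bool | P t]|%:R / 2 ^+ T.
Proof.
elim: T P => [|T IH] P /=.
  rewrite divr1; congr (_%:R); case E: (P [::]).
    rewrite (_ : [set t | _] = setT) ?cardsT ?card_tuple //.
    by apply/setP=> t; rewrite !inE tuple0.
  by rewrite (_ : [set t | _] = set0) ?cards0 //; apply/setP=> t; rewrite !inE tuple0.
rewrite (IH (fun z => P (true :: z))) (IH (fun z => P (false :: z))).
pose h b (t : T.-tuple bool) := [tuple of b :: t].
have hinj b : injective (h b) by move=> x y [] /val_inj.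
have -> : [set t : T.+1.-tuple bool | P t] =
  (h true @: [set t : T.-tuple bool | P (true :: t)]) :|:
  (h false @: [set t : T.-tuple bool | P (false :: t)]).
  apply/setP=> t; rewrite !inE; case/tupleP: t => b t.
  apply/idP/orP => [Pt|[]/imsetP[t']].
  - by case: b Pt => Pt; [left|right]; apply/imsetP; exists t; rewrite ?inE.
  - by rewrite inE => Pt' [-> /val_inj ->].
  - by rewrite inE => Pt' [-> /val_inj ->].
rewrite cardsU (_ : _ :&: _ = set0) ?cards0 ?subn0 ?card_imset //; last first.
  apply/setP=> t; rewrite !inE; apply/negP => /andP[/imsetP[x _ ->]] /imsetP[y _].
  by move/(congr1 (fun u : T.+1.-tuple bool => thead u)); rewrite !theadE.
by rewrite natrD exprS; field; rewrite expf_neq0.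
Qed.

Lemma avg_cat S T f :
  avg (S + T) f = avg S (fun y => avg T (fun z => f (y ++ z))).
Proof. by elim: S f => [|S IH] f //=; rewrite 2!IH. Qed.

(** * Probability of an absorbing event along an execution *)

Section Probability.
Variables (p : program) (B : nat) (F : option state -> bool).
Hypothesis F_absorbing : forall s b, F s -> F (step p B s b).

Definition pr T (s : option state) : rat :=
  avg T (fun z => (F (foldl (step p B) s z))%:R).

Lemma pr0 s : pr 0 s = (F s)%:R. Proof. by []. Qed.

Lemma prS T s :
  pr T.+1 s = (pr T (step p B s true) + pr T (step p B s false)) / 2.
Proof. by []. Qed.

Lemma pr_ge0 T s : 0 <= pr T s.
Proof. by rewrite -(avg_cst T 0); apply: ler_avg => z _; rewrite ler0n. Qed.

(** Once reached, the event persists, so spare steps only help: an upper bound on a duration may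
    replace the exact duration. *)
Lemma pr_homo S T s : (S <= T)%N -> pr S s <= pr T s.
Proof.
suff mono T' s' : pr T' s' <= pr T'.+1 s'.
  by move/subnK <-; elim: (T - S)%N => // k IH; rewrite addSn (le_trans IH).
elim: T' s' => [|T' IH] s'.
  rewrite prS /pr /=; case E: (F s'); last by rewrite divr_ge0 // addr_ge0.
  by rewrite !F_absorbing.
by rewrite 2!prS ler_pM2r // lerD // IH.
Qed.

Definition straight (i : instr) : bool :=
  match i with Coin _ | Jump _ _ => false | _ => true end.

(** The coin passed to [exec] is arbitrary on [straight] code. Such code does not jump either, so it
    can be run as a list, independently of its place in a program. *)
Definition sexec (code : seq instr) (s : state) : option state :=
  foldl (fun os i => obind (exec B false i) os) (Some s) code.

Lemma sexec_cons i code s :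
  sexec (i :: code) s = obind (sexec code) (exec B false i s).
Proof.
rewrite /sexec /=; case: (exec _ _ _ _) => //=.
by elim: code.
Qed.

Lemma sexec_cat c1 c2 s :
  sexec (c1 ++ c2) s = obind (sexec c2) (sexec c1 s).
Proof.
elim: c1 s => [|i c1 IH] s //=; rewrite !sexec_cons.
by case: (exec _ _ _ _) => //= s'.
Qed.

Lemma drop_cons_step (s : state) i rest : drop (pc s) p = i :: rest ->
  [/\ ~~ halted p s, nth (Const 0 0) p (pc s) = i & drop (pc s).+1 p = rest].
Proof.
move=> E; have lt : (pc s < size p)%N.
  by rewrite ltnNge; apply/negP => /drop_oversize; rewrite E.
rewrite (drop_nth (Const 0 0) lt) in E; case: E => -> ->.
by rewrite /halted -ltnNge.
Qed.

Lemma step_instr s i rest b : drop (pc s) p = i :: rest ->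
  step p B (Some s) b = exec B b i s.
Proof. by case/drop_cons_step => /negPf /= -> ->. Qed.

Lemma exec_straight i s s' b : straight i -> exec B b i s = Some s' ->
  exec B false i s = Some s' /\ pc s' = (pc s).+1.
Proof.
case: i => [r z|o r r1 r2|r r1|r1 r2|r|r l] //= _; rewrite /set_reg.
- by case: ifP => // _ [<-].
- by case: ifP => // _ [<-].
- by case: (reg s r1) => // k; case: ifP => // _ [<-].
- by case: (reg s r1) => // k [<-].
Qed.

Lemma exec_straightE i s b : straight i -> exec B b i s = exec B false i s.
Proof. by case: i. Qed.

(** Deterministic code costs one time unit per instruction and leaves the probability unchanged.
    Locating it through [drop (pc s) p] lets statements about fragments compose without fixed
    addresses. *)
Lemma pr_sexec T code rest (s s' : state) : all straight code ->
  drop (pc s) p = code ++ rest -> sexec code s = Some s' ->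
  pr (size code + T) (Some s) = pr T (Some s') /\ drop (pc s') p = rest.
Proof.
elim: code s => [|i code IH] s /=; first by move=> _ <- [<-].
case/andP=> si scode dE; rewrite sexec_cons.
case E: (exec _ _ _ _) => [s1|] //= s1E.
have [_ pc1] := exec_straight si E.
have [_ _ d1] := drop_cons_step dE; rewrite -pc1 in d1.
have [<- ->] := IH _ scode d1 s1E; split=> //.
by rewrite addSn prS !(step_instr _ dE) !(exec_straightE _ _ si) E; field.
Qed.

Lemma pc_sexec code s s' : all straight code -> sexec code s = Some s' ->
  pc s' = (pc s + size code)%N.
Proof.
elim: code s => [|i code IH] s /=; first by move=> _ [<-]; rewrite addn0.
case/andP=> si scode; rewrite sexec_cons.
case E: (exec _ _ _ _) => [s1|] //= s1E.
by have [_ pc1] := exec_straight si E; rewrite (IH s1) // pc1 addSnnS.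
Qed.

Lemma pr_coin T r rest (s : state) : (1 < B)%N -> drop (pc s) p = Coin r :: rest ->
  pr T.+1 (Some s) =
    (pr T (Some (State (pc s).+1 (upd (reg s) r 1) (memory s))) +
     pr T (Some (State (pc s).+1 (upd (reg s) r 0) (memory s)))) / 2.
Proof.
by move=> B1 dE; rewrite prS !(step_instr _ dE) /= /set_reg /= B1 (ltnW B1).
Qed.

Lemma pr_jump T r l rest (s : state) : drop (pc s) p = Jump r l :: rest ->
  pr T.+1 (Some s) =
    pr T (Some (State (if 0 < reg s r then l else (pc s).+1) (reg s) (memory s))).
Proof. by move=> dE; rewrite prS !(step_instr _ dE) /=; field. Qed.

End Probability.

(** * Isolation by random sampling *)

Lemma avgD T f g : avg T (fun z => f z + g z) = avg T f + avg T g.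
Proof. by elim: T f g => [|T IH] f g //=; rewrite 2!IH; field. Qed.

Lemma avgZ T c f : avg T (fun z => c * f z) = c * avg T f.
Proof. by have := avg_affine T 0 c f; rewrite add0r => <-; apply: eq_avg => z _; rewrite add0r. Qed.

Lemma avg_sum T (I : Type) (s : seq I) (f : I -> seq bool -> rat) :
  avg T (fun z => \sum_(i <- s) f i z) = \sum_(i <- s) avg T (f i).
Proof.
elim: s => [|i s IH].
  by rewrite big_nil -[RHS](avg_cst T 0); apply: eq_avg => z _; rewrite big_nil.
by rewrite big_cons -IH -avgD; apply: eq_avg => z _; rewrite big_cons.
Qed.

(** Independence of distinct coins: position 0, if present, contributes a factor 1/2 when its coin
    is split off, and the other positions move down by one into [J']. *)
Lemma avg_all T (J : seq nat) : uniq J -> all (fun j => j < T)%N J ->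
  avg T (fun z => (all (nth false z) J)%:R) = 2^-1 ^+ size J.
Proof.
elim: T J => [|T IH] J uJ JT.
  by case: J uJ JT => //= _ _; rewrite expr0.
pose J' := map predn (filter (fun j => 0 < j)%N J).
have uJ' : uniq J'.
  rewrite map_inj_in_uniq ?filter_uniq // => x y.
  by rewrite !mem_filter; lia.
have J'T : all (fun j => j < T)%N J'.
  apply/allP=> _ /mapP[x + ->]; rewrite mem_filter => /andP[x0 /(allP JT)]; lia.
have nJ b z : all (nth false (b :: z)) J = (b || (0%N \notin J)) && all (nth false z) J'.
  rewrite /J'; elim: (J) => [|[|j] s IHs] /=; first by rewrite orbT.
    by rewrite ?inE /= orbF IHs; move: (0%N \in s) => i0; case: (b) => //=; rewrite ?andbF //=; case: i0.
  by rewrite ?inE /= IHs; case: (nth _ _ _); rewrite ?andbF.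
have sJ : size J = ((0%N \in J) + size J')%N.
  rewrite size_map size_filter -(count_predC (fun j => 0 < j)%N J) addnC; congr (_ + _)%N.
  rewrite -(count_uniq_mem 0%N uJ); apply: eq_count => x /=; lia.
rewrite avgS; have := IH _ uJ' J'T => E.
have -> : avg T (fun z => (all (nth false (true :: z)) J)%:R) = 2^-1 ^+ size J'.
  by rewrite -E; apply: eq_avg => z _; rewrite nJ.
case: (boolP (0%N \in J)) sJ => J0 ->.
  rewrite (eq_avg (g := fun=> 0)) => [|z _]; last by rewrite nJ J0.
  by rewrite avg_cst addr0 exprD expr1 mulrC.
rewrite (eq_avg (g := fun z => (all (nth false z) J')%:R)) => [|z _]; last by rewrite nJ J0.
by rewrite E add0n; field.
Qed.

Section Isolation.
Variables (lam m : nat).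

(** Membership of [k] in sample [q]. The coins form rows of length [m], one per sample. In a group
    of [lam] consecutive samples, the one of level [l] keeps the indices whose coins in the rows 0
    to [l] of the group are all true, so that its density is [2 ^ -(l + 1)]. *)
Definition survives (z : seq bool) (q k : nat) : bool :=
  all (fun l => nth false z ((q %/ lam * lam + l) * m + k)) (iota 0 (q %% lam).+1).

(** The recursive form evaluated by the sampling loop: a fresh coin, and the value stored one row
    earlier. *)
Lemma survivesE z q k : (0 < lam)%N -> survives z q k =
  nth false z (q * m + k) && ((q %% lam == 0)%N || survives z q.-1 k).
Proof.
move=> lam0; rewrite {1}/survives -[(q %% lam).+1]addn1 iotaD all_cat /= add0n andbT -divn_eq andbC.
congr (_ && _); have [->//|q0] := eqVneq (q %% lam)%N 0%N.
have qE : q.-1 = (q %/ lam * lam + (q %% lam).-1)%N.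
  have := divn_eq q lam; move: q0; move: (q %% lam)%N (q %/ lam * lam)%N => r d.
  by lia.
have lt : ((q %% lam).-1 < lam)%N by have := ltn_pmod q lam0; lia.
rewrite /survives qE divnMDl // (divn_small lt) addn0 modnMDl (modn_small lt) prednK //.
by rewrite lt0n.
Qed.

Definition column (l k : nat) : seq nat := [seq (l' * m + k)%N | l' <- iota 0 l.+1].

Definition isolates (l : nat) (O : seq nat) (y : seq bool) : bool :=
  count (fun k => all (nth false y) (column l k)) O == 1%N.

(** Second moment method. If [c] elements of [O] survive, the indicator of [c = 1] is at least
    [2 * c - c ^ 2]. With [x = size O * 2 ^ -(l + 1)], pairwise independence bounds the average
    below by [x - x ^ 2], and the level [l = t + 1] puts [x] in [1/4, 1/2]. *)
Lemma avg_isolates l t O : uniq O -> all (fun k => k < m)%N O ->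
  (2 ^ t <= size O < 2 ^ t.+1)%N -> l = t.+1 -> (l < lam)%N ->
  1 / 8 <= avg (lam * m) (fun y => (isolates l O y)%:R).
Proof.
move=> uO Om sO lE llam; set s := size O in sO.
pose X k (y : seq bool) : rat := (all (nth false y) (column l k))%:R.
pose p : rat := 2^-1 ^+ l.+1.
have colT k : k \in O -> all (fun j => j < lam * m)%N (column l k).
  move=> /(allP Om) km; apply/allP => _ /mapP[l' + ->].
  rewrite mem_iota /= => l'l.
  have : (l'.+1 * m <= lam * m)%N by rewrite leq_mul2r; apply/orP; right; lia.
  by rewrite mulSn; lia.
have colu k : k \in O -> uniq (column l k).
  move=> /(allP Om) km; rewrite map_inj_uniq ?iota_uniq // => x y /addIn /eqP.
  by rewrite eqn_mul2r => /orP[/eqP m0|/eqP //]; lia.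
have E1 k : k \in O -> avg (lam * m) (X k) = p.
  by move=> kO; rewrite avg_all ?colu ?colT // size_map size_iota.
(* Distinct columns share no coin, whence the term [p ^+ 2]; the diagonal contributes [p]. *)
have E2 k k' : k \in O -> k' \in O ->
    avg (lam * m) (fun y => X k y * X k' y) <= p ^+ 2 + (k == k')%:R * p.
  move=> kO k'O; have [<-|ne] := eqVneq k k'.
    rewrite (eq_avg (g := X k)) => [|y _]; last by rewrite -natrM mulnb andbb.
    by rewrite E1 // mul1r lerDr exprn_ge0 // exprn_ge0.
  rewrite (eq_avg (g := fun y => (all (nth false y) (column l k ++ column l k'))%:R)).
    rewrite avg_all; last by rewrite all_cat !colT.
      by rewrite size_cat !size_map size_iota exprD mul0r addr0 expr2.
    rewrite cat_uniq !colu // andbT andTb; apply/hasPn => _ /mapP[x _ ->].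
    apply/mapP => -[y _ E]; move/eqP: ne; apply.
    have := congr1 (modn^~ m) E; rewrite !modnMDl !modn_small //.
      exact: (allP Om).
    exact: (allP Om).
  by move=> y _; rewrite all_cat -natrM mulnb.
have XX y : 2 * (\sum_(k <- O) X k y) +
    - 1 * (\sum_(k <- O) \sum_(k' <- O) X k y * X k' y) <= (isolates l O y)%:R.
  have cE : \sum_(k <- O) X k y = (count (fun k => all (nth false y) (column l k)) O)%:R.
    rewrite /X; elim: (O) => [|k O' IH]; first by rewrite big_nil.
    by rewrite big_cons IH /= natrD.
  have -> : \sum_(k <- O) \sum_(k' <- O) X k y * X k' y =
      (\sum_(k <- O) X k y) * (\sum_(k <- O) X k y).
    by rewrite mulr_suml; apply: eq_bigr => k _; rewrite mulr_sumr.
  rewrite cE /isolates; set c := count _ _.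
  case: c => [|[|c]]; rewrite [_ == _]/= ?mulr0n ?mulr1n; [lra|lra|].
  have -> : c.+2%:R = c%:R + 2 :> rat by rewrite -natrD addn2.
  by have := ler0n rat c; nra.
apply: le_trans (ler_avg (fun y _ => XX y)).
rewrite avgD !avgZ !avg_sum.
have S1 : \sum_(k <- O) avg (lam * m) (X k) = s%:R * p.
  rewrite (eq_big_seq (fun=> p)) => [|k kO]; last exact: E1.
  by rewrite big_const_seq count_predT iter_addr_0 mulr_natl.
have S2 : \sum_(k <- O) avg (lam * m) (fun y => \sum_(k' <- O) X k y * X k' y)
    <= s%:R * (s%:R * p ^+ 2 + p).
  rewrite -[s%:R * _](_ : \sum_(k <- O) (s%:R * p ^+ 2 + p) = _); last first.
    by rewrite big_const_seq count_predT iter_addr_0 [RHS]mulr_natl.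
  rewrite !big_seq; apply: ler_sum => k kO; rewrite avg_sum.
  apply: (@le_trans _ _ (\sum_(k' <- O) (p ^+ 2 + (k == k')%:R * p))).
    by rewrite !big_seq; apply: ler_sum => k' k'O; apply: E2.
  rewrite big_split /= big_const_seq count_predT iter_addr_0 mulr_natl lerD2l.
  rewrite -mulr_suml ler_piMl ?exprn_ge0 //.
  have -> : \sum_(i <- O) (k == i)%:R = (count_mem k O)%:R :> rat.
    elim: (O) => [|i O' IH]; first by rewrite big_nil.
    by rewrite big_cons IH /= natrD eq_sym.
  by rewrite count_uniq_mem // lern1 leq_b1.
rewrite S1; have [lo hi] : 1 / 4 <= s%:R * p /\ s%:R * p <= 1 / 2.
  have t0 : 0 < 2 ^+ t :> rat by rewrite exprn_gt0.
  have pE : p = (4 * 2 ^+ t)^-1.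
    by rewrite /p lE exprVn; congr (_^-1); rewrite !exprS; ring.
  case/andP: sO => s1 s2.
  rewrite -(ler_nat rat) natrX in s1; rewrite -(ltr_nat rat) natrX exprS in s2.
  rewrite pE; move: s1 s2 t0; move: (2 ^+ t) (s%:R) => x y le lt x0.
  have x4 : 0 < 4 * x by lra.
  by split; [rewrite ler_pdivlMr|rewrite ler_pdivrMr]; lra.
move: S2; rewrite (_ : s%:R * _ = s%:R * p * (s%:R * p) + s%:R * p); last by ring.
move: lo hi; move: (s%:R * p) (\sum_(k <- O) _) => x y lo hi le.
(* This product yields [x - x ^ 2 >= x / 4 + 1 / 8]. *)
have : 0 <= (x - 1 / 4) * (1 / 2 - x) by rewrite mulr_ge0 ?subr_ge0.
by move: lo hi le; clear; lra.
Qed.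

(** Each group of samples sees only its own block of [lam * m] coins, so that groups are independent
    repetitions of one experiment. *)
Lemma isolates_block l O r z : all (fun k => k < m)%N O -> (l < lam)%N ->
  isolates l O (take (lam * m) (drop (r * (lam * m)) z)) =
  (count (survives z (r * lam + l)) O == 1%N).
Proof.
move=> Om llam; rewrite /isolates; congr (_ == _); apply: eq_in_count => k /(allP Om) km.
rewrite /survives /column all_map divnMDl ?(leq_trans _ llam) // (divn_small llam) addn0.
rewrite modnMDl (modn_small llam); apply: eq_in_all => l'; rewrite mem_iota /= => l'l.
rewrite nth_take ?nth_drop; last first.
  have : (l'.+1 * m <= lam * m)%N by rewrite leq_mul2r; apply/orP; right; lia.
  by rewrite mulSn; lia.
by congr (nth _ _ _); rewrite mulnDl addnA mulnA.
Qed.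

End Isolation.

Lemma avg_blocks R L (bad : seq bool -> bool) :
  avg (R * L) (fun z => (all (fun r => bad (take L (drop (r * L) z))) (iota 0 R))%:R)
  = avg L (fun y => (bad y)%:R) ^+ R.
Proof.
elim: R => [|R IH]; first by rewrite mul0n expr0.
rewrite mulSn avg_cat exprSr -IH.
rewrite (eq_avg (g := fun y => avg (R * L) (fun z =>
  (all (fun r => bad (take L (drop (r * L) z))) (iota 0 R))%:R) * (bad y)%:R)).
  by rewrite avgZ.
move=> y yL; rewrite mulrC -avgZ; apply: eq_avg => z _.
rewrite -natrM mulnb /= mul0n drop0 (take_size_cat _ yL); congr (_ && _)%:R.
rewrite (iotaDl 1 0) all_map; apply: eq_all => r /=.
by rewrite mulSn addnC -drop_drop (drop_size_cat _ yL).
Qed.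

(** Union bound over [Os]. For each set, only the level adapted to its size is examined in every
    group; it fails in all [R] groups with probability at most [(7 / 8) ^+ R]. *)
Lemma avg_survives lam m R (Os : seq (seq nat)) : (0 < m)%N ->
  all (fun O => [&& uniq O, all (fun k => k < m)%N O, (0 < size O)%N &
                    (2 * size O < 2 ^ lam)%N]) Os ->
  (size Os)%:R * (7 / 8) ^+ R <= 1 / 4 :> rat ->
  3 / 4 <= avg (R * (lam * m)) (fun z =>
    (all (fun O => has (fun q => count (survives lam m z q) O == 1%N)
                       (iota 0 (R * lam))) Os)%:R).
Proof.
move=> m0 /allP OsP small.
pose good z O := has (fun q => count (survives lam m z q) O == 1%N) (iota 0 (R * lam)).
pose bad z O := ~~ good z O.
have union z : 1 + - 1 * (\sum_(O <- Os) (bad z O)%:R) <= (all (good z) Os)%:R :> rat.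
  elim: (Os) => [|O s IH]; first by rewrite big_nil /= mulr0 addr0.
  rewrite big_cons /= /bad; case: (good z O) => /=; first by move: IH; rewrite /bad; lra.
  suff : 0 <= \sum_(j <- s) (bad z j)%:R :> rat by rewrite /bad; lra.
  by apply: sumr_ge0 => *; rewrite ler0n.
apply: le_trans (ler_avg (fun z _ => union z)).
rewrite avgD avgZ avg_cst avg_sum.
suff : \sum_(O <- Os) avg (R * (lam * m)) (fun z => (bad z O)%:R) <= 
    (size Os)%:R * (7 / 8) ^+ R.
  by move: small; move: (_ * _ ^+ R) (\sum_(O <- Os) _) => x y; lra.
rewrite mulr_natl -(count_predT Os) -iter_addr_0 -big_const_seq.
rewrite !big_seq; apply: ler_sum => O /OsP /and4P[uO Om O0 Olam].
have [l0 l1] : (2 ^ trunc_log 2 (size O) <= size O)%N /\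
    (size O < 2 ^ (trunc_log 2 (size O)).+1)%N.
  by rewrite trunc_logP // trunc_log_ltn.
set t := trunc_log _ _ in l0 l1.
(* [2 ^ t.+1 <= 2 * size O < 2 ^ lam], so the adapted level occurs in each group. *)
have tlam : (t.+1 < lam)%N.
  by rewrite -(@ltn_exp2l 2) //; apply: leq_ltn_trans Olam; rewrite expnS leq_mul2l.
have iso := @avg_isolates lam m t.+1 t O uO Om (introT andP (conj l0 l1)) erefl tlam.
pose bb y := ~~ isolates m t.+1 O y.
apply: (@le_trans _ _ (avg (R * (lam * m)) (fun z =>
    (all (fun r => bb (take (lam * m) (drop (r * (lam * m)) z))) (iota 0 R))%:R))).
  apply: ler_avg => z _; rewrite ler_nat; case B : (bad z O) => //.
  rewrite (_ : all _ _ = true) //; apply/allP => r; rewrite mem_iota /= => rR.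
  rewrite /bb isolates_block //; apply/negP => H.
  move/negP: B; apply; apply/hasP; exists (r * lam + t.+1)%N => //.
  rewrite mem_iota /=; have : (r.+1 * lam <= R * lam)%N by rewrite leq_mul2r rR orbT.
  by rewrite mulSn; lia.
rewrite avg_blocks lerXn2r ?nnegrE ?divr_ge0 //.
  by rewrite -(avg_cst (lam * m) 0); apply: ler_avg => y _; rewrite ler0n.
rewrite (eq_avg (g := fun y => 1 + - 1 * (isolates m t.+1 O y)%:R)).
  by rewrite avg_affine; lra.
by move=> y _; rewrite /bb; case: (isolates _ _ _ _); rewrite [nat_of_bool (~~ _)]/= [nat_of_bool _]/= ?mulr0n ?mulr1n; lra.
Qed.

(** * Reading the bits of an optimal index *)

Section ReductionGraph.
Local Open Scope nat_scope.
Variables (n m M lam : nat) (A B : nat -> nat -> nat) (Z : nat -> nat -> bool).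

Definition copy_size : nat := 2 * n + 2 * m * (2 * M + 1).

(* In the copy of index [q * lam + b], the vertices below [n] are the sources,
   those in [n, 2n) the sinks; the others form, for every [k < m], two
   chains [2k] and [2k+1] of [2M+1] vertices.  The chain [2k+1] is reachable
   only if the [b]-th bit of [k] is set, so that the number of shortest paths
   tells the [b]-th bit of an optimal [k]. *)
Definition enters g x y : bool :=
  let c := (y - 2 * n) %/ (2 * M + 1) in
  [&& x < n, 2 * n <= y, (y - 2 * n) %% (2 * M + 1) + A x (c %/ 2) == M,
      Z (g %/ lam) (c %/ 2) & (c %% 2 == 0) || (c %/ 2 %/ 2 ^ (g %% lam) %% 2 == 1)].

Definition advances x y : bool :=
  [&& 2 * n <= x, y == x.+1 & (x - 2 * n) %% (2 * M + 1) < 2 * M].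

Definition leaves x y : bool :=
  [&& 2 * n <= x, n <= y, y < 2 * n &
      (x - 2 * n) %% (2 * M + 1) == M + B ((x - 2 * n) %/ (2 * M + 1) %/ 2) (y - n)].

Definition local_edge g x y : bool :=
  [|| enters g x y, advances x y | leaves x y].

Definition edge u v : bool :=
  (u %/ copy_size == v %/ copy_size) &&
  local_edge (u %/ copy_size) (u %% copy_size) (v %% copy_size).

Lemma edge_irrefl u : edge u u = false.
Proof.
rewrite /edge eqxx /local_edge /enters /advances /leaves; apply/negP => /=.
case/or3P=> [/and5P[]|/and3P[]|/and4P[]]; lia.
Qed.

Hypotheses (AM : forall i k, i < n -> k < m -> A i k <= M)
  (BM : forall k j, k < m -> j < n -> B k j <= M).

Definition chain c p : nat := 2 * n + (c * (2 * M + 1) + p).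

(** From the entrance [M - A i k] to the exit [M + B k j] there are [A i k + B k j + 1] chain
    vertices, followed by the sink. *)
Definition route i j c : seq nat :=
  rcons (iota (chain c (M - A i (c %/ 2))) (A i (c %/ 2) + B (c %/ 2) j).+1) (n + j).

Lemma chain_div c p : p <= 2 * M -> (chain c p - 2 * n) %/ (2 * M + 1) = c.
Proof. by move=> pM; rewrite addKn divnMDl ?addn1 // divn_small ?addn0. Qed.

Lemma chain_mod c p : p <= 2 * M -> (chain c p - 2 * n) %% (2 * M + 1) = p.
Proof. by move=> pM; rewrite addKn modnMDl modn_small // addn1. Qed.

Lemma chainP x : 2 * n <= x ->
  exists c p, [/\ x = chain c p, p <= 2 * M & (x < copy_size) = (c < 2 * m)].
Proof.
move=> nx; exists ((x - 2 * n) %/ (2 * M + 1)), ((x - 2 * n) %% (2 * M + 1)).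
have xE : x = chain ((x - 2 * n) %/ (2 * M + 1)) ((x - 2 * n) %% (2 * M + 1)).
  by rewrite /chain -divn_eq subnKC.
split=> //; first by rewrite -ltnS -[(2 * M).+1]addn1 ltn_mod addn1.
by rewrite /copy_size ltn_divLR ?addn1 // ltn_subLR.
Qed.

Section Routes.
Variables (g i j : nat) (iN : i < n) (jN : j < n).

Definition active c : bool :=
  Z (g %/ lam) (c %/ 2) &&
  ((c %% 2 == 0) || (c %/ 2 %/ 2 ^ (g %% lam) %% 2 == 1)).

Let local_lt x := x < copy_size.

(** Sinks are dead ends: a path can reach one only at its last vertex. *)
Lemma leavesP x y z : leaves x y -> ~~ local_edge g y z.
Proof.
rewrite /local_edge /enters /advances /leaves => /and4P[nx ny y2 _].
apply/negP; case/or3P=> [/and5P[]|/and3P[]|/and4P[]]; lia.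
Qed.

(** Inside a chain the only moves are one step forward and an exit to a sink. The exit towards [j]
    is at the single position [M + B (c %/ 2) j], so the rest of the path is forced. *)
Lemma chain_path c p s : c < 2 * m -> p <= 2 * M ->
  path (local_edge g) (chain c p) s -> last (chain c p) s = n + j ->
  all local_lt s ->
  s = rcons (iota (chain c p).+1 (M + B (c %/ 2) j - p)) (n + j) /\
  p <= M + B (c %/ 2) j.
Proof.
move=> cm; elim: s p => [|y s IH] p pM /=.
  by move=> _; rewrite /chain; lia.
case/andP=> /or3P[/and5P[]||] e.
- by move: e; rewrite /chain; lia.
- case/and3P: e => _ /eqP -> ; rewrite chain_mod // => pM'.
  have -> : (chain c p).+1 = chain c p.+1 by rewrite /chain !addnS.
  move=> ps ls /andP[_ al]; have [-> le] := IH p.+1 pM' ps ls al.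
  split; last exact: ltnW.
  by rewrite -[M + _ - p](subnSK le) /= /chain !addnS.
- move=> ps ls _; have ny := leavesP _ e; case/and4P: e => _ n_y y_2.
  rewrite chain_mod // chain_div // => /eqP pE.
  case: s ps ls {IH} => [|z s] /=; last by rewrite (negPf (ny z)).
  move=> _ yE; move: pE; rewrite yE addKn => pE.
  by rewrite -pE subnn.
Qed.

Lemma path_route s : path (local_edge g) i s -> last i s = n + j ->
  all local_lt s -> exists c, [/\ c < 2 * m, active c & s = route i j c].
Proof.
case: s => [|y s] /=; first by move=> _; lia.
case/andP=> /or3P[/and5P[_ ny]|/and3P[]|/and4P[]]; try by lia.
have [c [p [-> pM ltE]]] := chainP ny.
rewrite chain_mod // chain_div // => /eqP pE Zc bc ps ls /andP[lt al].
rewrite /local_lt ltE in lt.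
exists c; split=> //; first by rewrite /active Zc bc.
have c2 : c %/ 2 < m by rewrite ltn_divLR // mulnC.
have [-> le] := chain_path lt pM ps ls al.
have pE' : M - A i (c %/ 2) = p by rewrite -pE addnK.
rewrite /route pE' /=; congr (_ :: rcons (iota _ _) _).
by rewrite -pE; have := BM c2 jN; have := AM iN c2; lia.
Qed.

Lemma route_path c : c < 2 * m -> active c -> path (local_edge g) i (route i j c).
Proof.
move=> cm /andP[Zc bc]; have c2 : c %/ 2 < m by rewrite ltn_divLR // mulnC.
have := AM iN c2; have := BM c2 jN.
set a := A _ _ in bc *; set b := B _ _ => bM aM.
have chP d p : p + d = M + b -> 
    path (local_edge g) (chain c p) (rcons (iota (chain c p).+1 d) (n + j)).
  elim: d p => [|d IH] p pd.
    rewrite /= andbT /local_edge; apply/or3P/Or33.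
    rewrite /leaves chain_mod ?chain_div; try lia.
    by rewrite addKn -/b -pd addn0 eqxx andbT /chain; lia.
  rewrite /= -[(chain c p).+1](_ : chain c p.+1 = _); last by rewrite /chain !addnS.
  rewrite IH ?andbT; last by lia.
  rewrite /local_edge; apply/or3P/Or32; rewrite /advances chain_mod; last by lia.
  by rewrite /chain; lia.
rewrite /route -/a -/b /=; apply/andP; split; last by apply: chP; lia.
rewrite /local_edge; apply/or3P/Or31; rewrite /enters.
rewrite chain_div ?chain_mod; try lia.
rewrite -/a subnK // eqxx Zc bc iN /chain !andbT /=; lia.
Qed.

Lemma last_route c : last i (route i j c) = n + j.
Proof. by rewrite last_rcons. Qed.

Lemma size_route c : size (route i j c) = (A i (c %/ 2) + B (c %/ 2) j).+2.
Proof. by rewrite size_rcons size_iota. Qed.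

Lemma route_lt c x : c < 2 * m -> x \in route i j c -> x < copy_size.
Proof.
move=> cm; have c2 : c %/ 2 < m by rewrite ltn_divLR // mulnC.
have := AM iN c2; have := BM c2 jN => bM aM.
rewrite mem_rcons inE mem_iota => /orP[/eqP->|/andP[_ lt]]; rewrite /copy_size.
  by lia.
apply: leq_trans lt _; rewrite /chain.
have : c.+1 * (2 * M + 1) <= 2 * m * (2 * M + 1) by rewrite leq_mul2r cm orbT.
by rewrite mulSn; lia.
Qed.

Lemma uniq_route c : uniq (i :: route i j c).
Proof.
rewrite cons_uniq rcons_uniq iota_uniq andbT mem_rcons inE !mem_iota /chain.
lia.
Qed.

Lemma route_neq c : route i j (2 * c) != route i j (2 * c).+1.
Proof.
apply/eqP => /(congr1 (head 0)); rewrite /route /= /chain mulSn.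
have -> : (2 * c).+1 %/ 2 = 2 * c %/ 2 by lia.
by lia.
Qed.
End Routes.

Section Count.
Variables (N : nat) (E : 'M[bool]_N) (g i j k0 : nat) (u v : 'I_N).
Hypotheses (EE : forall x y : 'I_N, E x y = edge x y)
  (gN : g.+1 * copy_size <= N) (iN : i < n) (jN : j < n) (k0m : k0 < m)
  (uE : u = g * copy_size + i :> nat) (vE : v = g * copy_size + (n + j) :> nat)
  (Zk0 : Z (g %/ lam) k0)
  (k0_opt : forall k, k < m -> k != k0 -> Z (g %/ lam) k ->
     A i k0 + B k0 j < A i k + B k j).

Let S := copy_size.

Lemma copy_decode x : x < S -> ((g * S + x) %/ S = g) * ((g * S + x) %% S = x).
Proof.
move=> xS; have S0 : 0 < S by apply: leq_trans xS.
by rewrite divnMDl // divn_small // addn0 modnMDl modn_small.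
Qed.

Lemma copy_lt x : x < S -> g * S + x < N.
Proof. by move=> xS; apply: leq_trans gN; rewrite mulSn addnC ltn_add2r. Qed.

Lemma iS : i < S. Proof. by rewrite /S /copy_size; lia. Qed.
Lemma edge_copy x y : x < S ->
  reflect (exists2 y', y = g * S + y' & (y' < S) && local_edge g x y')
    (edge (g * S + x) y).
Proof.
move=> xS; have S0 : 0 < S by apply: leq_trans xS.
rewrite /edge -/S !(copy_decode xS); apply: (iffP andP) => [[/eqP gE le]|].
  exists (y %% S); last by rewrite ltn_mod S0.
  by rewrite {1}(divn_eq y S) -gE.
by case=> y' -> /andP[y'S le]; rewrite !(copy_decode y'S) eqxx.
Qed.

Lemma path_copy x (w : 'I_N) (p : seq 'I_N) : x < S -> w = g * S + x :> nat ->
  path (fun x y => E x y) w p ->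
  exists s, [/\ map val p = map (addn (g * S)) s, all (fun y => y < S) s &
    path (local_edge g) x s].
Proof.
elim: p x w => [|y p IH] x w xS wE /=; first by exists [::].
case/andP; rewrite EE wE => /(edge_copy _ xS) [y' yE /andP[y'S le]].
move=> /(IH y' y y'S yE) [s [sE sS ps]].
by exists (y' :: s); rewrite /= sE yE y'S sS le ps.
Qed.

(** For the sequences of [copy_pathP], the defaults of [insubd] and [insub_bseq] are never taken:
    the vertices are below [N], and a duplicate-free path fits in the bounded sequence. *)
Definition copy_path (s : seq nat) : N.-bseq 'I_N :=
  insub_bseq N (map (insubd u) (map (addn (g * S)) s)).

Lemma copy_pathP s : all (fun y => y < S) s -> uniq (i :: s) ->
  path (local_edge g) i s -> last i s = n + j ->
  map val (copy_path s) = map (addn (g * S)) s /\ is_path E u v (copy_path s).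
Proof.
move=> sS us ps ls.
pose p := map (insubd u) (map (addn (g * S)) s).
have pE : map val p = map (addn (g * S)) s.
  rewrite -map_comp map_id_in // => y /mapP[z zs ->] /=.
  by rewrite insubdK //; apply: copy_lt; exact: (allP sS).
have up : uniq (u :: p).
  rewrite -(map_inj_uniq val_inj) map_cons pE [val u]uE.
  by rewrite -(map_cons (addn (g * S))) (map_inj_uniq (@addnI _)).
have pN : size p <= N.
  by have := uniq_leq_size up (s2 := enum 'I_N) (fun x _ => mem_enum _ _); rewrite size_enum_ord => /ltnW.
have cE : copy_path s = p :> seq _ by rewrite /copy_path insubdK.
rewrite cE; split=> //; rewrite /is_path up andbT; apply/andP; split; last first.
  apply/eqP/val_inj; rewrite -[LHS]last_map pE [val u]uE [RHS]vE -ls.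
  by rewrite last_map.
have {cE pN up ls us} : all (fun y => y < S) (i :: s) by rewrite /= iS.
move: u uE pE ps; rewrite -/p; elim: (s) p (i) => [|y t IH] [|y' p] x //= w wE.
move=> [y'E pE] /andP[le pt] /and3P[xS yS tS].
rewrite EE wE y'E; apply/andP; split.
  by apply/(edge_copy _ xS); exists y; rewrite ?yS.
by apply: IH (pE) pt _ => //=; rewrite yS.
Qed.

(** The paths from [u] to [v] are the routes through active chains. Strict optimality of [k0] among
    the sampled indices leaves two chains: [2 * k0], which is active, and [2 * k0 + 1], active
    exactly when the bit is 1. *)
Lemma count_isolated :
  count_shortest_paths E u v = (k0 %/ 2 ^ (g %% lam) %% 2).+1.
Proof.
pose R c := copy_path (route i j c).
have activeE c : c %/ 2 = k0 -> active g c =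
    (c %% 2 == 0) || (k0 %/ 2 ^ (g %% lam) %% 2 == 1).
  by rewrite /active => ->; rewrite Zk0.
have RP c : c < 2 * m -> active g c ->
    map val (R c) = map (addn (g * S)) (route i j c) /\ is_path E u v (R c).
  move=> cm ac; apply: copy_pathP.
  - by apply/allP => x; apply: route_lt.
  - exact: uniq_route.
  - exact: route_path ac.
  - exact: last_route.
have sizeR c : c < 2 * m -> active g c ->
    size (R c) = (A i (c %/ 2) + B (c %/ 2) j).+2.
  by move=> cm ac; rewrite -(size_map val) (RP c cm ac).1 size_map size_route.
have RE (p : N.-bseq 'I_N) : is_path E u v p ->
    exists c, [/\ c < 2 * m, active g c & p = R c].
  case/and3P=> pp /eqP lp _; have [s [sE sS ps]] := path_copy iS uE pp.
  have ls : last i s = n + j.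
    apply/eqP; rewrite -(eqn_add2l (g * S)) -vE -lp.
    by rewrite -[X in _ == X]last_map sE [val u]uE last_map.
  have [c [cm ac scE]] := path_route iN jN ps ls sS.
  exists c; split=> //; apply/val_inj/(inj_map val_inj).
  by rewrite (RP c cm ac).1 -scE.
have m0 : 2 * k0 < 2 * m by lia.
have a0 : active g (2 * k0) by rewrite activeE; lia.
have h0 : 2 * k0 %/ 2 = k0 by lia.
have h1 : (2 * k0).+1 %/ 2 = k0 by lia.
have shortP (p : N.-bseq 'I_N) : reflect
    (exists c, [/\ c < 2 * m, active g c, c %/ 2 = k0 & p = R c])
    (is_shortest_path E u v p).
  apply: (iffP andP) => [[pp /forallP short]|[c [cm ac cE ->]]].
    have [c [cm ac pE]] := RE p pp; exists c; split=> //.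
    apply/eqP/contraT => cne; have := short (R (2 * k0)).
    rewrite (RP _ m0 a0).2 /= pE !sizeR // h0.
    have := @k0_opt (c %/ 2) _ cne (andP ac).1.
    by rewrite ltn_divLR // mulnC cm => /(_ isT); lia.
  split; first exact: (RP c cm ac).2.
  apply/forallP => p1; apply/implyP => /RE [d [dm ad ->]].
  rewrite !sizeR // cE !ltnS; have [->//|dne] := eqVneq (d %/ 2) k0.
  by apply/ltnW/k0_opt => //; [rewrite ltn_divLR // mulnC|case/andP: ad].
rewrite /count_shortest_paths; case: (eqVneq (k0 %/ 2 ^ (g %% lam) %% 2) 1) => [bit|nbit].
  have m1 : (2 * k0).+1 < 2 * m by lia.
  have a1 : active g (2 * k0).+1 by rewrite activeE // bit orbT.
  rewrite bit (_ : [set p | _] = [set R (2 * k0); R (2 * k0).+1]).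
    rewrite cards2 (_ : _ != _) //; apply/negP => /eqP.
    move/(congr1 (fun p : N.-bseq 'I_N => map val p)); rewrite !(RP _ _ _).1 //.
    by move/(inj_map (@addnI _))/eqP; apply/negP/route_neq.
  apply/setP => p; rewrite !inE; apply/shortP/orP.
    case=> c [_ _ cE ->]; have [->|->] : c = 2 * k0 \/ c = (2 * k0).+1 by lia.
      by left.
    by right.
  by case=> /eqP ->; [exists (2 * k0)|exists (2 * k0).+1].
rewrite (_ : _ %% 2 = 0); last by lia.
rewrite (_ : [set p | _] = [set R (2 * k0)]) ?cards1 //.
apply/setP => p; rewrite !inE; apply/shortP/eqP => [|->]; last by exists (2 * k0).
case=> c [_ ac cE ->]; rewrite activeE // (negPf nbit) orbF in ac.
by congr R; lia.
Qed.
End Count.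
End ReductionGraph.

(** * Expressions and their compilation *)

(** Values are natural numbers with truncated subtraction, and there is no branching: an expression
    compiles to straight-line code, whose running time does not depend on the data. *)
Inductive expr :=
  | Num of nat
  | Idx
  | Flip
  | Get of nat & expr
  | Bin of binop & expr & expr.

Definition pospart (x : int) : nat := if x is Posz k then k else 0%N.

Definition nat_binop (o : binop) : nat -> nat -> nat :=
  match o with Add => addn | Defs.Sub => subn | Mul => muln | Div => divn end.

Section Evaluation.
Variables (G : nat) (m : nat -> int) (i : nat) (b : bool).

Fixpoint eval (e : expr) : nat :=
  match e with
  | Num z => z
  | Idx => i
  | Flip => b
  | Get r e => pospart (m (r * G + eval e)%N)
  | Bin o e1 e2 => nat_binop o (eval e1) (eval e2)
  end.

End Evaluation.

(** An exponent such that all values are at most [V ^ weight e]. [Get] also counts its region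
    number, so that [V ^ weight e < G] forces this number below [G]. *)
Fixpoint weight (e : expr) : nat :=
  match e with
  | Num z => z.+1
  | Idx | Flip => 1
  | Get r e => (r + weight e).+1
  | Bin _ e1 e2 => weight e1 + weight e2
  end.

(* For [v] in register [d], [v %/ (v * v + 1)] is [-1] or [0] according to
   the sign of [v], so that the code replaces [v] by its positive part. *)
Definition clamp (d : nat) : seq instr :=
  [:: Arith Mul d.+1 d d; Const d.+2 1; Arith Add d.+1 d.+1 d.+2;
      Arith Div d.+1 d d.+1; Arith Add d.+1 d.+1 d.+2; Arith Mul d d d.+1].

(** Stack discipline: the value ends in register [d], and the registers below [d] are preserved. A
    register is copied by adding it to 0; in [Arith Add d d 1] the last operand is register 1, the
    loop index. *)
Fixpoint compile_expr (d : nat) (e : expr) : seq instr :=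
  match e with
  | Num z => [:: Const d z]
  | Idx => [:: Const d 0; Arith Add d d 1]
  | Flip => [:: Const d 0; Arith Add d d 2]
  | Get r e => compile_expr d e ++
      [:: Const d.+1 r; Arith Mul d.+1 d.+1 0; Arith Add d d d.+1; Read d d]
      ++ clamp d
  | Bin o e1 e2 => compile_expr d e1 ++ compile_expr d.+1 e2 ++
      [:: Arith o d d d.+1] ++ clamp d
  end.

Lemma straight_compile_expr d e : all straight (compile_expr d e).
Proof.
elim: e d => //= [r e IH|o e1 IH1 e2 IH2] d.
  by rewrite all_cat IH.
by rewrite !all_cat IH1 IH2.
Qed.

Lemma upd_same f k v : upd f k v k = v.
Proof. by rewrite /upd eqxx. Qed.

Lemma upd_other f k v j : j != k -> upd f k v j = f j.
Proof. by rewrite /upd => /negPf ->. Qed.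

(** * Symbolic execution of straight-line code *)

Section StraightLine.
Variable B : nat.
Local Notation sexec := (sexec B).

Lemma sexec_const r z c k f m : (`|z| < B)%N ->
  sexec (Const r z :: c) (State k f m) = sexec c (State k.+1 (upd f r z) m).
Proof. by move=> zB; rewrite sexec_cons /= /set_reg zB. Qed.

Lemma sexec_arith o r r1 r2 v c k f m : eval_binop o (f r1) (f r2) = v ->
  (`|v| < B)%N ->
  sexec (Arith o r r1 r2 :: c) (State k f m) =
  sexec c (State k.+1 (upd f r v) m).
Proof. by move=> vE vB; rewrite sexec_cons /= vE /set_reg vB. Qed.

Lemma sexec_read r r1 a c k f m : f r1 = Posz a -> (`|m a| < B)%N ->
  sexec (Read r r1 :: c) (State k f m) =
  sexec c (State k.+1 (upd f r (m a)) m).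
Proof. by move=> aE vB; rewrite sexec_cons /= aE /set_reg vB. Qed.

Lemma sexec_write r1 r2 a c k f m : f r1 = Posz a ->
  sexec (Write r1 r2 :: c) (State k f m) =
  sexec c (State k.+1 f (upd m a (f r2))).
Proof. by move=> aE; rewrite sexec_cons /= aE. Qed.

Definition computes (c : seq instr) (d : nat) (s : state) (v : int) :=
  exists s', [/\ sexec c s = Some s', memory s' = memory s,
    forall r, (r < d)%N -> reg s' r = reg s r & reg s' d = v].

Lemma sign_div (v : int) :
  (v %/ (v * v + 1))%Z = if v is Negz _ then -1 else 0.
Proof.
case: v => k.
  by rewrite divz_small //; apply/andP; split; nia.
have Hp : 0 < Negz k * Negz k + 1 :> int by nia.
(* Adding the divisor [v * v + 1] once brings a negative [v] into the range of remainders. *)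
rewrite [X in (X %/ _)%Z](_ : Negz k = -1 * (Negz k * Negz k + 1) +
  (Negz k * Negz k + 1 + Negz k)); last by ring.
rewrite divzMDl; last by lia.
by rewrite divz_small ?addr0 //; apply/andP; split; nia.
Qed.

Lemma clamp_computes d s : (0 < d)%N ->
  (`|reg s d| * `|reg s d| + 1 < B)%N ->
  computes (clamp d) d s (pospart (reg s d)).
Proof.
move=> d0; case: s => pcs rg mm /=; set v := rg d => vB.
have n1 : (d == d.+1) = false by lia.
have n2 : (d.+1 == d.+2) = false by lia.
have n3 : (d == d.+2) = false by lia.
have n4 : (d.+2 == d.+1) = false by lia.
have n5 : (d.+1 == d) = false by lia.
eexists; split.
- rewrite /clamp (sexec_arith _ (v := v * v)); [|by []|by lia].
  rewrite sexec_const; last by lia.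
  rewrite (sexec_arith _ (v := v * v + 1)); [|by rewrite /= /upd /= !eqxx n2|by lia].
  rewrite (sexec_arith _ (v := (v %/ (v * v + 1))%Z)); last first.
  + by rewrite sign_div; case: (v) vB => k /=; lia.
  + by rewrite /= /upd /= !eqxx n1 n3.
  rewrite (sexec_arith _ (v := (v %/ (v * v + 1))%Z + 1)); last first.
  + by rewrite sign_div; case: (v) vB => k /=; lia.
  + by rewrite /= /upd /= !eqxx n4.
  rewrite (sexec_arith _ (v := Posz (pospart v))); first by [].
  + rewrite /= /upd /= !eqxx n1 n3 -/v sign_div; case: (v) => k.
    * by rewrite add0r mulr1.
    * by rewrite addNr mulr0.
  + by case: (v) vB => k /=; nia.
- by [].
- move=> r rd /=; rewrite !upd_other //; lia.
- by rewrite /= upd_same.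
Qed.

Lemma computes_cat c1 c2 d s v1 v : computes c1 d s v1 ->
  (forall s', memory s' = memory s -> (forall r, (r < d)%N -> reg s' r = reg s r) ->
     reg s' d = v1 -> computes c2 d s' v) ->
  computes (c1 ++ c2) d s v.
Proof.
move=> [s1 [e1 m1 r1 v1E]] /(_ s1 m1 r1 v1E) [s2 [e2 m2 r2 v2E]].
exists s2; split=> //; first by rewrite sexec_cat e1.
- by rewrite m2.
- by move=> r rd; rewrite r2 // r1.
Qed.

End StraightLine.

Lemma pospart_le x : (pospart x <= `|x|)%N.
Proof. by case: x. Qed.

Section CompileExpr.
Variables (B G V : nat).
Hypotheses (V2 : (1 < V)%N) (GB : (G ^ 2 < B)%N).

(** Both powers are at least 2, so their product dominates their sum; one bound thus serves for all
    four operations. *)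
Lemma expnD_ge a b : (0 < a)%N -> (0 < b)%N -> (V ^ a + V ^ b <= V ^ (a + b))%N.
Proof.
move=> a0 b0; rewrite expnD.
have : (1 < V ^ a)%N by rewrite -[1%N](expn0 V) ltn_exp2l.
have : (1 < V ^ b)%N by rewrite -[1%N](expn0 V) ltn_exp2l.
by set x := (V ^ a)%N; set y := (V ^ b)%N; nia.
Qed.

Lemma weight_gt0 e : (0 < weight e)%N.
Proof. by elim: e => //= o e1 IH1 e2 IH2; rewrite addn_gt0 IH1. Qed.

Lemma expn_gt z : (z < V ^ z.+1)%N.
Proof. by apply: leq_trans (ltn_expl z.+1 V2); lia. Qed.

Section Eval.
Variables (m : nat -> int) (i : nat) (b : bool).
Hypotheses (mV : forall x, (`|m x| <= V)%N) (iV : (i <= V)%N).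

Lemma eval_le e : (eval G m i b e <= V ^ weight e)%N.
Proof.
elim: e => [z|||r e IH|o e1 IH1 e2 IH2] /=.
- exact/ltnW/expn_gt.
- by rewrite expn1.
- by rewrite expn1; case: b => //; exact: ltnW.
- apply: leq_trans (pospart_le _) _; apply: leq_trans (mV _) _.
  by rewrite -[V in (V <= _)%N]expn1 leq_exp2l.
- have [w1 w2] := (weight_gt0 e1, weight_gt0 e2).
  have le12 := expnD_ge w1 w2.
  case: o => /=.
  + by apply: leq_trans le12; rewrite leq_add.
  + by apply: leq_trans le12; apply: leq_trans (leq_subr _ _) _; lia.
  + by rewrite expnD leq_mul.
  + by apply: leq_trans le12; apply: leq_trans (leq_div _ _) _; lia.
Qed.

End Eval.

(** All values stay below [G], and [G ^ 2 < B] leaves room for the addresses [r * G + o] and for the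
    squares formed by [clamp]. *)
Lemma compile_expr_computes i (b : bool) e d (s : state) : (2 < d)%N -> (i <= V)%N ->
  (forall x, `|memory s x| <= V)%N ->
  reg s 0 = G -> reg s 1 = i -> reg s 2 = (b : nat) ->
  (V ^ weight e < G)%N ->
  computes B (compile_expr d e) d s (eval G (memory s) i b e).
Proof.
move=> d2 iV.
have ZG (x : int) : (`|x| < G)%N -> (`|x| * `|x| + 1 < B)%N.
  by move=> xG; apply: leq_ltn_trans GB; nia.
have GB' : (G < B)%N by apply: leq_ltn_trans GB; nia.
elim: e d d2 s => [z|||r e IH|o e1 IH1 e2 IH2] d d2 [k f m] /= mV s0 s1 s2 wG.
- have zB : (`|Posz z| < B)%N.
    by apply: ltn_trans GB'; apply: ltn_trans wG; exact: expn_gt.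
  exists (State k.+1 (upd f d z) m); split=> //=.
  + by rewrite sexec_const.
  + by move=> r rd; rewrite upd_other // ltn_eqF.
  + exact: upd_same.
- have iB : (`|Posz i| < B)%N.
    by apply: ltn_trans GB'; apply: leq_ltn_trans wG; rewrite /= expn1.
  eexists; split.
  + rewrite sexec_const; last by lia.
    rewrite (sexec_arith _ (v := Posz i)) //=.
    by rewrite upd_same upd_other ?s1 ?add0r // ltn_eqF // ltnW.
  + by [].
  + by move=> r rd; rewrite /= !upd_other // ltn_eqF.
  + exact: upd_same.
- eexists; split.
  + rewrite sexec_const; last by lia.
    rewrite (sexec_arith _ (v := Posz b)) //=; last by case: (b); lia.
    by rewrite upd_same upd_other ?s2 ?add0r // ltn_eqF.
  + by [].
  + by move=> r rd; rewrite /= !upd_other // ltn_eqF.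
  + exact: upd_same.
- have we : (V ^ weight e < G)%N.
    apply: leq_ltn_trans wG; rewrite leq_exp2l //=; lia.
  have rG : (r < G)%N.
    apply: leq_ltn_trans wG; apply: leq_trans (ltnW (ltn_expl r V2)) _.
    rewrite leq_exp2l //=; lia.
  apply: computes_cat (IH d d2 (State k f m) mV s0 s1 s2 we) _ => -[k' f' m'] /= ->{m'} r' v'.
  set o := eval _ _ _ _ _ in v' *.
  have oG : (o < G)%N by apply: leq_ltn_trans we; apply: eval_le.
  have aB : (r * G + o < B)%N by apply: leq_ltn_trans GB; nia.
  set x := m (r * G + o)%N.
  have xG : (`|x| < G)%N.
    apply: leq_ltn_trans (mV _) _; apply: leq_ltn_trans wG.
    by rewrite -[V in (V <= _)%N]expn1 leq_exp2l.
  pose s4 := State k'.+4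
    (upd (upd (upd (upd f' d.+1 r) d.+1 (r * G)%N) d (r * G + o)%N) d x) m.
  have [|s5 [e5 m5 r5 v5]] := @clamp_computes B d s4 (ltn_trans (isT : (0 < 2)%N) d2).
    by rewrite /= upd_same ZG.
  exists s5; split.
  + rewrite sexec_const; last by rewrite /=; lia.
    rewrite (sexec_arith _ (v := Posz (r * G))); last first.
    * by rewrite /=; lia.
    * by rewrite /= upd_same upd_other // r' ?s0 //; lia.
    rewrite (sexec_arith _ (v := Posz (r * G + o))); last first.
    * exact: aB.
    * by rewrite /= upd_same !upd_other ?v' 1?addrC //; lia.
    rewrite (sexec_read _ (a := (r * G + o)%N)) /=; last first.
    * by apply: ltn_trans GB'.
    * by rewrite upd_same.
    by rewrite -e5.
  + by rewrite m5.
  + by move=> j jd; rewrite r5 //= !upd_other ?r' //; lia.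
  + by rewrite v5 /= upd_same.
- have [w1 w2] := (weight_gt0 e1, weight_gt0 e2).
  have we1 : (V ^ weight e1 < G)%N.
    by apply: leq_ltn_trans wG; rewrite leq_exp2l //= leq_addr.
  have we2 : (V ^ weight e2 < G)%N.
    by apply: leq_ltn_trans wG; rewrite leq_exp2l //= leq_addl.
  apply: computes_cat (IH1 d d2 (State k f m) mV s0 s1 s2 we1) _ => -[k' f' m'] /= ->{m'} r' v'.
  have [|||||[k3 f3 m3] /= [e3 m3E r3 v3]] := IH2 d.+1 _ (State k' f' m) _ _ _ _ we2.
  + by lia.
  + by [].
  + by rewrite /= r' //; lia.
  + by rewrite /= r' //; lia.
  + by rewrite /= r' //; lia.
  subst m3; have h1 := eval_le b mV iV e1; have h2 := eval_le b mV iV e2.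
  move: v' v3 h1 h2.
  set x := eval _ _ _ _ e1; set y := eval _ _ _ _ e2 => v' v3 h1 h2.
  have hB := eval_le b mV iV (Bin o e1 e2).
  have [v vE [vN vG]] : exists2 v, eval_binop o (Posz x) (Posz y) = v &
      pospart v = nat_binop o x y /\ (`|v| < G)%N.
    move: hB; rewrite /= -/x -/y; case: (o) => /= hB.
    + by exists (Posz (x + y)) => //; split => //; apply: leq_ltn_trans wG.
    + exists (Posz x - Posz y) => //; split.
        have [yx|xy] := leqP y x; first by rewrite subzn.
        have -> : (x - y = 0)%N by move: (x) (y) xy => x' y'; lia.
        have -> // : Posz x - Posz y = Negz (y - x).-1.
        by move: (x) (y) xy => x' y'; lia.
      have := leq_ltn_trans h1 we1; have := leq_ltn_trans h2 we2.
      by move: (x) (y) => x' y'; lia.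
    + by exists (Posz (x * y)) => //; split => //; apply: leq_ltn_trans wG.
    + by exists (Posz (x %/ y)) => //; rewrite ?divz_nat //; split => //; apply: leq_ltn_trans wG.
  pose s4 := State k3.+1 (upd f3 d v) m.
  have [|s5 [e5 m5 r5 v5]] := @clamp_computes B d s4 (ltn_trans (isT : (0 < 2)%N) d2).
    by rewrite /= upd_same ZG.
  exists s5; split.
  + rewrite sexec_cat e3 /= (sexec_arith _ (v := v)) //.
    * by rewrite v3 r3 ?v' ?vE.
    * by apply: ltn_trans GB'.
  + by rewrite m5.
  + by move=> j jd; rewrite r5 //= upd_other ?r3 ?r' //; lia.
  + by rewrite v5 /= upd_same vN.
Qed.

End CompileExpr.

(** * Programs with loops and an oracle *)

(* [Loop r cnt e] writes the value of [e] at [Idx = a] in cell [a] of region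
   [r], for [a < cnt] in turn, with a fresh coin [Flip] each time; [Call r]
   runs the oracle program on region [r].  Register 0 holds the region size
   [G], register 1 the index, register 2 the coin, register 3 the loop bound;
   region [r] is the set of addresses in [[r * G, (r + 1) * G)]. *)
Inductive cmd := Loop of nat & expr & expr | Call of nat.

Definition instr_regs (i : instr) : seq nat :=
  match i with
  | Const r _ | Coin r | Jump r _ => [:: r]
  | Arith _ r r1 r2 => [:: r; r1; r2]
  | Read r r1 | Write r r1 => [:: r; r1]
  end.

Definition reg_count (P : program) : nat :=
  (\max_(i <- P) \max_(r <- instr_regs i) r.+1)%N.

Section Compilation.
Variable P : program.

Definition loop_pre (cnt : expr) : seq instr :=
  [:: Const 1 0; Const 2 0] ++ compile_expr 4 cnt ++
  [:: Const 3 0; Arith Add 3 3 4].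

Definition loop_post (r : nat) : seq instr :=
  [:: Const 5 r; Arith Mul 5 5 0; Arith Add 5 5 1; Write 5 4; Const 5 1;
      Arith Add 1 1 5; Arith Defs.Sub 5 3 1].

(** The test comes after the body, which is therefore executed at least once; this is the origin of
    the condition [0 < N] on loops. *)
Definition loop_code (off r : nat) (cnt e : expr) : seq instr :=
  loop_pre cnt ++
  Coin 2 :: (compile_expr 4 e ++ loop_post r) ++ [:: Jump 5 (off + size (loop_pre cnt))].

Definition loop_time (r : nat) (cnt e : expr) (N : nat) : nat :=
  (size (loop_pre cnt) + N * (size (compile_expr 4 e ++ loop_post r)).+2)%N.

(* The memory of [P] is shifted by the content of register 4, and its
   registers by 8.  All blocks have length 2, so that the program counters
   are related by an affine map. *)
Definition shift_instr (off : nat) (i : instr) : seq instr :=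
  match i with
  | Const r z => [:: Const 5 0; Const (r + 8) z]
  | Arith o r r1 r2 => [:: Const 5 0; Arith o (r + 8) (r1 + 8) (r2 + 8)]
  | Read r r1 => [:: Arith Add 5 (r1 + 8) 4; Read (r + 8) 5]
  | Write r1 r2 => [:: Arith Add 5 (r1 + 8) 4; Write 5 (r2 + 8)]
  | Coin r => [:: Const 5 0; Coin (r + 8)]
  | Jump r l => [:: Const 5 0; Jump (r + 8) (off + 2 * minn l (size P))]
  end%N.

(** Register 4 receives the base address of the region. The registers of the oracle are cleared
    because its run starts from zero registers, and those of the host are left over from earlier
    commands. *)
Definition call_pre (r : nat) : seq instr :=
  [:: Const 4 r; Arith Mul 4 4 0] ++
  [seq Const (i + 8) 0 | i <- iota 0 (reg_count P)].

Definition embed (off : nat) : seq instr :=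
  flatten [seq shift_instr off i | i <- P].

Definition call_code (off r : nat) : seq instr :=
  call_pre r ++ embed (off + size (call_pre r)).

Definition cmd_code (off : nat) (c : cmd) : seq instr :=
  match c with
  | Loop r cnt e => loop_code off r cnt e
  | Call r => call_code off r
  end.

Fixpoint compile (off : nat) (cs : seq cmd) : seq instr :=
  if cs is c :: cs' then
    cmd_code off c ++ compile (off + size (cmd_code off c)) cs'
  else [::].

End Compilation.

(** * Proof rules for loops *)

Section Fill.
Variable G : nat.

Definition fill (m : nat -> int) (r N : nat) (h : nat -> nat) : nat -> int :=
  fun x => if (r * G <= x < r * G + N)%N then Posz (h (x - r * G)%N) else m x.

Lemma fill0 m r h : fill m r 0 h = m.
Proof. by apply/funext=> x; rewrite /fill; case: ifP => //; lia. Qed.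

Lemma fillS m r a h : fill m r a.+1 h = upd (fill m r a h) (r * G + a) (h a).
Proof.
apply/funext=> x; rewrite /fill /upd; case: (eqVneq x (r * G + a)%N) => [->|ne].
  by rewrite leq_addr addnS ltnSn addKn.
by congr (if _ then _ else _); move/eqP: ne; lia.
Qed.

End Fill.

Section Judgement.
Variables (P Q : program) (B G V : nat) (F : option state -> bool).
Hypothesis F_absorbing : forall s b, F s -> F (step Q B s b).
Hypotheses (V2 : (1 < V)%N) (GB : (G ^ 2 < B)%N).

Local Notation pr := (pr Q B F).
Local Notation fill := (fill G).

(* From a state about to execute the code of [cs], which ends the program [Q],
   with memory [m], the event [F] holds after [T] steps with probability at
   least [v]. *)
Definition attains (cs : seq cmd) (T : nat) (m : nat -> int) (v : rat) : Prop :=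
  forall s, drop (pc s) Q = compile P (pc s) cs -> reg s 0 = G ->
  memory s = m -> v <= pr T (Some s).

Lemma attains_homo cs S T m u v : (S <= T)%N -> u <= v -> attains cs S m v ->
  attains cs T m u.
Proof.
move=> ST uv vS s d0 s0 sm; apply: le_trans uv (le_trans (vS s d0 s0 sm) _).
exact: pr_homo.
Qed.

Lemma attains_nil T m : (forall s, halted Q s -> memory s = m -> F (Some s)) ->
  attains [::] T m 1.
Proof.
move=> Fm s /= d0 _ sm; have Fs : F (Some s).
  by apply: Fm => //; rewrite /halted -subn_eq0 -size_drop d0.
by apply: le_trans (pr_homo F_absorbing _ (leq0n T)); rewrite pr0 Fs.
Qed.

Section LoopRule.
Variables (m : nat -> int) (r : nat) (e : expr) (N : nat).

Fixpoint loop_mem (z : seq bool) (a : nat) : nat -> int :=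
  if a is a'.+1 then
    let m' := loop_mem z a' in
    upd m' (r * G + a') (eval G m' a' (nth false z a') e)
  else m.

Lemma loop_mem_take z1 z2 a : take a z1 = take a z2 ->
  loop_mem z1 a = loop_mem z2 a.
Proof.
elim: a => //= a IH tE; have tE' : take a z1 = take a z2.
  by have := congr1 (take a) tE; rewrite !take_takel.
rewrite (IH tE'); congr (upd _ _ (Posz (eval _ _ _ _ _))).
by rewrite -(nth_take false (ltnSn a)) tE nth_take.
Qed.

(** A loop evaluates a recurrence: at iteration [a] the cells [h 0, ..., h (a - 1)] are already in
    the region, and the expression may read them. *)
Lemma loop_mem_fill z h a : (a <= N)%N ->
  (forall a, (a < N)%N -> eval G (fill m r a h) a (nth false z a) e = h a) ->
  loop_mem z a = fill m r a h.
Proof.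
move=> aN eE; elim: a aN => [|a IH] aN /=; first by rewrite fill0.
by rewrite IH 1?ltnW // eE // -fillS.
Qed.

Hypotheses (NV : (N <= V)%N) (mV : forall x, (`|m x| <= V)%N)
  (eG : (V ^ weight e < G)%N) (rG : (r < G)%N)
  (eV : forall z a, (a < N)%N ->
     (eval G (loop_mem z a) a (nth false z a) e <= V)%N).

Lemma loop_mem_le z a x : (a <= N)%N -> (`|loop_mem z a x| <= V)%N.
Proof.
elim: a => //= a IH aN; rewrite /upd; case: ifP => _; first exact: eV.
exact/IH/ltnW.
Qed.


Lemma loop_body_sexec (b : bool) a k (f : nat -> int) m' :
  (forall x, (`|m' x| <= V)%N) -> (a < N)%N -> f 0%N = G -> f 1%N = a ->
  f 2%N = (b : nat) -> f 3%N = N ->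
  exists s', [/\ sexec B (compile_expr 4 e ++ loop_post r) (State k f m') = Some s',
    reg s' 0 = G, reg s' 1 = a.+1, reg s' 3 = N & reg s' 5 = Posz (N - a.+1)] /\
    memory s' = upd m' (r * G + a) (eval G m' a b e).
Proof.
move=> m'V aN f0 f1 f2 f3.
have aV : (a <= V)%N by rewrite (leq_trans (ltnW aN)).
have VG : (V < G)%N.
  apply: leq_ltn_trans eG; rewrite -[V in (V <= _)%N]expn1 leq_exp2l //.
  exact: weight_gt0.
have GB' : (G < B)%N by apply: leq_ltn_trans GB; nia.
have [[k1 f1' m1] /= [e1 m1E r1 v1]] := @compile_expr_computes B G V V2 GB
  a b e 4 (State k f m') isT aV m'V f0 f1 f2 eG.
subst m1; have aB : (r * G + a < B)%N by apply: leq_ltn_trans GB; nia.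
have g0 : f1' 0%N = G by rewrite r1.
have g1 : f1' 1%N = a by rewrite r1.
have g3 : f1' 3%N = N by rewrite r1.
eexists; split; [split|].
- rewrite sexec_cat e1 /= sexec_const; last by rewrite /=; lia.
  rewrite (sexec_arith _ (v := Posz (r * G))) /=; last first.
  + by lia.
  + by rewrite /upd /= g0.
  rewrite (sexec_arith _ (v := Posz (r * G + a))) /=; last first.
  + exact: aB.
  + by rewrite /upd /= g1.
  rewrite (sexec_write _ _ (a := (r * G + a)%N)); last by rewrite upd_same.
  rewrite sexec_const; last by rewrite /=; lia.
  rewrite (sexec_arith _ (v := Posz a.+1)) /=; last first.
  + by lia.
  + by rewrite /upd /= g1; lia.
  rewrite (sexec_arith _ (v := Posz (N - a.+1))) /=; last first.
  + by lia.
  + by rewrite /upd /= g3; lia.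
  by [].
- by rewrite /upd /=.
- by rewrite /upd /=.
- by rewrite /upd /=.
- by rewrite /upd /=.
- by rewrite /= !upd_other // v1.
Qed.

(** Induction on the number of remaining iterations. The coins already tossed are in [y], and each
    [Coin] splits one level of the average. *)
Lemma pr_loop L rest T v n y s :
  drop L Q = Coin 2 :: (compile_expr 4 e ++ loop_post r) ++ Jump 5 L :: rest ->
  (forall z s, size z = N -> drop (pc s) Q = rest ->
     pc s = (L + (size (compile_expr 4 e ++ loop_post r)).+2)%N ->
     reg s 0 = G -> memory s = loop_mem z N ->
     v z <= pr T (Some s)) ->
  (size y + n.+1 = N)%N -> pc s = L -> reg s 0 = G -> reg s 1 = size y ->
  reg s 3 = N -> memory s = loop_mem y (size y) ->
  avg n.+1 (fun z => v (y ++ z)) <=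
    pr (n.+1 * (size (compile_expr 4 e ++ loop_post r)).+2 + T) (Some s).
Proof.
move=> dL restP; set body := _ ++ loop_post r in dL restP *.
have sbody : all straight body by rewrite all_cat straight_compile_expr.
have B1 : (1 < B)%N.
  apply: leq_ltn_trans GB; have : (0 < V ^ weight e)%N by rewrite expn_gt0 (ltnW V2).
  by move: eG; case: (G) => // G' _ _; rewrite expn_gt0.
have iter (z : seq bool) (b : bool) (f : nat -> int) m' U :
    (size z < N)%N -> f 0%N = G -> f 1%N = size z -> f 3%N = N ->
    m' = loop_mem z (size z) -> exists s',
    [/\ pr ((size body).+1 + U) (Some (State L.+1 (upd f 2 (b : nat)) m')) = pr U (Some s'),
      pc s' = if (size z).+1 == N then (L + (size body).+2)%N else L,
      reg s' 0 = G, reg s' 1 = (size z).+1 & reg s' 3 = N] /\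
      memory s' = loop_mem (rcons z b) (size z).+1.
  move=> zN f0 f1 f3 ->.
  have m'V x : (`|loop_mem z (size z) x| <= V)%N by apply/loop_mem_le/ltnW.
  have [s' [[e' s'0 s'1 s'3 s'5] ms']] :=
    @loop_body_sexec b (size z) L.+1 (upd f 2 (b : nat)) _ m'V zN f0 f1 (upd_same _ _ _) f3.
  have pc' := pc_sexec sbody e'.
  have [_ _ dL1] := @drop_cons_step Q (State L f m') _ _ dL.
  have [prE dL2] := @pr_sexec Q B F (U.+1) _ _ (State L.+1 _ _) s' sbody dL1 e'.
  exists (State (if 0 < reg s' 5 then L else (pc s').+1) (reg s') (memory s')); split; last first.
    rewrite /= ms' nth_rcons ltnn eqxx.
    suff -> : loop_mem (rcons z b) (size z) = loop_mem z (size z) by [].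
    by apply: loop_mem_take; rewrite -cats1 take_size_cat // take_size.
  split=> //=.
  - by rewrite addSn -addnS prE (pr_jump _ _ _ dL2).
  - by rewrite s'5 pc' /=; case: eqVneq => [->|ne]; rewrite ?subnn /= -?[L.+1]addn1 ?ifT //; lia.
elim: n y s => [|n IH] y [k f m']; set A := avg _ _;
  move=> /= sy pcs s0 s1 s3 ms; subst k; rewrite {}/A.
  rewrite avgS mul1n addSn (@pr_coin Q B F _ 2 _ (State L f m') B1 dL) ler_pM2r //.
  rewrite addnS addn0 in sy.
  have yN : (size y < N)%N by rewrite -sy.
  have [t1 [[-> pc1 s10 s11 s13] ms1]] := iter y true f m' T yN s0 s1 s3 ms.
  have [t2 [[-> pc2 s20 s21 s23] ms2]] := iter y false f m' T yN s0 s1 s3 ms.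
  have dr : drop (L + (size body).+2) Q = rest.
    by rewrite addnC -drop_drop dL /= -cat_rcons drop_size_cat // size_rcons.
  rewrite sy eqxx in pc1 pc2; rewrite sy in ms1 ms2.
  apply: lerD.
  - by apply: (restP (y ++ [:: true])); rewrite ?pc1 ?cats1 ?size_rcons.
  - by apply: (restP (y ++ [:: false])); rewrite ?pc2 ?cats1 ?size_rcons.
rewrite [in leRHS]mulSn -addnA addSn (@pr_coin Q B F _ 2 _ (State L f m') B1 dL) avgS ler_pM2r //.
have yN : (size y < N)%N by lia.
set U := (n.+1 * _ + T)%N.
have [t1 [[-> pc1 s10 s11 s13] ms1]] := iter y true f m' U yN s0 s1 s3 ms.
have [t2 [[-> pc2 s20 s21 s23] ms2]] := iter y false f m' U yN s0 s1 s3 ms.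
have ne : ((size y).+1 == N) = false by lia.
rewrite ne in pc1 pc2.
apply: lerD.
- have := IH (rcons y true) t1; rewrite size_rcons => /(_ _ pc1 s10 s11 s13 ms1).
  under eq_avg do rewrite cat_rcons.
  by apply; lia.
- have := IH (rcons y false) t2; rewrite size_rcons => /(_ _ pc2 s20 s21 s23 ms2).
  under eq_avg do rewrite cat_rcons.
  by apply; lia.
Qed.
End LoopRule.

Lemma loop_mem_nth m r e z1 z2 a :
  (forall i, (i < a)%N -> nth false z1 i = nth false z2 i) ->
  loop_mem m r e z1 a = loop_mem m r e z2 a.
Proof.
elim: a => //= a IH zE; rewrite IH ?zE // => i ia.
by apply: zE; rewrite ltnW.
Qed.

(** The value [v z] after the loop may depend on the whole coin sequence [z]. Fixing [z] amounts to
    conditioning on the sample when the rest of the program is analysed. *)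
Lemma attains_loop r cnt e cs N T m (h : seq bool -> nat -> nat) v :
  (0 < N <= V)%N -> (forall x, (`|m x| <= V)%N) ->
  (V ^ weight cnt < G)%N -> (V ^ weight e < G)%N -> (r < G)%N ->
  eval G m 0 false cnt = N ->
  (forall z a, size z = N -> (a < N)%N ->
     eval G (fill m r a (h z)) a (nth false z a) e = h z a) ->
  (forall z a, size z = N -> (a < N)%N -> (h z a <= V)%N) ->
  (forall z, size z = N -> attains cs T (fill m r N (h z)) (v z)) ->
  attains (Loop r cnt e :: cs) (loop_time r cnt e N + T) m (avg N v).
Proof.
move=> /andP[N0 NV] mV wc we rG cntN eh hV vP [k f m0] dQ /= s0 m0E; subst m0.
set rest := compile P (k + size (loop_code k r cnt e)) cs.
have {}dQ : drop k Q = loop_code k r cnt e ++ rest by [].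
have VG : (V < G)%N.
  apply: leq_ltn_trans wc; rewrite -[V in (V <= _)%N]expn1 leq_exp2l //.
  exact: weight_gt0.
have B1 : (1 < B)%N by apply: leq_ltn_trans GB; nia.
have NB : (N < B)%N by apply: leq_ltn_trans GB; nia.
have B0 := ltnW B1.
have lmE z a : size z = N -> (a <= N)%N ->
    loop_mem m r e z a = fill m r a (h z).
  by move=> zN aN; apply: loop_mem_fill aN _ => // i iN; exact: eh.
have eV z a : (a < N)%N ->
    (eval G (loop_mem m r e z a) a (nth false z a) e <= V)%N.
  (* The hypotheses on [h] concern sequences of length [N]; [z'] is [z] cut or padded with [false]
     to this length. *)
  move=> aN; pose z' := mkseq (nth false z) N.
  have z'N : size z' = N by rewrite size_mkseq.
  rewrite (@loop_mem_nth m r e z z') => [|i ia]; last first.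
    by rewrite nth_mkseq // (ltn_trans ia).
  rewrite lmE ?(ltnW aN) //; have -> : nth false z a = nth false z' a.
    by rewrite nth_mkseq.
  by rewrite eh ?hV.
rewrite /loop_code -catA in dQ.
pose f2 := upd (upd f 1 0) 2 0.
have [[k1 f1 m1] [/= e1 m1E r1 v1]] := @compile_expr_computes B G V V2 GB 0 false cnt 4
  (State k.+2 f2 m) isT (leq0n _) mV s0 erefl erefl wc.
subst m1; have q0 : f1 0%N = G by rewrite r1.
have q1 : f1 1%N = 0 by rewrite r1.
pose s2 := State k1.+2 (upd (upd f1 3 0) 3 N) m.
have e2 : sexec B (loop_pre cnt) (State k f m) = Some s2.
  rewrite /loop_pre /= !sexec_const // sexec_cat e1 /=.
  rewrite sexec_const // (sexec_arith _ (v := Posz N)) //=.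
  by rewrite upd_same upd_other // v1 cntN add0r.
have pre : all straight (loop_pre cnt).
  by rewrite /loop_pre !all_cat straight_compile_expr.
have pc2 := pc_sexec pre e2.
have [prE d2] := @pr_sexec Q B F (N * (size (compile_expr 4 e ++ loop_post r)).+2 + T)
  _ _ (State k f m) _ pre dQ e2.
rewrite /loop_time -addnA prE.
have Nn : (size (Nil bool) + N.-1.+1)%N = N by rewrite add0n prednK.
rewrite -[N in avg N](prednK N0) -[N in (N * _)%N](prednK N0).
rewrite -[avg _ _]/(avg N.-1.+1 (fun z => v ([::] ++ z))).
apply: (@pr_loop m r e N NV mV we rG eV (pc s2) rest) => //.
- by rewrite d2 pc2 /= -catA.
- move=> z s zN ds pcs s'0 ms; apply: (vP z zN s) => //.
    rewrite ds pcs pc2 /rest /loop_code; congr (compile P _ cs).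
    by rewrite !size_cat /= !size_cat /=; lia.
  by rewrite ms lmE.
Qed.

End Judgement.

(** * Oracle calls *)

Lemma instr_regs_lt P k r : (k < size P)%N ->
  r \in instr_regs (nth (Const 0 0) P k) -> (r < reg_count P)%N.
Proof.
rewrite /reg_count; elim: P k => // i P IH [_|k] /=; rewrite big_cons leq_max.
  move=> ri; apply/orP; left.
  exact: (@leq_bigmax_seq _ _ xpredT (fun r => r.+1)).
by rewrite ltnS => kP /(IH _ kP) ->; rewrite orbT.
Qed.

Lemma size_shift_instr P off i : size (shift_instr P off i) = 2.
Proof. by case: i. Qed.

Lemma size_embed P off : size (embed P off) = (2 * size P)%N.
Proof.
rewrite /embed; move: (shift_instr P off) (size_shift_instr P off) => sh sh2.
by elim: P => //= i s IH; rewrite size_cat IH mulnS sh2.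
Qed.

Lemma drop_embed P off k rest : (k < size P)%N ->
  drop (2 * k) (embed P off ++ rest) =
  shift_instr P off (nth (Const 0 0) P k) ++
  drop (2 * k.+1) (embed P off ++ rest).
Proof.
rewrite /embed; move: (shift_instr P off) (size_shift_instr P off) => sh sh2.
elim: P k => // i s IH [_|k] /=.
  by rewrite muln0 drop0 muln1 -catA drop_size_cat.
rewrite ltnS => ks; rewrite mulnS addnC -drop_drop -catA drop_size_cat // IH //.
by rewrite (mulnS 2 k.+1) addnC -drop_drop (drop_size_cat _ (sh2 i)).
Qed.

Section CallRule.
Variables (P Q : program) (B BP G V : nat) (F : option state -> bool).
Hypothesis F_absorbing : forall s b, F s -> F (step Q B s b).
Hypotheses (V2 : (1 < V)%N) (GB : (G ^ 2 < B)%N) (BPV : (BP <= V)%N)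
  (VG : (V < G)%N).
Local Notation pr := (pr Q B F).

Section Simulation.
Variables (r off : nat) (rest : seq instr) (m0 : nat -> int).
Hypotheses (rG : (r < G)%N) (drop_off : drop off Q = embed P off ++ rest).

Definition overlay (m : nat -> int) : nat -> int :=
  fun x => if (r * G <= x < r * G + G)%N then m (x - r * G)%N else m0 x.

(** The [minn] identifies all halting positions of the oracle with the end of its embedded code.
    Registers are below the oracle's own bound [BP], as they serve as addresses; memory cells, which
    may still contain input, are only bounded by [V]. *)
Record simulates (s t : state) : Prop := Simulates {
  sim_pc : pc t = (off + 2 * minn (pc s) (size P))%N;
  sim_reg : forall j, (j < reg_count P)%N -> reg t (j + 8) = reg s j;
  sim_bound : forall j, (`|reg s j| < BP)%N;
  sim_G : reg t 0 = G;
  sim_base : reg t 4 = Posz (r * G);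
  sim_mem : memory t = overlay (memory s);
  sim_mem_bound : forall x, (`|memory s x| <= V)%N }.

Lemma overlay_upd m a v : (a < G)%N ->
  overlay (upd m a v) = upd (overlay m) (r * G + a)%N v.
Proof.
move=> aG; apply/funext=> x; rewrite /overlay /upd.
case: (eqVneq x (r * G + a)%N) => [->|ne].
  by rewrite leq_addr ltn_add2l aG addKn eqxx.
case: ifP => // /andP[le _]; rewrite ifF //; apply/negP => /eqP E.
by move/eqP: ne; lia.
Qed.

(** Two host steps match one oracle step, and only the second instruction of a block can read the
    coin, so the two successors remain equally likely. Addresses used by the oracle are below
    [BP <= V < G], hence stay in its region. *)
Lemma simulates_step s t s1 s2 U : simulates s t -> ~~ halted P s ->
  step P BP (Some s) true = Some s1 -> step P BP (Some s) false = Some s2 ->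
  exists t1 t2, [/\ simulates s1 t1, simulates s2 t2 &
    pr U.+2 (Some t) = (pr U (Some t1) + pr U (Some t2)) / 2].
Proof.
case: s t => [k f m] [k' f' m'] [/= -> fE fB f0 f4 -> mV].
rewrite /halted /= -ltnNge => kP; rewrite leqNgt kP /=.
have -> : minn k (size P) = k by apply/minn_idPl/ltnW.
have regP := instr_regs_lt kP.
have dk : drop (off + 2 * k) Q = shift_instr P off (nth (Const 0 0) P k) ++
    drop (off + 2 * k.+1) Q.
  by rewrite addnC -drop_drop drop_off drop_embed // -drop_off drop_drop addnC.
have GB' : (G < B)%N by apply: leq_ltn_trans GB; nia.
have BPB : (BP < B)%N by lia.
have B1 : (1 < B)%N by lia.
have pcS : (off + 2 * minn k.+1 (size P) = (off + 2 * k).+2)%N by lia.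
have upd_reg x (z : int) (f5 : nat -> int) j : (j < reg_count P)%N ->
    (forall j, (j < reg_count P)%N -> f5 (j + 8)%N = f j) ->
    upd f5 (x + 8) z (j + 8)%N = upd f x z j.
  by move=> jP f5E; rewrite /upd eqn_add2r f5E.
have f'5 z j : (j < reg_count P)%N -> upd f' 5 z (j + 8)%N = f j.
  by move=> jP; rewrite upd_other ?fE //; lia.
have upd_bound x (z : int) : (`|z| < BP)%N -> forall j, (`|upd f x z j| < BP)%N.
  by move=> zB j; rewrite /upd; case: ifP.
have simS x (z : int) z5 : (`|z| < BP)%N ->
    simulates (State k.+1 (upd f x z) m)
      (State (off + 2 * k).+2 (upd (upd f' 5 z5) (x + 8) z) (overlay m)).
  move=> zB; split => //=.
  - by move=> j jP; apply: upd_reg => // i iP; exact: f'5.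
  - exact: upd_bound.
  - by rewrite !upd_other ?f0 //; lia.
  - by rewrite !upd_other ?f4 //; lia.
have stepS i1 i2 t1 : all straight [:: i1; i2] ->
    drop (off + 2 * k) Q = i1 :: i2 :: drop (off + 2 * k.+1) Q ->
    sexec B [:: i1; i2] (State (off + 2 * k) f' (overlay m)) = Some t1 ->
    pr U.+2 (Some (State (off + 2 * k) f' (overlay m))) =
      (pr U (Some t1) + pr U (Some t1)) / 2.
  move=> st dQ e; have [<- _] := @pr_sexec Q B F U [:: i1; i2] _
    (State (off + 2 * k) f' (overlay m)) _ st dQ e.
  by rewrite /= add2n; field.
have fG x : (`|f x| < G)%N by have := fB x; lia.
have addr x1 a : (x1 < reg_count P)%N -> f x1 = Posz a ->
    eval_binop Add (f' (x1 + 8)%N) (f' 4%N) = Posz (r * G + a) /\ (r * G + a < B)%N.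
  move=> x1P x1E; rewrite /= fE // f4 x1E addrC; split=> //.
  by have := fG x1; rewrite x1E /= => aG; apply: leq_ltn_trans GB; nia.
move: dk regP; case: (nth _ P k) => [x z|o x x1 x2|x x1|x1 x2|x|x l] /= dk regP.
- rewrite /set_reg; case: ifP => //= zB [<-] [<-].
  eexists; eexists; split; [exact: (simS _ _ 0)|exact: (simS _ _ 0)|].
  apply: (stepS _ _ _ _ dk) => //.
  by rewrite !sexec_const ?(ltnW B1) ?(ltn_trans zB BPB).
- rewrite /set_reg; case: ifP => //= zB [<-] [<-].
  eexists; eexists; split; [exact: (simS _ _ 0)|exact: (simS _ _ 0)|].
  apply: (stepS _ _ _ _ dk) => //.
  rewrite sexec_const; last by rewrite absz0 (ltnW B1).
  rewrite (sexec_arith _ (v := eval_binop o (f x1) (f x2))) //; last exact: ltn_trans zB BPB.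
  by rewrite !f'5 // regP // !inE eqxx ?orbT.
- case x1E : (f x1) => [a|] //; rewrite /set_reg; case: ifP => //= zB [<-] [<-].
  eexists; eexists; split; [exact: (simS _ _ (r * G + a)%N)|exact: (simS _ _ (r * G + a)%N)|].
  apply: (stepS _ _ _ _ dk) => //.
  have [|aE aB] := addr x1 a _ x1E; first by rewrite regP // !inE eqxx ?orbT.
  have aG : (a < G)%N by have := fG x1; rewrite x1E.
  have mE : overlay m (r * G + a)%N = m a.
    by rewrite /overlay leq_addr ltn_add2l aG addKn.
  rewrite (@sexec_arith B _ _ _ _ _ _ _ _ _ aE) // (sexec_read _ (a := (r * G + a)%N)) ?upd_same //.
    by rewrite mE.
  by rewrite mE; lia.
- case x1E : (f x1) => [a|] // [<-] [<-].
  have [|aE aB] := addr x1 a _ x1E; first by rewrite regP // !inE eqxx ?orbT.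
  have aG : (a < G)%N by have := fG x1; rewrite x1E.
  have x2P : (x2 < reg_count P)%N by rewrite regP // !inE eqxx ?orbT.
  have S : simulates (State k.+1 f (upd m a (f x2)))
      (State (off + 2 * k).+2 (upd f' 5 (r * G + a)%N)
         (upd (overlay m) (r * G + a)%N (f x2))).
    split => //=.
    + by move=> j jP; exact: f'5.
    + by rewrite overlay_upd.
    + by move=> j; rewrite /upd; case: ifP => // _; have := fB x2; lia.
  eexists; eexists; split; [exact: S|exact: S|].
  apply: (stepS _ _ _ _ dk) => //.
  by rewrite (@sexec_arith B _ _ _ _ _ _ _ _ _ aE) // (sexec_write _ _ (a := (r * G + a)%N)) ?upd_same ?f'5.
- rewrite /set_reg; case: ifP => //= BP1 [<-]; case: ifP => //= BP0 [<-].
  eexists; eexists; split; [exact: (simS _ _ 0)|exact: (simS _ _ 0)|].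
  have [prE d2] := @pr_sexec Q B F U.+1 [:: Const 5 0] _
    (State (off + 2 * k) f' (overlay m)) _ isT dk (@sexec_const B 5 0 [::] _ _ _ (ltnW B1)).
  by rewrite -[U.+2]/(1 + U.+1)%N prE (@pr_coin Q B F U _ _ (State _ _ _) B1 d2).
- move=> [<-] [<-].
  have xP : (x < reg_count P)%N by rewrite regP // !inE eqxx ?orbT.
  have [prE d2] := @pr_sexec Q B F U.+1 [:: Const 5 0] _
    (State (off + 2 * k) f' (overlay m)) _ isT dk (@sexec_const B 5 0 [::] _ _ _ (ltnW B1)).
  have S : simulates (State (if 0 < f x then l else k.+1) f m)
    (State (if 0 < f x then (off + 2 * minn l (size P))%N else (off + 2 * k).+2)
      (upd f' 5 0) (overlay m)).
    by split => //=; [case: ifP|move=> j jP; exact: f'5].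
  eexists; eexists; split; [exact: S|exact: S|].
  rewrite -[U.+2]/(1 + U.+1)%N prE (@pr_jump Q B F U _ _ _ (State _ _ _) d2) /= f'5 //.
  by field.
Qed.
Lemma run_halted s z : halted P s -> foldl (step P BP) (Some s) z = Some s.
Proof. by move=> hs; elim: z => //= b z IH; rewrite hs. Qed.

Lemma run_none z : foldl (step P BP) None z = None.
Proof. by elim: z. Qed.

Lemma pr_simulates (Out : option state -> bool) T v1 v2 : v2 <= v1 ->
  (forall s t, simulates s t -> drop (pc t) Q = rest ->
     pc t = (off + size (embed P off))%N ->
     (if Out (Some s) then v1 else v2) <= pr T (Some t)) ->
  forall n s t, simulates s t ->
  (forall z, size z = n -> terminates P (foldl (step P BP) (Some s) z)) ->
  v2 + (v1 - v2) * avg n (fun z => (Out (foldl (step P BP) (Some s) z))%:R)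
    <= pr (2 * n + T) (Some t).
Proof.
move=> v21 post; elim=> [|n IH] s t st term.
all: have [hs|nhs] := boolP (halted P s).
- rewrite /= (le_trans _ (post _ _ st _ _)) //.
  + by case: (Out _); rewrite ?mulr1 ?mulr0 ?addr0 // addrC subrK.
  + rewrite (sim_pc st) (minn_idPr hs) addnC -drop_drop drop_off.
    by rewrite drop_size_cat // size_embed.
  + by rewrite (sim_pc st) (minn_idPr hs) size_embed.
- by have := term [::] erefl; rewrite /= (negPf nhs).
- apply: le_trans (pr_homo F_absorbing _ (leq_addl _ T)).
  rewrite (le_trans _ (post _ _ st _ _)) //.
  + rewrite (eq_avg (g := fun=> (Out (Some s))%:R)) => [|z _]; last by rewrite run_halted.
    by rewrite avg_cst; case: (Out _); rewrite ?mulr1 ?mulr0 ?addr0 // addrC subrK.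
  + rewrite (sim_pc st) (minn_idPr hs) addnC -drop_drop drop_off.
    by rewrite drop_size_cat // size_embed.
  + by rewrite (sim_pc st) (minn_idPr hs) size_embed.
have sS b : exists s', step P BP (Some s) b = Some s'.
  case E : (step P BP (Some s) b) => [s'|]; first by exists s'.
  have := term (b :: nseq n true); rewrite /= size_nseq => /(_ erefl).
  by move: E; rewrite /= => ->; rewrite run_none.
have [[s1 e1] [s2 e2]] := (sS true, sS false).
have [t1 [t2 [st1 st2]]] := simulates_step (2 * n + T) st nhs e1 e2.
rewrite mulnS -addnA => ->; rewrite avgS.
have H1 := IH _ _ st1; have H2 := IH _ _ st2.
rewrite (eq_avg (g := fun z => (Out (foldl (step P BP) (Some s1) z))%:R) (f := fun z => (Out (foldl _ _ (true :: z)))%:R)); last by move=> z _; rewrite -e1.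
rewrite (eq_avg (g := fun z => (Out (foldl (step P BP) (Some s2) z))%:R) (f := fun z => (Out (foldl _ _ (false :: z)))%:R)); last by move=> z _; rewrite -e2.
set A1 := avg n _ in H1 *; set A2 := avg n _ in H2 *.
have {}H1 : v2 + (v1 - v2) * A1 <= pr (2 * n + T) (Some t1).
  apply: H1 => z zn; rewrite -e1; apply: (term (true :: z)); by rewrite /= zn.
have {}H2 : v2 + (v1 - v2) * A2 <= pr (2 * n + T) (Some t2).
  apply: H2 => z zn; rewrite -e2; apply: (term (false :: z)); by rewrite /= zn.
by rewrite ler_pdivlMr //; move: H1 H2; lra.
Qed.

End Simulation.

Definition call_time (r t : nat) : nat := (size (call_pre P r) + 2 * t)%N.

Lemma sexec_zero_regs n k (f : nat -> int) m : (0 < B)%N -> exists f' : nat -> int,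
  [/\ sexec B [seq Const (i + 8) 0 | i <- iota 0 n] (State k f m) =
        Some (State (k + n) f' m),
      forall j, (j < n)%N -> f' (j + 8)%N = 0 &
      forall j, (j < 8)%N -> f' j = f j].
Proof.
move=> B0; elim: n => [|n [f' [e f0 f8]]].
  by exists f; rewrite addn0.
exists (upd f' (n + 8) 0); split.
- by rewrite -[n.+1]addn1 iotaD map_cat sexec_cat e /= add0n sexec_const // addnA addn1.
- move=> j; rewrite ltnS leq_eqVlt => /orP[/eqP->|jn]; first exact: upd_same.
  by rewrite upd_other ?f0 // eqn_add2r ltn_eqF.
- by move=> j j8; rewrite upd_other ?f8 //; lia.
Qed.

(** The continuation is worth [v1] after an answer satisfying [Out] and at least [v2] after any
    other. The oracle expects zeros beyond its input, hence the condition on all cells of the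
    region. *)
Lemma attains_call r cs T (m : nat -> int) (xs : seq int) t (Out : option state -> bool) v1 v2 :
  (0 < BP)%N -> (r < G)%N ->
  (forall a, (a < G)%N -> m (r * G + a)%N = nth 0 xs a) ->
  (forall a, (`|nth 0%R xs a| <= V)%N) -> (forall x, (`|m x| <= V)%N) ->
  (forall z, size z = t -> terminates P (run P BP xs z)) -> v2 <= v1 ->
  (forall m', (forall x, (`|m' x| <= V)%N) ->
     (forall x, ~~ (r * G <= x < r * G + G)%N -> m' x = m x) ->
     attains P Q B G F cs T m' v2 /\
     (forall s, Out (Some s) ->
        (forall a, (a < G)%N -> m' (r * G + a)%N = memory s a) ->
        attains P Q B G F cs T m' v1)) ->
  attains P Q B G F (Call r :: cs) (call_time r t + T) m
    (v2 + (v1 - v2) * avg t (fun z => (Out (run P BP xs z))%:R)).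
Proof.
move=> BP0 rG mxs xsV mV term v21 post [k f m0] dQ /= f0 m0E; subst m0.
set off := (k + size (call_pre P r))%N.
set rest := compile P (k + size (call_code P k r)) cs.
have {}dQ : drop k Q = call_pre P r ++ embed P off ++ rest.
  by rewrite [LHS]dQ /= /call_code -!catA.
have GB' : (G < B)%N by apply: leq_ltn_trans GB; nia.
have B0 : (0 < B)%N by lia.
have rB : (r * G < B)%N by apply: leq_ltn_trans GB; nia.
have rG' : (r < B)%N by apply: ltn_trans GB'.
pose f1 := upd (upd f 4 r) 4 (r * G)%N.
have [f2 [e2 z2 z8]] := sexec_zero_regs (reg_count P) k.+2 f1 m B0.
have e1 : sexec B (call_pre P r) (State k f m) =
    Some (State (k.+2 + reg_count P) f2 m).
  rewrite /call_pre sexec_cat sexec_const // (sexec_arith _ (v := Posz (r * G))) //=.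
  by rewrite upd_same upd_other ?f0.
have scode : all straight (call_pre P r) by rewrite all_cat /= all_map all_predT.
have [prE dr] := @pr_sexec Q B F (2 * t + T) _ _ (State k f m) _ scode dQ e1.
rewrite /call_time -addnA prE.
have offE : off = (k.+2 + reg_count P)%N.
  by rewrite /off /call_pre /= size_map size_iota; lia.
rewrite /= -offE in dr.
apply: (pr_simulates rG dr (m0 := m)) => //; last first.
  split => //=.
  - by rewrite min0n muln0 addn0 offE.
  - by rewrite z8.
  - by rewrite z8 // /f1 upd_same.
  - apply/funext=> x; rewrite /overlay; case: ifP => // /andP[le lt].
    by rewrite -mxs ?subnKC // ltn_subLR.
move=> s st sim dst pcst; have [] := post (memory st).
- move=> x; rewrite (sim_mem sim) /overlay; case: ifP => _ //.
  exact: (sim_mem_bound sim).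
- by move=> x /negPf xr; rewrite (sim_mem sim) /overlay xr.
have st0 := sim_G sim.
have dst' : drop (pc st) Q = compile P (pc st) cs.
  by rewrite dst /rest pcst /off /call_code size_cat addnA.
move=> p2 p1; case: ifP => Os; last exact: p2.
apply: (p1 s Os) => // a aG; rewrite (sim_mem sim) /overlay.
by rewrite leq_addr ltn_add2l aG addKn.
Qed.

End CallRule.

(** * Complete programs: region size, then commands *)

Definition prelude (c : nat) : seq instr :=
  [:: Const 5 0; Read 5 5; Const 6 1; Arith Add 5 5 6; Const 0 1] ++
  nseq c (Arith Mul 0 0 5).

Definition assemble (P : program) (c : nat) (cs : seq cmd) : program :=
  prelude c ++ compile P (size (prelude c)) cs.

Lemma terminates_absorbing p B s b :
  terminates p s -> terminates p (step p B s b).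
Proof. by case: s => //= s hs; rewrite hs /=. Qed.

Lemma outputs_absorbing p B out s b :
  outputs p s out -> outputs p (step p B s b) out.
Proof. by case: s => //= s /andP[hs o]; rewrite hs /= hs. Qed.

Lemma pr_prelude P c cs B (F : option state -> bool) n (xs : seq int) T v :
  (forall s b, F s -> F (step (assemble P c cs) B s b)) ->
  (((n.+1 ^ c) ^ 2) < B)%N -> (n.+1 < B)%N -> nth 0%R xs 0%N = Posz n ->
  attains P (assemble P c cs) B (n.+1 ^ c) F cs T (fun k => nth 0 xs k) v ->
  v <= pr (assemble P c cs) B F (size (prelude c) + T) (Some (init xs)).
Proof.
move=> F_abs cB nB xn vP; set Q := assemble P c cs in F_abs vP *.
have B1 : (1 < B)%N by lia.
pose f1 := upd (upd (upd (upd (upd (fun=> 0) 5 0) 5 n) 6 1) 5 n.+1) 0 1.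
have pow j k (f : nat -> int) m : (j <= c)%N -> f 5%N = Posz n.+1 -> f 0%N = 1 ->
    exists f' : nat -> int, [/\ sexec B (nseq j (Arith Mul 0 0 5)) (State k f m) =
    Some (State (k + j) f' m), f' 0%N = Posz (n.+1 ^ j) & f' 5%N = n.+1].
  move=> + f5 f0; elim: j => [|j IH] jc; first by exists f; rewrite addn0.
  have [|f' [e f'0 f'5]] := IH; first exact: ltnW.
  exists (upd f' 0 (Posz (n.+1 ^ j.+1))); split.
  - rewrite -[j.+1]addn1 nseqD sexec_cat e /=.
    rewrite (sexec_arith _ (v := Posz (n.+1 ^ (j + 1)))) //=.
    + by rewrite addnA !addn1.
    + by rewrite f'0 f'5 addn1 expnSr.
    + apply: leq_ltn_trans cB; rewrite -expnM leq_pexp2l //; lia.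
  - exact: upd_same.
  - by rewrite upd_other.
have [||f' [e f'0 _]] := pow c 5 f1 (fun k => nth 0 xs k) (leqnn c); [by []|by []|].
have e5 : sexec B (prelude c) (init xs) =
    Some (State (5 + c) f' (fun k => nth 0 xs k)).
  rewrite /prelude /init /= sexec_const; last exact: ltnW.
  rewrite (sexec_read _ (a := 0%N)) ?xn //; last exact: ltnW.
  rewrite sexec_const // (sexec_arith _ (v := Posz n.+1)) //; last by rewrite /upd /= -[n.+1]addn1.
  by rewrite sexec_const.
have st : all straight (prelude c) by rewrite all_cat /= all_nseq orbT.
have dQ : drop (pc (init xs)) Q = prelude c ++ compile P (size (prelude c)) cs.
  by rewrite drop0.
have [-> d] := @pr_sexec Q B F T _ _ (init xs) _ st dQ e5.
apply: vP => //; rewrite d; congr (compile P _ cs).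
by rewrite size_cat /= size_nseq.
Qed.

(** The judgement is applied twice to the same program: to termination, with value at least 1, and
    to the correct output, with value at least 2/3. *)
Lemma run_assemble P c cs B n (xs : seq int) T out u v : let Q := assemble P c cs in
  let G := (n.+1 ^ c)%N in let m := fun k => nth 0%R xs k in
  ((G ^ 2) < B)%N -> (n.+1 < B)%N -> nth 0%R xs 0%N = Posz n ->
  1 <= u -> attains P Q B G (terminates Q) cs T m u ->
  2 / 3 <= v -> attains P Q B G (fun s => outputs Q s out) cs T m v ->
  (forall tape : (size (prelude c) + T).-tuple bool,
     terminates Q (run Q B xs tape)) /\
  (2 * 2 ^ (size (prelude c) + T) <=
     3 * #|[set tape : (size (prelude c) + T).-tuple bool |
        outputs Q (run Q B xs tape) out]|)%N.
Proof.
move=> Q G m GB nB xn u1 v1 v23 v2; set t := (_ + T)%N.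
have := pr_prelude (fun s b => @terminates_absorbing Q B s b) GB nB xn v1; move/(le_trans u1).
have := pr_prelude (fun s b => @outputs_absorbing Q B out s b) GB nB xn v2; move/(le_trans v23).
have t0 : 0 < 2 ^+ t :> rat by rewrite exprn_gt0.
rewrite /pr !avg_card -/t -/Q => H2 H1; split.
  (* Probability 1 on the finite set of tapes means all tapes. *)
  move: H1; rewrite ler_pdivlMr // mul1r => H1 tape.
  have : [set t0 : t.-tuple bool | terminates Q (run Q B xs t0)] = setT.
    apply/eqP; rewrite eqEcard subsetT cardsT card_tuple card_bool.
    by rewrite -(ler_nat rat) natrX.
  by move/setP/(_ tape); rewrite !inE.
move: H2; rewrite ler_pdivlMr // mulrAC ler_pdivrMr // => H2.
by rewrite -(ler_nat rat) [leLHS]natrM [leRHS]natrM natrX [leRHS]mulrC.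
Qed.

(** * The Min-Plus program *)

Section Macros.
Definition eAdd := Bin Add.
Definition eSub := Bin Defs.Sub.
Definition eMul := Bin Mul.
Definition eDiv := Bin Div.
Definition eMod x y := eSub x (eMul (eDiv x y) y).
Definition eNot x := eSub (Num 1) x.
Definition ePos x := eNot (eNot x).
Definition eLt x y := ePos (eSub y x).
Definition eEq x y := eNot (eAdd (eSub x y) (eSub y x)).
Definition eLe x y := eNot (eSub x y).
Definition eMin x y := eSub x (eSub x y).
(** Both branches are evaluated and the rejected one is multiplied by 0. A read at a meaningless
    offset is harmless there, since [eval_le] bounds every offset and every cell. *)
Definition eIf c x y := eAdd (eMul (ePos c) x) (eMul (eNot c) y).
Definition eOr x y := ePos (eAdd x y).

Definition get (G : nat) (m : nat -> int) (r a : nat) : nat :=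
  pospart (m (r * G + a)%N).

Variables (G : nat) (m : nat -> int) (i : nat) (b : bool).
Local Notation ev := (eval G m i b).
Implicit Types (x y c : expr).
Local Open Scope nat_scope.

Lemma ev_num k : ev (Num k) = k. Proof. by []. Qed.
Lemma ev_idx : ev Idx = i. Proof. by []. Qed.
Lemma ev_flip : ev Flip = b. Proof. by []. Qed.
Lemma ev_get r x : ev (Get r x) = get G m r (ev x). Proof. by []. Qed.
Lemma ev_add x y : ev (eAdd x y) = ev x + ev y. Proof. by []. Qed.
Lemma ev_sub x y : ev (eSub x y) = ev x - ev y. Proof. by []. Qed.
Lemma ev_mul x y : ev (eMul x y) = ev x * ev y. Proof. by []. Qed.
Lemma ev_div x y : ev (eDiv x y) = ev x %/ ev y. Proof. by []. Qed.
Lemma ev_mod x y : ev (eMod x y) = ev x %% ev y.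
Proof.
rewrite ev_sub ev_mul ev_div [X in X - _](divn_eq (ev x) (ev y)).
by rewrite addKn.
Qed.
Lemma ev_not x : ev (eNot x) = (ev x == 0).
Proof. by rewrite ev_sub ev_num; case: (ev x). Qed.
Lemma ev_pos x : ev (ePos x) = (0 < ev x).
Proof. by rewrite !ev_not; case: (ev x). Qed.
Lemma ev_lt x y : ev (eLt x y) = (ev x < ev y).
Proof. by rewrite ev_pos ev_sub subn_gt0. Qed.
Lemma ev_eq x y : ev (eEq x y) = (ev x == ev y).
Proof. by rewrite ev_not ev_add !ev_sub; congr (nat_of_bool _); lia. Qed.
Lemma ev_le x y : ev (eLe x y) = (ev x <= ev y).
Proof. by rewrite ev_not ev_sub subn_eq0. Qed.
Lemma ev_min x y : ev (eMin x y) = minn (ev x) (ev y).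
Proof. by rewrite !ev_sub; lia. Qed.
Lemma ev_if c x y : ev (eIf c x y) = if 0 < ev c then ev x else ev y.
Proof. by rewrite ev_add !ev_mul ev_pos ev_not; case: (ev c) => /=; lia. Qed.
Lemma ev_or x y : ev (eOr x y) = (0 < ev x) || (0 < ev y).
Proof. by rewrite ev_pos ev_add addn_gt0. Qed.
End Macros.

Definition evE := (ev_num, ev_idx, ev_flip, ev_get, ev_eq, ev_le, ev_lt, ev_or,
  ev_if, ev_min, ev_mod, ev_pos, ev_not, ev_add, ev_sub, ev_mul, ev_div).

Lemma get_fill G m r N h r' a : (a < G)%N -> (N <= G)%N ->
  get G (fill G m r N h) r' a =
  if (r' == r) && (a < N)%N then h a else get G m r' a.
Proof.
move=> aG NG; rewrite /get /fill; case: (eqVneq r' r) => [->|ne] /=.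
  by rewrite leq_addr ltn_add2l addKn /=; case: ifP.
case: ifP => // /andP[le lt].
have : (r' < r.+1)%N && (r < r'.+1)%N.
  have G0 : (0 < G)%N by lia.
  apply/andP; split; rewrite -(@ltn_pmul2r G) //; rewrite mulSn; lia.
by move/eqP: ne; lia.
Qed.

Lemma fill_other G m r N h x : ~~ (r * G <= x < r * G + G)%N -> (N <= G)%N ->
  fill G m r N h x = m x.
Proof. by move=> xr NG; rewrite /fill ifF //; lia. Qed.

Lemma fill_bound G V m r N h : (forall x, (`|m x| <= V)%N) ->
  (forall a, (a < N)%N -> (h a <= V)%N) ->
  forall x, (`|fill G m r N h x| <= V)%N.
Proof. by move=> mV hV x; rewrite /fill; case: ifP => // x_r; apply: hV; lia. Qed.

Lemma size_row_major p q (A : 'M[int]_(p, q)) : size (row_major A) = (p * q)%N.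
Proof. by rewrite /row_major size_allpairs !size_enum_ord. Qed.

Lemma nth_allpairs (S T U : Type) (f : S -> T -> U) s t x0 y0 z0 i j :
  (i < size s)%N -> (j < size t)%N ->
  nth z0 (allpairs f s t) (i * size t + j) = f (nth x0 s i) (nth y0 t j).
Proof.
elim: s i => //= x s IH [|i] /= si tj.
  by rewrite nth_cat size_map mul0n add0n tj (nth_map y0).
rewrite nth_cat size_map mulSn -addnA ltnNge leq_addr /= addKn.
exact: IH.
Qed.

Lemma nth_row_major p q (A : 'M[int]_(p, q)) (i : 'I_p) (j : 'I_q) :
  nth 0 (row_major A) (i * q + j) = A i j.
Proof.
have := @nth_allpairs _ _ _ (fun i j => A i j) (enum 'I_p) (enum 'I_q) i j 0 i j.
by rewrite !size_enum_ord !nth_ord_enum; apply.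
Qed.

Section Judgement.
Variables (P Q : program) (B G V : nat) (F : option state -> bool).
Hypotheses (V2 : (1 < V)%N) (GB : (G ^ 2 < B)%N).

Lemma attains_det_loop r cnt e cs N T m (h : nat -> nat) v :
  (0 < N <= V)%N -> (forall x, (`|m x| <= V)%N) ->
  (V ^ weight cnt < G)%N -> (V ^ weight e < G)%N -> (r < G)%N ->
  eval G m 0 false cnt = N ->
  (forall (b : bool) a, (a < N)%N -> eval G (fill G m r a h) a b e = h a) ->
  (forall a, (a < N)%N -> (h a <= V)%N) ->
  attains P Q B G F cs T (fill G m r N h) v ->
  attains P Q B G F (Loop r cnt e :: cs) (loop_time r cnt e N + T) m v.
Proof.
move=> NV mV wc we rG cntN eh hV vP; rewrite -(avg_cst N v).
apply: (attains_loop V2 GB (h := fun=> h)) => // z a _ aN.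
- exact: eh.
- exact: hV.
Qed.
End Judgement.

(** Layout of a Min-Plus input: [n], [m], [n], [M] in the cells 0 to 3, then the two matrices row by
    row from cell 4. *)
Definition pn := Get 0 (Num 0).
Definition pm := Get 0 (Num 1).
Definition pM := Get 0 (Num 3).
Definition plam := Get 2 (Num 0).
Definition pK := Get 3 (Num 0).
Definition p2n := eMul (Num 2) pn.
Definition p2M := eMul (Num 2) pM.
Definition pw := eAdd p2M (Num 1).
Definition pS := eAdd p2n (eMul (eMul (Num 2) pm) pw).
Definition pN := eMul (eMul pK plam) pS.
Definition pA i k := Get 0 (eAdd (Num 4) (eAdd (eMul i pm) k)).
Definition pB k j := Get 0 (eAdd (Num 4) (eAdd (eMul pn pm) (eAdd (eMul k pn) j))).

Definition pEdge r u v :=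
  let g := eDiv u pS in let x := eMod u pS in let y := eMod v pS in
  let c := eDiv (eSub y p2n) pw in let p := eMod (eSub y p2n) pw in
  let k := eDiv c (Num 2) in
  let c' := eDiv (eSub x p2n) pw in let p' := eMod (eSub x p2n) pw in
  eMul (eEq g (eDiv v pS))
   (eOr (eMul (eLt x pn) (eMul (eLe p2n y) (eMul (eEq (eAdd p (pA x k)) pM)
      (eMul (Get r (eAdd (eMul (eDiv g plam) pm) k))
        (eOr (eEq (eMod c (Num 2)) (Num 0))
             (eEq (eMod (eDiv k (Get 4 (eMod g plam))) (Num 2)) (Num 1)))))))
   (eOr (eMul (eLe p2n x) (eMul (eEq y (eAdd x (Num 1))) (eLt p' p2M)))
        (eMul (eLe p2n x) (eMul (eLe pn y) (eMul (eLt y p2n)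
          (eEq p' (eAdd pM (pB (eDiv c' (Num 2)) (eSub y pn))))))))).

(* Region 0 holds the input; region 1 the bit lengths of the numbers up to
   [2n], computed by the recurrence [bitlen a = 1 + bitlen (a %/ 2)]; regions
   2 and 3 the numbers [lam] and [K] of bits and of samples; region 4 the
   powers of 2. *)
Definition setup : seq cmd :=
  [:: Loop 1 (eAdd p2n (Num 1))
        (eMul (ePos Idx) (eAdd (Num 1) (Get 1 (eDiv Idx (Num 2)))));
      Loop 2 (Num 1) (Get 1 p2n);
      Loop 3 (Num 1) (eMul (Num 12) (eMul plam plam));
      Loop 4 plam (eIf Idx (eMul (Num 2) (Get 4 (eSub Idx (Num 1)))) (Num 1))].

(* The samples come in groups of [lam]: in each group, a sample is a random
   half of the preceding one. *)
Definition sample_val r :=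
  eMul Flip (eOr (eEq (eMod (eDiv Idx pm) plam) (Num 0)) (Get r (eSub Idx pm))).

(** The input of the oracle starts with its number of vertices, so the adjacency matrix is shifted
    by one cell. *)
Definition graph_val r :=
  let a := eSub Idx (Num 1) in
  eIf Idx (pEdge r (eDiv a pN) (eMod a pN)) pN.

(* The binary digits of the inner index found by each sample are summed up one
   after the other, so that the last partial sum is the index. *)
Definition digit_val r :=
  let b := eMod Idx plam in let e := eDiv Idx plam in
  let q := eMod e pK in let p := eDiv e pK in
  let s := eMul (eAdd (eMul q plam) b) pS in
  let u := eAdd s (eDiv p pn) in let v := eAdd s (eAdd pn (eMod p pn)) in
  eAdd (eIf b (Get r.+2 (eSub Idx (Num 1))) (Num 0))
       (eMul (eNot (eEq (Get r.+1 (eAdd (eMul u pN) v)) (Num 1))) (Get 4 b)).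

(* A wrong index still gives an upper bound on the entry, so that the minimum
   over the samples is correct once one sample is. *)
Definition best_val r :=
  let q := eMod Idx pK in let p := eDiv Idx pK in
  let k := Get r.+2 (eAdd (eMul Idx plam) (eSub plam (Num 1))) in
  eMin (eIf (eLt k pm) (eAdd (pA (eDiv p pn) k) (pB k (eMod p pn))) p2M)
       (eIf q (Get r.+3 (eSub Idx (Num 1))) p2M).

(** Region [r + 1] holds the graph and, after the call, the answer. It must be zero beyond the
    graph, which is why the two rounds have disjoint regions. *)
Definition round (r : nat) : seq cmd :=
  [:: Loop r (eMul pK pm) (sample_val r);
      Loop r.+1 (eAdd (eMul pN pN) (Num 1)) (graph_val r);
      Call r.+1;
      Loop r.+2 (eMul (eMul (eMul pn pn) pK) plam) (digit_val r);
      Loop r.+3 (eMul (eMul pn pn) pK) (best_val r)].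

(** The running minima of an entry end at position [K - 1] of its block. The output overwrites the
    input, hence an expression reading only the regions 3, 8 and 13. *)
Definition combine_val :=
  let last := eAdd (eMul Idx pK) (eSub pK (Num 1)) in
  eMin (Get 8 last) (Get 13 last).

Definition minplus_cmds : seq cmd :=
  setup ++ round 5 ++ round 10 ++ [:: Loop 0 (eMul pn pn) combine_val].

(** * Decoding the answers of the oracle *)

Section Decoding.
Local Open Scope nat_scope.

Lemma sum_bits L k : \sum_(b < L) k %/ 2 ^ b %% 2 * 2 ^ b = k %% 2 ^ L.
Proof.
elim: L => [|L IH]; first by rewrite big_ord0 modn1.
rewrite big_ord_recr /= IH expnSr; set P := 2 ^ L.
have P0 : 0 < P by rewrite expn_gt0.
have r_P : k %% P < P by rewrite ltn_mod.
have d2 : k %/ P %% 2 < 2 by rewrite ltn_mod.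
have -> : k %% (P * 2) = (k %/ P %/ 2 * (P * 2) + (k %/ P %% 2 * P + k %% P)) %% (P * 2).
  congr (_ %% _); rewrite {1}(divn_eq k P) {1}(divn_eq (k %/ P) 2); ring.
rewrite modnMDl [RHS]modn_small; first by rewrite addnC.
move: d2 r_P; move: (k %/ P %% 2) (k %% P) => d r; case: d => [|[|//]] _; lia.
Qed.

Variables (n m M lam K : nat) (A B : nat -> nat -> nat) (o : nat -> nat).
Let S := copy_size n m M.
Let N := K * lam * S.

(** The entry of the answer at source [p %/ n] and sink [p %% n] in the copy of index [q * lam + b];
    only equality with 1 is tested. *)
Definition bit_query p q b : bool :=
  o (((q * lam + b) * S + p %/ n) * N + ((q * lam + b) * S + (n + p %% n))) != 1.

Definition digits a : nat :=
  \sum_(b < (a %% lam).+1)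
     bit_query (a %/ lam %/ K) (a %/ lam %% K) b * 2 ^ b.

Lemma digits_rec a : 0 < lam -> digits a =
  (if 0 < a %% lam then digits a.-1 else 0) +
  bit_query (a %/ lam %/ K) (a %/ lam %% K) (a %% lam) * 2 ^ (a %% lam).
Proof.
move=> lam0; rewrite {1}/digits big_ord_recr /=; congr (_ + _).
case: posnP => [->|a0]; first by rewrite big_ord0.
have aE : a.-1 = a %/ lam * lam + (a %% lam).-1.
  have := divn_eq a lam; move: a0; move: (a %% lam) (a %/ lam * lam) => r d.
  by lia.
have lt : (a %% lam).-1 < lam by have := ltn_pmod a lam0; lia.
by rewrite /digits aE divnMDl // (divn_small lt) addn0 modnMDl (modn_small lt) prednK.
Qed.

(** This holds for arbitrary answers [o], so memory stays bounded when the oracle is wrong. *)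
Lemma digits_lt a : 0 < lam -> digits a < 2 ^ (a %% lam).+1.
Proof.
move=> lam0; rewrite /digits; elim: (a %% lam).+1 => [|d IH]; first by rewrite big_ord0.
rewrite big_ord_recr /= expnS; move: IH; case: (bit_query _ _ _) => /=; lia.
Qed.

(** A wrong answer may decode to an index outside the matrices, which is then replaced by the upper
    bound [2 * M]. *)
Definition candidate p q : nat :=
  let k := digits ((p * K + q) * lam + (lam - 1)) in
  if k < m then A (p %/ n) k + B k (p %% n) else 2 * M.

Fixpoint best p q : nat :=
  minn (candidate p q) (if q is q'.+1 then best p q' else 2 * M).

Variable D : nat -> nat -> nat.
Hypotheses (D_le : forall i j k, i < n -> j < n -> k < m -> D i j <= A i k + B k j)
  (D_2M : forall i j, i < n -> j < n -> D i j <= 2 * M).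

Lemma best_ge p q : p < n * n -> D (p %/ n) (p %% n) <= best p q.
Proof.
move=> pn; have n0 : 0 < n by move: pn; case: (n).
have i_n : p %/ n < n by rewrite ltn_divLR.
have j_n : p %% n < n by rewrite ltn_mod.
have cand q' : D (p %/ n) (p %% n) <= candidate p q'.
  by rewrite /candidate; case: ltnP => [km|_]; [exact: D_le|exact: D_2M].
by elim: q => [|q IH] /=; rewrite leq_min cand ?D_2M.
Qed.

Lemma best_le p q q' : q' <= q -> best p q <= candidate p q'.
Proof.
elim: q => [|q IH] /=; first by rewrite leqn0 => /eqP ->; rewrite geq_minl.
rewrite leq_eqVlt => /orP[/eqP ->|]; first by rewrite geq_minl.
by rewrite ltnS => /IH; apply: leq_trans; rewrite geq_minr.
Qed.

Lemma best_le_2M p q : best p q <= 2 * M.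
Proof. by elim: q => [|q IH] /=; rewrite geq_min ?leqnn ?orbT // IH orbT. Qed.

(** A single correctly decoded sample suffices; [k < 2 ^ lam] ensures that its [lam] bits determine
    [k]. *)
Lemma best_eq p q k : p < n * n -> q < K -> 0 < lam -> k < m -> k < 2 ^ lam ->
  (forall b, b < lam -> bit_query p q b = (k %/ 2 ^ b %% 2 == 1)) ->
  D (p %/ n) (p %% n) = A (p %/ n) k + B k (p %% n) ->
  best p (K - 1) = D (p %/ n) (p %% n).
Proof.
move=> pn qK lam0 km k2 bits DE; apply/eqP; rewrite eqn_leq best_ge // andbT.
apply: leq_trans (best_le p (_ : q <= K - 1)) _; first by lia.
have l1 : lam - 1 < lam by lia.
have dE : digits ((p * K + q) * lam + (lam - 1)) = k.
  have K0 : 0 < K by lia.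
  rewrite /digits divnMDl // (divn_small l1) addn0 modnMDl (modn_small l1).
  rewrite divnMDl // (divn_small qK) addn0 modnMDl (modn_small qK).
  rewrite -[RHS](modn_small k2) -sum_bits subn1 prednK //.
  by apply: eq_bigr => b _; rewrite bits //; case: eqP => [->//|]; lia.
by rewrite /candidate dE km DE.
Qed.

Lemma best_rec e : 0 < K ->
  best (e %/ K) (e %% K) = minn (candidate (e %/ K) (e %% K))
    (if 0 < e %% K then best (e.-1 %/ K) (e.-1 %% K) else 2 * M).
Proof.
move=> K0; case E : (e %% K) => [|q] //=; congr (minn _ _).
have eE : e.-1 = e %/ K * K + q by rewrite {1}(divn_eq e K) E addnS.
have qK : q < K by have := ltn_pmod e K0; rewrite E => /ltnW.
by rewrite eE divnMDl // (divn_small qK) addn0 modnMDl (modn_small qK).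
Qed.

End Decoding.

Definition fits (V G : nat) (c : cmd) : bool :=
  match c with
  | Loop r cnt e => [&& V ^ weight cnt < G, V ^ weight e < G & r < G]%N
  | Call r => (r < G)%N
  end.

(** Average over the sample coins: [v1] is the value after a successful round and [v2] the
    guaranteed one, so that [v2 <= v1] makes the bound increase with [x]. *)
Lemma mix_isolating (v1 v2 x : rat) : v2 <= v1 -> 3 / 4 <= x ->
  (v1 + v2) / 2 <= v2 + (v1 - v2) * (2 / 3) * x.
Proof. by move=> v21 x34; nra. Qed.

Lemma mix_correct (v1 v2 x : rat) (b : bool) : v2 <= v1 -> 2 / 3 <= x ->
  v2 + (v1 - v2) * (2 / 3) * b%:R <= v2 + ((if b then v1 else v2) - v2) * x.
Proof. by move=> v21 x23; case: b; rewrite ?mulr1n ?mulr0n; nra. Qed.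

Lemma outside_region r G x i j : ~~ (r * G <= x < (j + r) * G)%N -> (i < j)%N ->
  ~~ ((i + r) * G <= x < (i + r) * G + G)%N.
Proof.
move=> xr ij; apply: contra xr => /andP[le lt]; apply/andP; split.
  by apply: leq_trans le; rewrite leq_mul2r leq_addl orbT.
by apply: leq_trans lt _; rewrite addnC -mulSn leq_mul2r -addSn leq_add2r ij orbT.
Qed.

(** * One round: sampling, graph, oracle call, minimum *)

Section Instance.
Local Open Scope nat_scope.
Variables (V G n m M lam : nat) (AA BB : nat -> nat -> nat).
Let K := 12 * (lam * lam).
Let S := copy_size n m M.
Let N := K * lam * S.

(** The parameters lie in the regions 0, 2, 3 and 4, while the rounds write only in higher regions
    and thus preserve them. *)
Record inv (mm : nat -> int) : Prop := Inv {
  inv_n : get G mm 0 0 = n;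
  inv_m : get G mm 0 1 = m;
  inv_M : get G mm 0 3 = M;
  inv_A : forall i k, i < n -> k < m -> get G mm 0 (4 + (i * m + k)) = AA i k;
  inv_B : forall k j, k < m -> j < n ->
    get G mm 0 (4 + (n * m + (k * n + j))) = BB k j;
  inv_lam : get G mm 2 0 = lam;
  inv_K : get G mm 3 0 = K;
  inv_pow : forall b, b < lam -> get G mm 4 b = 2 ^ b;
  inv_bound : forall x, absz (mm x) <= V }.

Hypotheses (n0 : 0 < n) (m0 : 0 < m) (lam0 : 0 < lam)
  (in_V : 4 + (n * m + m * n) <= V) (lam_V : 2 ^ lam <= V) (VG : V < G).

Lemma inv_ext mm mm' : (forall x, x < 5 * G -> mm' x = mm x) ->
  (forall x, absz (mm' x) <= V) -> inv mm -> inv mm'.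
Proof.
move=> E bd I; have gE r a : r < 5 -> a < G -> get G mm' r a = get G mm r a.
  move=> r5 aG; rewrite /get E //.
  by have : r.+1 * G <= 5 * G by [rewrite leq_mul2r r5 orbT]; rewrite mulSn; lia.
have G4 : 4 < G by lia.
have A_G i k : i < n -> k < m -> 4 + (i * m + k) < G.
  by move=> iN km; have : i.+1 * m <= n * m by [rewrite leq_mul2r iN orbT]; rewrite mulSn; lia.
have B_G k j : k < m -> j < n -> 4 + (n * m + (k * n + j)) < G.
  by move=> km jN; have : k.+1 * n <= m * n by [rewrite leq_mul2r km orbT]; rewrite mulSn; lia.
have lamG : lam < G.
  by apply: ltn_trans VG; apply: leq_trans lam_V; apply: ltn_expl.
case: I => In Im IM IA IB Il IK Ip _; split=> //.
- by rewrite gE //; lia.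
- by rewrite gE //; lia.
- by rewrite gE //; lia.
- by move=> i k iN km; rewrite gE ?IA ?A_G.
- by move=> k j km jN; rewrite gE ?IB ?B_G.
- by rewrite gE //; lia.
- by rewrite gE //; lia.
- by move=> b bl; rewrite gE ?Ip //; apply: ltn_trans lamG.
Qed.

Lemma inv_fill mm r c h : 4 < r -> c <= G -> (forall a, a < c -> h a <= V) ->
  inv mm -> inv (fill G mm r c h).
Proof.
move=> r4 cG hV I; apply: (inv_ext _ _ I).
  move=> x x5; rewrite fill_other //.
  by have : 5 * G <= r * G by [rewrite leq_mul2r r4 orbT]; lia.
by apply: fill_bound => // x; exact: (inv_bound I).
Qed.

Section Eval.
Variables (mm : nat -> int) (i : nat) (b : bool).
Hypothesis I : inv mm.
Local Notation ev := (eval G mm i b).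

Lemma ev_pn : ev pn = n. Proof. by rewrite evE inv_n. Qed.
Lemma ev_pm : ev pm = m. Proof. by rewrite evE inv_m. Qed.
Lemma ev_pM : ev pM = M. Proof. by rewrite evE inv_M. Qed.
Lemma ev_plam : ev plam = lam. Proof. by rewrite evE inv_lam. Qed.
Lemma ev_pK : ev pK = K. Proof. by rewrite evE inv_K. Qed.
Lemma ev_p2n : ev p2n = 2 * n. Proof. by rewrite ev_mul ev_pn. Qed.
Lemma ev_p2M : ev p2M = 2 * M. Proof. by rewrite ev_mul ev_pM. Qed.
Lemma ev_pw : ev pw = 2 * M + 1. Proof. by rewrite ev_add ev_p2M. Qed.
Lemma ev_pS : ev pS = S.
Proof. by rewrite ev_add ev_p2n !ev_mul ev_pm ev_pw. Qed.
Lemma ev_pN : ev pN = N.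
Proof. by rewrite ev_mul ev_pS ev_mul ev_pK ev_plam. Qed.
Lemma ev_pA x y : ev x < n -> ev y < m -> ev (pA x y) = AA (ev x) (ev y).
Proof. by move=> xn ym; rewrite ev_get !ev_add ev_mul ev_pm inv_A. Qed.
Lemma ev_pB x y : ev x < m -> ev y < n -> ev (pB x y) = BB (ev x) (ev y).
Proof. by move=> xn ym; rewrite ev_get !ev_add !ev_mul ev_pm ev_pn inv_B. Qed.

Opaque pn pm pM plam pK p2n p2M pw pS pN pA pB.

(** A product acts as a lazy conjunction: a factor has to be evaluated correctly only when those on
    its left hold, and these supply the range conditions for reading matrix entries. *)
Lemma muln_andb (a c : bool) (x : nat) : (a -> x = c) -> a * x = a && c.
Proof. by case: a => [->|] //; rewrite mul1n. Qed.

Lemma ev_pEdge r (Z : nat -> nat -> bool) u v : ev u < N -> ev v < N ->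
  (forall q k, q < K -> k < m -> get G mm r (q * m + k) = Z q k) ->
  ev (pEdge r u v) = edge n m M lam AA BB Z (ev u) (ev v).
Proof.
move=> uN vN Zg; rewrite /pEdge; set g := eDiv u pS.
set x := eMod u pS; set y := eMod v pS.
have S0 : 0 < S by rewrite /S /copy_size; lia.
have gE : ev g = ev u %/ S by rewrite evE ev_pS.
have xE : ev x = ev u %% S by rewrite evE ev_pS.
have yE : ev y = ev v %% S by rewrite evE ev_pS.
have gK : ev u %/ S %/ lam < K by rewrite !ltn_divLR // -mulnA mulnAC mulnA.
rewrite /edge -/S; set c := eDiv (eSub y p2n) pw; set c' := eDiv (eSub x p2n) pw.
have cE : ev c = (ev v %% S - 2 * n) %/ (2 * M + 1) by rewrite ev_div ev_sub yE ev_p2n ev_pw.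
have c'E : ev c' = (ev u %% S - 2 * n) %/ (2 * M + 1) by rewrite ev_div ev_sub xE ev_p2n ev_pw.
have chain_lt w : 2 * n <= w %% S -> (w %% S - 2 * n) %/ (2 * M + 1) %/ 2 < m.
  move=> nw; have := ltn_pmod w S0; rewrite {2}/S /copy_size => wS.
  rewrite -divnMA ltn_divLR ?muln_gt0 ?addn1 //.
  have <- : 2 * m * (2 * M + 1) = m * ((2 * M).+1 * 2) by rewrite -addn1; ring.
  by rewrite ltn_subLR.
rewrite /local_edge /enters /advances /leaves.
rewrite ev_mul ev_eq gE ev_div ev_pS -mulnb; congr (_ * _).
set e1 := eMul _ _; set e2 := eMul _ _; set e3 := eMul (eLe p2n x) _.
have E2 : ev e2 = [&& 2 * n <= ev u %% S, ev v %% S == (ev u %% S).+1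
    & (ev u %% S - 2 * n) %% (2 * M + 1) < 2 * M].
  rewrite ev_mul ev_le ev_p2n xE; apply: muln_andb => _.
  rewrite ev_mul ev_eq ev_add xE yE ev_num addn1; apply: muln_andb => _.
  by rewrite ev_lt ev_mod ev_sub xE ev_p2n ev_pw ev_p2M.
have E3 : ev e3 = [&& 2 * n <= ev u %% S, n <= ev v %% S, ev v %% S < 2 * n
    & (ev u %% S - 2 * n) %% (2 * M + 1) ==
      M + BB ((ev u %% S - 2 * n) %/ (2 * M + 1) %/ 2) (ev v %% S - n)].
  rewrite ev_mul ev_le ev_p2n xE; apply: muln_andb => nx.
  rewrite ev_mul ev_le ev_pn yE; apply: muln_andb => ny.
  rewrite ev_mul ev_lt ev_p2n yE; apply: muln_andb => yn.
  rewrite ev_eq ev_mod ev_sub xE ev_p2n ev_pw ev_add ev_pM ev_pB.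
  - by rewrite ev_div c'E ev_num ev_sub yE ev_pn.
  - by rewrite ev_div c'E ev_num; apply: chain_lt.
  - by rewrite ev_sub yE ev_pn ltn_subLR // addnn -mul2n.
rewrite !ev_or E2 E3 !lt0b; congr (nat_of_bool (_ || _)).
rewrite ev_mul ev_lt xE ev_pn -[RHS]lt0b; congr (0 < _).
apply: muln_andb => xn.
rewrite ev_mul ev_le ev_p2n yE; apply: muln_andb => ny.
have kE : ev (eDiv c (Num 2)) = (ev v %% S - 2 * n) %/ (2 * M + 1) %/ 2.
  by rewrite ev_div cE ev_num.
have km := chain_lt _ ny; rewrite -kE in km.
rewrite ev_mul ev_eq ev_add ev_mod ev_sub yE ev_p2n ev_pw ev_pM ev_pA ?xE //.
rewrite kE; apply: muln_andb => _; rewrite kE in km.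
rewrite ev_mul ev_get ev_add ev_mul ev_div gE ev_plam ev_pm kE Zg //.
apply: muln_andb => _.
rewrite ev_or ev_eq ev_mod cE !ev_num lt0b ev_eq ev_mod ev_div kE ev_get ev_mod gE.
by rewrite ev_plam inv_pow ?ltn_mod // !ev_num lt0b.
Qed.

End Eval.

Variables (P Q : program) (W : nat) (F : option state -> bool).
Hypotheses (F_absorbing : forall s b, F s -> F (step Q W s b))
  (GW : G ^ 2 < W).
Local Notation attains := (attains P Q W G F).

Let V2 : 1 < V. Proof. by lia. Qed.

Lemma get_bound mm r a : (forall x, absz (mm x) <= V) -> get G mm r a <= V.
Proof. by move=> mV; apply: leq_trans (pospart_le _) (mV _). Qed.

Section Tail.
Variables (r : nat) (o : nat -> nat).
Hypotheses (r5 : 4 < r) (NN_V : N * N + 1 <= V) (H_V : n * n * K * lam <= V)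
  (M2_V : 2 * M <= V).

Let K0 : 0 < K. Proof. by rewrite !muln_gt0 lam0. Qed.

(** Stated for whatever the oracle has left in its region; the correctness of the answer enters in
    [best_isolating]. *)
Lemma attains_tail cs T mm v :
  all (fits V G) [:: Loop r.+2 (eMul (eMul (eMul pn pn) pK) plam) (digit_val r);
      Loop r.+3 (eMul (eMul pn pn) pK) (best_val r)] ->
  inv mm -> (forall a, a < N * N -> get G mm r.+1 a = o a) ->
  attains cs T (fill G (fill G mm r.+2 (n * n * K * lam) (digits n m M lam K o))
      r.+3 (n * n * K) (fun e => best n m M lam K AA BB o (e %/ K) (e %% K))) v ->
  attains ([:: Loop r.+2 (eMul (eMul (eMul pn pn) pK) plam) (digit_val r);
      Loop r.+3 (eMul (eMul pn pn) pK) (best_val r)] ++ cs)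
    (loop_time r.+2 (eMul (eMul (eMul pn pn) pK) plam) (digit_val r) (n * n * K * lam) +
     (loop_time r.+3 (eMul (eMul pn pn) pK) (best_val r) (n * n * K) + T)) mm v.
Proof.
move=> /and3P[/and3P[wc1 we1 rG1] /and3P[wc2 we2 rG2] _] I oE vP.
have nnK0 : 0 < n * n * K by rewrite muln_gt0 K0 andbT muln_gt0 n0.
have nnKl0 : 0 < n * n * K * lam by rewrite muln_gt0 nnK0.
have HG : n * n * K * lam <= G by apply: leq_trans (ltnW VG).
have nnK_le : n * n * K <= n * n * K * lam by rewrite leq_pmulr.
have dV a : digits n m M lam K o a <= V.
  apply: leq_trans (ltnW (digits_lt _ _ _ _ _ _ lam0)) _.
  by apply: leq_trans lam_V; rewrite leq_exp2l // ltn_mod.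
have I1 c : c <= n * n * K * lam ->
    inv (fill G mm r.+2 c (digits n m M lam K o)).
  by move=> c_le; apply: inv_fill => //; [lia|apply: leq_trans HG].
set md := fill G mm r.+2 _ _ in vP *.
have bV e : best n m M lam K AA BB o (e %/ K) (e %% K) <= V.
  by apply: leq_trans (best_le_2M _ _ _ _ _ _ _ _ _ _) _.
have I2 c : c <= n * n * K -> inv (fill G md r.+3 c
    (fun e => best n m M lam K AA BB o (e %/ K) (e %% K))).
  move=> c_le; apply: inv_fill => //; [lia|lia|exact: I1].
apply: (attains_det_loop V2 GW (h := digits n m M lam K o)) => //.
- by rewrite nnKl0.
- exact: (inv_bound I).
- by rewrite !ev_mul (ev_pn _ _ I) (ev_pK _ _ I) (ev_plam _ _ I).
- move=> b a aH; have Ia := I1 a (ltnW aH).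
  have aG : a < G by apply: leq_trans HG.
  have eK : a %/ lam %/ K < n * n by rewrite !ltn_divLR.
  rewrite (digits_rec _ _ _ _ _ a lam0) /digit_val.
  set eb := eMod Idx plam; set ee := eDiv Idx plam.
  have ebE : eval G (fill G mm r.+2 a (digits n m M lam K o)) a b eb = a %% lam.
    by rewrite ev_mod ev_idx ev_plam.
  have eeE : eval G (fill G mm r.+2 a (digits n m M lam K o)) a b ee = a %/ lam.
    by rewrite ev_div ev_idx ev_plam.
  rewrite ev_add ev_if ebE; congr (_ + _).
    case: ifP => // a0; rewrite ev_get ev_sub ev_idx ev_num get_fill ?eqxx //=.
    + by rewrite ifT subn1 //; have := leq_mod a lam; lia.
    + by apply: leq_ltn_trans aG; apply: leq_subr.
    + exact: ltnW.
  set es := eMul (eAdd _ eb) pS.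
  have esE : eval G (fill G mm r.+2 a (digits n m M lam K o)) a b es =
      (a %/ lam %% K * lam + a %% lam) * S.
    by rewrite ev_mul ev_add ev_mul ev_mod eeE ebE ev_pK // ev_plam // ev_pS.
  set ep := eDiv ee pK.
  have epE : eval G (fill G mm r.+2 a (digits n m M lam K o)) a b ep =
      a %/ lam %/ K by rewrite ev_div eeE ev_pK.
  rewrite ev_mul ev_not ev_eq ev_num ev_get !ev_add ev_mul ev_add esE.
  rewrite ev_div epE ev_mod epE ev_pN // ev_pn //.
  rewrite ev_get ebE (inv_pow Ia) ?ltn_mod // eqb0 /bit_query -/S -/N.
  congr (nat_of_bool (~~ (_ == _)) * _).
  have gS : (a %/ lam %% K * lam + a %% lam).+1 * S <= N.
    rewrite leq_mul2r; apply/orP; right.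
    have : (a %/ lam %% K).+1 * lam <= K * lam by rewrite leq_mul2r ltn_mod K0 orbT.
    by rewrite mulSn; have := ltn_pmod a lam0; lia.
  have iN : a %/ lam %/ K %/ n < n by rewrite ltn_divLR.
  have jN : a %/ lam %/ K %% n < n by rewrite ltn_mod.
  have nS : 2 * n <= S by rewrite /S /copy_size leq_addr.
  move: gS; rewrite mulSn; set g := _ * S => gS.
  set x := g + _; set y := g + _.
  have xN : x < N by rewrite /x; lia.
  have yN : y < N by rewrite /y; lia.
  have idx : x * N + y < N * N.
    by have : x.+1 * N <= N * N by [rewrite leq_mul2r xN orbT]; rewrite mulSn; lia.
  by rewrite get_fill ?(ltnW aG) ?oE //; [rewrite ifN // eqn_leq ltnn andbF|lia].
apply: (attains_det_loop V2 GW
  (h := fun e => best n m M lam K AA BB o (e %/ K) (e %% K)) _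
  (inv_bound (I1 _ (leqnn _))) wc2 we2 rG2 _ _ _ vP).
- by rewrite nnK0 (leq_trans nnK_le).
- have J := I1 _ (leqnn (n * n * K * lam)).
  by rewrite !ev_mul (ev_pn _ _ J) (ev_pK _ _ J).
- move=> b e eH; have Ie := I2 e (ltnW eH).
  have eG : e < G by apply: leq_trans (leq_trans eH nnK_le) HG.
  rewrite [RHS](best_rec _ _ _ _ _ _ _ _ K0) /best_val.
  set ek := Get r.+2 _; set ep := eDiv Idx pK; set eq := eMod Idx pK.
  set mf := fill G md r.+3 e _ in Ie *.
  have epE : eval G mf e b ep = e %/ K by rewrite ev_div ev_idx ev_pK.
  have eqE : eval G mf e b eq = e %% K by rewrite ev_mod ev_idx ev_pK.
  have lam1 : lam - 1 < lam by lia.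
  have el : e * lam + (lam - 1) < n * n * K * lam.
    have : e.+1 * lam <= n * n * K * lam by rewrite leq_mul2r eH orbT.
    by rewrite mulSn; lia.
  have ekE : eval G mf e b ek = digits n m M lam K o (e * lam + (lam - 1)).
    rewrite ev_get ev_add ev_mul ev_sub ev_idx ev_plam // ev_num.
    have elG : e * lam + (lam - 1) < G by apply: leq_trans HG.
    rewrite /mf get_fill ?(ltnW eG) //.
    rewrite ifN; last by rewrite eqn_leq ltnn andbF.
    by rewrite /md get_fill // eqxx el.
  have pnn : e %/ K < n * n by rewrite ltn_divLR.
  rewrite ev_min ev_if ev_lt ekE ev_pm // ev_p2M // lt0b.
  rewrite ev_if eqE ev_p2M //; congr (minn _ _).
    rewrite /candidate -divn_eq; case: ifP => // km.
    rewrite ev_add ev_pA ?ev_pB //.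
    - by rewrite ev_div ev_mod epE ekE ev_pn.
    - by rewrite ekE.
    - by rewrite ev_mod epE ev_pn // ltn_mod.
    - by rewrite ev_div epE ev_pn // ltn_divLR.
    - by rewrite ekE.
  case: ifP => // e0; have e_gt0 : 0 < e by have := leq_mod e K; lia.
  rewrite ev_get ev_sub ev_idx ev_num subn1 /mf get_fill ?(ltnW eG) //; last first.
    by apply: leq_ltn_trans (leq_pred e) eG.
  by rewrite eqxx /= prednK // leqnn.
- by move=> e _; exact: bV.
Qed.
End Tail.

Section Round.
Variables (r tP BP : nat) (f : nat -> nat) (D : nat -> nat -> nat).
Hypotheses (r5 : 4 < r) (NN_V : N * N + 1 <= V) (H_V : n * n * K * lam <= V)
  (M2_V : 2 * M <= V) (Z_V : K * m <= V) (BP0 : 0 < BP) (BPV : BP <= V)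
  (f1 : f 1 = 1) (f2 : f 2 != 1).
Hypotheses (AM : forall i k, i < n -> k < m -> AA i k <= M)
  (BM : forall k j, k < m -> j < n -> BB k j <= M)
  (D_le : forall i j k, i < n -> j < n -> k < m -> D i j <= AA i k + BB k j)
  (D_2M : forall i j, i < n -> j < n -> D i j <= 2 * M)
  (D_att : forall i j, i < n -> j < n -> exists2 k, k < m & D i j = AA i k + BB k j).
Hypotheses (m_lam : 2 * m < 2 ^ lam)
  (small : ((n * n)%:R * (7 / 8) ^+ (12 * lam) <= 1 / 4 :> rat)%R).

Let K0 : 0 < K. Proof. by rewrite !muln_gt0 lam0. Qed.
Let N0 : 0 < N. Proof. by rewrite !muln_gt0 lam0 addn_gt0 muln_gt0 n0. Qed.

Definition reduction_graph (z : seq bool) : 'M[bool]_N :=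
  \matrix_(u, v) edge n m M lam AA BB (survives lam m z) u v.

Definition graph_cell (z : seq bool) (a : nat) : nat :=
  if 0 < a then
    nat_of_bool (edge n m M lam AA BB (survives lam m z) (a.-1 %/ N) (a.-1 %% N))
  else N.

Lemma nth_graph_input z a :
  nth 0%R (@Defs.input (count_apsp f N) (reduction_graph z)) a =
  Posz (if a < N * N + 1 then graph_cell z a else 0).
Proof.
case: a => [|a] /=; first by rewrite addn1.
rewrite addn1 ltnS; case: ltnP => aN; last by rewrite nth_default // size_row_major.
have i_N : a %/ N < N by rewrite ltn_divLR.
have j_N : a %% N < N by rewrite ltn_mod.
have := nth_row_major (map_mx (fun b : bool => Posz b) (reduction_graph z))
  (Ordinal i_N) (Ordinal j_N).
by rewrite /= -divn_eq => ->; rewrite !mxE.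
Qed.

Lemma reduction_graph_loopless z :
  @admissible (count_apsp f N) (reduction_graph z).
Proof. by apply/forallP => u; rewrite mxE edge_irrefl. Qed.

Definition optimal (p : nat) : seq nat :=
  [seq k <- iota 0 m | AA (p %/ n) k + BB k (p %% n) == D (p %/ n) (p %% n)].

Definition isolating (z : seq bool) : bool :=
  all (fun O => has (fun q => count (survives lam m z q) O == 1) (iota 0 (12 * lam * lam)))
    [seq optimal p | p <- iota 0 (n * n)].

Lemma avg_isolating : (3 / 4 <= avg (K * m) (fun z => (isolating z)%:R))%R.
Proof.
rewrite /K -[12 * (lam * lam) * m]mulnA -[lam * lam * m]mulnA.
have := @avg_survives lam m (12 * lam) [seq optimal p | p <- iota 0 (n * n)] m0.
rewrite size_map size_iota -mulnA; apply => //.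
apply/allP => _ /mapP[p + ->]; rewrite mem_iota /= => p_nn.
have i_n : p %/ n < n by rewrite ltn_divLR.
have j_n : p %% n < n by rewrite ltn_mod.
have size_m : size (optimal p) <= m by rewrite size_filter -[leqRHS](size_iota 0) count_size.
rewrite filter_uniq ?iota_uniq //=; apply/and3P; split.
- by apply/allP => k; rewrite mem_filter mem_iota => /andP[_].
- have [k km DE] := D_att i_n j_n.
  by rewrite size_filter -has_count; apply/hasP; exists k; rewrite ?mem_iota // DE.
- by apply: leq_ltn_trans m_lam; rewrite leq_mul2l size_m.
Qed.

(** In the isolating sample the surviving optimal index is strictly better than all other survivors,
    as [count_isolated] demands; [f 1 = 1] and [f 2 != 1] then separate the two possible counts. *)
Lemma best_isolating z (o : nat -> nat) p : isolating z ->
  (forall a, a < N * N -> o a =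
     pospart (nth 0%R (@Defs.output (count_apsp f N) (reduction_graph z)) a)) ->
  p < n * n ->
  best n m M lam K AA BB o p (K - 1) = D (p %/ n) (p %% n).
Proof.
move=> /allP iso oE p_nn.
have i_n : p %/ n < n by rewrite ltn_divLR.
have j_n : p %% n < n by rewrite ltn_mod.
have := iso (optimal p); rewrite map_f ?mem_iota // => /(_ isT) /hasP[q].
rewrite mem_iota /= -mulnA -/K => qK /eqP.
rewrite -size_filter => sz1.
have [k optE] : exists k, [seq k <- optimal p | survives lam m z q k] = [:: k].
  by case: (filter _ _) sz1 => [|k []] // _; exists k.
have : k \in [seq k <- optimal p | survives lam m z q k] by rewrite optE inE.
rewrite mem_filter => /andP[zk]; rewrite mem_filter mem_iota /= => /andP[/eqP kE km].
have uniq_k k' : k' < m -> k' != k -> survives lam m z q k' ->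
    AA (p %/ n) k + BB k (p %% n) < AA (p %/ n) k' + BB k' (p %% n).
  move=> k'm k'k zk'; rewrite kE ltn_neqAle D_le // andbT.
  apply: contraNN k'k => /eqP E.
  by rewrite -mem_seq1 -optE !mem_filter zk' mem_iota k'm -E eqxx.
apply: (best_eq D_le D_2M (q := q) (k := k)) => //.
  by apply: leq_ltn_trans m_lam; lia.
move=> b b_lam; rewrite /bit_query -/S -/N.
set g := q * lam + b.
have gE : (g %/ lam = q) * (g %% lam = b).
  by rewrite divnMDl // divn_small // addn0 modnMDl modn_small.
have gN : g.+1 * S <= N.
  rewrite leq_mul2r; apply/orP; right.
  by have : q.+1 * lam <= K * lam by [rewrite leq_mul2r qK orbT]; rewrite mulSn /g; lia.
have nS : 2 * n <= S by rewrite /S /copy_size leq_addr.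
have uN : g * S + p %/ n < N by move: gN; rewrite mulSn; lia.
have vN : g * S + (n + p %% n) < N by move: gN; rewrite mulSn; lia.
have idx : (g * S + p %/ n) * N + (g * S + (n + p %% n)) < N * N.
  have : (g * S + p %/ n).+1 * N <= N * N by rewrite leq_mul2r uN orbT.
  by rewrite mulSn; lia.
rewrite oE //=.
have := nth_row_major (\matrix_(u, v) Posz (f (count_shortest_paths (reduction_graph z) u v)))
  (Ordinal uN) (Ordinal vN).
rewrite /= => ->; rewrite mxE /=.
rewrite (@count_isolated n m M lam AA BB (survives lam m z) AM BM N (reduction_graph z)
  g (p %/ n) (p %% n) k) //.
- have := ltn_pmod (k %/ 2 ^ (g %% lam)) (isT : 0 < 2); rewrite gE.
  by case: (_ %% 2) => [|[|]] // _; rewrite ?f1 ?f2.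
- by move=> x y; rewrite mxE.
- by rewrite gE.
- by move=> k' k'm k'k; rewrite gE; apply: uniq_k.
Qed.

Hypotheses
  (P_term : forall E : 'M[bool]_N, @admissible (count_apsp f N) E ->
     forall z, size z = tP ->
     terminates P (run P BP (@Defs.input (count_apsp f N) E) z))
  (P_ok : forall E : 'M[bool]_N, @admissible (count_apsp f N) E ->
     (2 / 3 <= avg tP (fun z =>
        (outputs P (run P BP (@Defs.input (count_apsp f N) E) z)
           (@Defs.output (count_apsp f N) E))%:R))%R).

Definition round_time : nat :=
  loop_time r (eMul pK pm) (sample_val r) (K * m) +
  (loop_time r.+1 (eAdd (eMul pN pN) (Num 1)) (graph_val r) (N * N + 1) +
  (call_time P r.+1 tP +
  (loop_time r.+2 (eMul (eMul (eMul pn pn) pK) plam) (digit_val r) (n * n * K * lam) +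
   loop_time r.+3 (eMul (eMul pn pn) pK) (best_val r) (n * n * K)))).

(** The continuation is worth [v1] if all entries in region [r + 3] are right, and [v2] otherwise.
    The lower bound by [D] is granted in both cases, so that a later minimum can ignore a failed
    round. *)
Lemma attains_round cs T mm v1 v2 : (0 <= v2 <= v1)%R ->
  all (fits V G) (round r) -> inv mm ->
  (forall a, a < G -> mm (r.+1 * G + a) = 0%R) ->
  (forall mm', inv mm' ->
     (forall x, ~~ (r * G <= x < r.+4 * G) -> mm' x = mm x) ->
     (forall p, p < n * n ->
        D (p %/ n) (p %% n) <= get G mm' r.+3 (p * K + (K - 1)) <= 2 * M) ->
     attains cs T mm' v2 /\
     ((forall p, p < n * n ->
         get G mm' r.+3 (p * K + (K - 1)) = D (p %/ n) (p %% n)) ->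
      attains cs T mm' v1)) ->
  attains (round r ++ cs) (round_time + T) mm ((v1 + v2) / 2).
Proof.
move=> /andP[v20 v21] /andP[/and3P[wc1 we1 rG1] /andP[/and3P[wc2 we2 rG2]
  /andP[rG3 fit]]] I fresh post.
have Km0 : 0 < K * m by rewrite muln_gt0 K0.
have KmG : K * m <= G by lia.
have NNG : N * N + 1 <= G by lia.
pose hz z a : nat := survives lam m z (a %/ m) (a %% m).
have hzV z a : hz z a <= V by rewrite /hz; case: (survives _ _ _ _ _) => //; lia.
have Iz z c : c <= K * m -> inv (fill G mm r c (hz z)).
  by move=> cK; apply: inv_fill => //; lia.
pose v z : rat := (v2 + (v1 - v2) * (2 / 3) * (isolating z)%:R)%R.
have reassoc a b c d e t : a + (b + (c + (d + e))) + t = a + (b + (c + (d + (e + t)))).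
  by rewrite !addnA.
rewrite /round_time reassoc.
apply: (@attains_homo _ _ _ _ _ F_absorbing _ _ _ _ _ (avg (K * m) v) (leqnn _)).
  by rewrite avg_affine; apply: mix_isolating avg_isolating.
apply: (attains_loop V2 GW (h := hz)) => //.
- by rewrite Km0.
- exact: (inv_bound I).
- by rewrite ev_mul ev_pK // ev_pm.
- move=> z a zK aK; have Ia := Iz z a (ltnW aK).
  have aG : a < G by lia.
  rewrite ev_mul ev_flip ev_or ev_eq ev_mod ev_div ev_idx ev_plam // ev_pm // ev_num lt0b.
  rewrite ev_get ev_sub ev_idx ev_pm // get_fill ?eqxx /=; last 2 first.
  + by lia.
  + exact: ltnW.
  rewrite /hz (survivesE m z (a %/ m) (a %% m) lam0) -divn_eq -mulnb; congr (_ * nat_of_bool _).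
  case: eqVneq => //= am.
  have ma : m <= a by rewrite leqNgt; apply: contraNN am => am; rewrite divn_small // mod0n.
  rewrite ifT; last by lia.
  have amE : a - m = (a %/ m).-1 * m + a %% m.
    have q0 : 0 < a %/ m by rewrite divn_gt0.
    rewrite {1}(divn_eq a m) -{1}(prednK q0) mulSn; lia.
  by rewrite amE divnMDl // (divn_small (ltn_pmod a m0)) addn0 modnMDl modn_mod lt0b.
move=> z zK; set mz := fill G mm r (K * m) (hz z).
have Imz : inv mz by exact: Iz.
have cell_V a : a < N * N + 1 -> graph_cell z a <= V.
  rewrite /graph_cell => aN; case: ifP => _; first by case: (edge _ _ _ _ _ _ _ _ _) => //; lia.
  by have : N * 1 <= N * N by [rewrite leq_mul2l N0 orbT]; lia.
have Ig c : c <= N * N + 1 -> inv (fill G mz r.+1 c (graph_cell z)).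
  by move=> cN; apply: inv_fill => //; [lia|lia|move=> a ac; apply: cell_V; lia].
apply: (attains_det_loop V2 GW (h := graph_cell z)) => //.
- by rewrite addn1 /= -addn1.
- exact: (inv_bound Imz).
- by rewrite ev_add ev_mul ev_pN // ev_num.
- move=> b a aN; have Ia := Ig a (ltnW aN).
  rewrite ev_if ev_idx ev_pN // /graph_cell; case: ifP => // a0.
  have uE : eval G (fill G mz r.+1 a (graph_cell z)) a b (eDiv (eSub Idx (Num 1)) pN)
      = a.-1 %/ N by rewrite ev_div ev_sub ev_idx ev_pN // ev_num subn1.
  have vE : eval G (fill G mz r.+1 a (graph_cell z)) a b (eMod (eSub Idx (Num 1)) pN)
      = a.-1 %% N by rewrite ev_mod ev_sub ev_idx ev_pN // ev_num subn1.
  rewrite (ev_pEdge _ (Z := survives lam m z)) ?uE ?vE ?ltn_mod //.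
    by rewrite ltn_divLR //; lia.
  move=> q k qK km.
  have qkm : q * m + k < K * m.
    by have : q.+1 * m <= K * m by [rewrite leq_mul2r qK orbT]; rewrite mulSn; lia.
  rewrite get_fill; [|by lia|by lia].
  rewrite ifN; last by rewrite eqn_leq ltnn andbF.
  rewrite /mz get_fill; [|by lia|by lia].
  by rewrite eqxx qkm /= /hz divnMDl // divn_small // addn0 modnMDl modn_small.
set mg := fill G mz r.+1 _ _; have Img : inv mg by exact: Ig.
set E := reduction_graph z.
have Eadm := reduction_graph_loopless z.
(* With the sample coins fixed, the value is [v2] when isolation failed, whatever the oracle
   answers. *)
apply: (@attains_homo _ _ _ _ _ F_absorbing _ _ _ _ _ (v2 + ((if isolating z then v1 else v2) - v2) *
   avg tP (fun z' => (outputs P (run P BP (@Defs.input (count_apsp f N) E) z')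
     (@Defs.output (count_apsp f N) E))%:R))%R (leqnn _)).
  exact: mix_correct (P_ok Eadm).
apply: (attains_call F_absorbing V2 GW BPV VG
  (xs := @Defs.input (count_apsp f N) E) (Out := fun s => outputs P s (@Defs.output (count_apsp f N) E))) => //.
- move=> a aG; rewrite nth_graph_input /mg /fill.
  case: ifP => [/andP[_ lt]|nlt].
    by rewrite addKn ifT //; lia.
  rewrite ifF; last by lia.
  by rewrite /mz fill_other ?fresh // mulSn; lia.
- by move=> a; rewrite nth_graph_input; case: ifP => // aN; apply: cell_V.
- exact: (inv_bound Img).
- exact: P_term.
- by case: ifP.
move=> m' m'V m'E.
have m'0 x : ~~ (r * G <= x < r.+2 * G) -> m' x = mm x.
  move=> xr; rewrite m'E; last exact: (@outside_region r G x 1 2 xr isT).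
  rewrite /mg (fill_other _ _ (@outside_region r G x 1 2 xr isT)) //.
  by rewrite /mz (fill_other _ _ (@outside_region r G x 0 2 xr isT)).
have Im' : inv m'.
  apply: (inv_ext _ m'V I) => x x5; apply: m'0.
  by have : 5 * G <= r * G by [rewrite leq_mul2r r5 orbT]; lia.
pose o := get G m' r.+1.
have tail u := @attains_tail r o r5 NN_V H_V M2_V cs T m' u fit Im' (fun a _ => erefl).
set mb := fill G (fill G m' _ _ _) _ _ _ in tail.
have H_G : n * n * K * lam <= G by lia.
have M_G : n * n * K <= G by apply: leq_trans H_G; rewrite leq_pmulr.
have digV a : digits n m M lam K o a <= V.
  apply: leq_trans (ltnW (digits_lt _ _ _ _ _ _ lam0)) _.
  by apply: leq_trans lam_V; rewrite leq_exp2l // ltn_mod.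
have Imb : inv mb.
  apply: inv_fill => //; first by lia.
    by move=> e _; apply: leq_trans (best_le_2M _ _ _ _ _ _ _ _ _ _) _.
  by apply: inv_fill => //; lia.
have mbE x : ~~ (r * G <= x < r.+4 * G) -> mb x = mm x.
  move=> xr; rewrite /mb (fill_other _ _ (@outside_region r G x 3 4 xr isT)) //.
  rewrite (fill_other _ _ (@outside_region r G x 2 4 xr isT)) //.
  apply: m'0; apply: contra xr => /andP[-> lt]; apply: leq_trans lt _.
  by rewrite leq_mul2r !ltnS leqW ?orbT.
have mbb p : p < n * n -> get G mb r.+3 (p * K + (K - 1)) =
    best n m M lam K AA BB o p (K - 1).
  move=> pnn; have pK : p * K + (K - 1) < n * n * K.
    by have : p.+1 * K <= n * n * K by [rewrite leq_mul2r pnn orbT]; rewrite mulSn; lia.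
  have K1 : K - 1 < K by lia.
  rewrite /mb get_fill //; last by lia.
  by rewrite eqxx pK /= divnMDl // (divn_small K1) addn0 modnMDl (modn_small K1).
have [|p2 p1] := post mb Imb mbE.
  by move=> p pnn; rewrite mbb // best_ge //= best_le_2M.
split; first exact: tail.
move=> s Os sE; case: ifP => [iso|_]; last exact: tail.
apply/tail/p1 => p pnn; rewrite mbb //.
apply: (best_isolating iso) => // a aN.
rewrite /o /get sE; last by lia.
move: Os; rewrite /= => /andP[_ /eqP <-]; rewrite nth_mkseq // size_row_major.
exact: aN.
Qed.

End Round.
End Instance.

(** * Initialisation, and the two rounds together *)

Definition bitlen (a : nat) : nat := if a is 0%N then 0%N else (trunc_log 2 a).+1.

Lemma bitlen_rec a : (0 < a)%N -> bitlen a = (1 + bitlen (a %/ 2))%N.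
Proof.
case: a => [|[|a]] // _; rewrite /bitlen.
rewrite trunc_log2S // divn2; case E : (a.+2./2) => //; lia.
Qed.

Lemma bitlen_le a : (bitlen a <= a)%N.
Proof.
case: a => // a; rewrite /bitlen.
by apply: leq_trans (ltn_expl _ (isT : (1 < 2)%N)) (trunc_logP _ _).
Qed.

Section Instance.
Local Open Scope nat_scope.
Variables (V G n m M lam : nat) (AA BB : nat -> nat -> nat).
Let K := 12 * (lam * lam).
Let S := copy_size n m M.
Let N := K * lam * S.
Hypotheses (n0 : 0 < n) (m0 : 0 < m) (lamE : lam = bitlen (2 * n))
  (in_V : 4 + (n * m + m * n) <= V) (lam_V : 2 ^ lam <= V) (VG : V < G)
  (n_V : 2 * n + 1 <= V) (K_V : K <= V).
Variables (P Q : program) (W : nat) (F : option state -> bool).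
Hypotheses (F_absorbing : forall s b, F s -> F (step Q W s b)) (GW : G ^ 2 < W).
Local Notation attains := (attains P Q W G F).
Local Notation inv := (inv V G n m M lam AA BB).

Let V2 : 1 < V. Proof. by lia. Qed.

Let lam0 : 0 < lam.
Proof. by rewrite lamE; case: (n) n0 => // n' _; rewrite mulnS. Qed.

Definition setup_time : nat :=
  loop_time 1 (eAdd p2n (Num 1))
    (eMul (ePos Idx) (eAdd (Num 1) (Get 1 (eDiv Idx (Num 2))))) (2 * n + 1) +
  (loop_time 2 (Num 1) (Get 1 p2n) 1 +
  (loop_time 3 (Num 1) (eMul (Num 12) (eMul plam plam)) 1 +
   loop_time 4 plam (eIf Idx (eMul (Num 2) (Get 4 (eSub Idx (Num 1)))) (Num 1)) lam)).

Lemma attains_setup cs T mm v : all (fits V G) setup ->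
  get G mm 0 0 = n -> get G mm 0 1 = m -> get G mm 0 3 = M ->
  (forall i k, i < n -> k < m -> get G mm 0 (4 + (i * m + k)) = AA i k) ->
  (forall k j, k < m -> j < n ->
    get G mm 0 (4 + (n * m + (k * n + j))) = BB k j) ->
  (forall x, absz (mm x) <= V) -> (forall x, G <= x -> mm x = 0%R) ->
  (forall mm', inv mm' -> (forall x, 5 * G <= x -> mm' x = 0%R) -> attains cs T mm' v) ->
  attains (setup ++ cs) (setup_time + T) mm v.
Proof.
move=> /andP[/and3P[wc1 we1 rG1] /andP[/and3P[wc2 we2 rG2]
  /andP[/and3P[wc3 we3 rG3] /andP[/and3P[wc4 we4 rG4] _]]]] In Im IM IA IB mV zero vP.
have reassoc a b c d t : a + (b + (c + d)) + t = a + (b + (c + (d + t))).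
  by rewrite !addnA.
rewrite /setup_time reassoc.
have blV a : a < 2 * n + 1 -> bitlen a <= V by have := bitlen_le a; lia.
have n2G : 2 * n + 1 <= G by lia.
have p2nE mm' i b : get G mm' 0 0 = n -> eval G mm' i b p2n = 2 * n.
  by move=> mn; rewrite ev_mul ev_num ev_get mn.
have G0 : 0 < G by lia.
have GA i k : i < n -> k < m -> 4 + (i * m + k) < G.
  by move=> iN km; have : i.+1 * m <= n * m by [rewrite leq_mul2r iN orbT]; rewrite mulSn; lia.
have GB k j : k < m -> j < n -> 4 + (n * m + (k * n + j)) < G.
  by move=> km jN; have : k.+1 * n <= m * n by [rewrite leq_mul2r km orbT]; rewrite mulSn; lia.
apply: (attains_det_loop V2 GW (h := bitlen) _ mV wc1 we1 rG1).
- by rewrite addn1 /= -addn1.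
- by rewrite ev_add p2nE // ev_num.
- move=> b a an; have aG : a < G by lia.
  rewrite ev_mul ev_pos ev_idx ev_add ev_get ev_div ev_idx !ev_num.
  case: (posnP a) => [->//|a0]; rewrite mul1n bitlen_rec // get_fill; [|lia|lia].
  by rewrite eqxx ltn_Pdiv.
- exact: blV.
set m1 := fill _ _ _ _ _.
have m1V : forall x, absz (m1 x) <= V by apply: fill_bound.
have m1g a r : r != 1 -> a < G -> get G m1 r a = get G mm r a.
  by move=> r1 aG; rewrite get_fill // (negPf r1).
apply: (attains_det_loop V2 GW (h := fun=> lam) _ m1V wc2 we2 rG2).
- by rewrite (ltnW V2).
- by [].
- move=> b a; rewrite ltnS leqn0 => /eqP ->; rewrite fill0 ev_get p2nE; last first.
    by rewrite m1g.
  rewrite get_fill; [|lia|lia].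
  by rewrite lamE ifT //; lia.
- by move=> a _; apply: leq_trans lam_V; apply/ltnW/ltn_expl.
set m2 := fill _ _ _ _ _.
have lamG : lam < G by apply: leq_ltn_trans VG; apply: leq_trans lam_V; apply/ltnW/ltn_expl.
have m2V : forall x, absz (m2 x) <= V.
  by apply: fill_bound => // a _; apply: leq_trans lam_V; apply/ltnW/ltn_expl.
have m2g a r : r \notin [:: 1; 2] -> a < G -> get G m2 r a = get G mm r a.
  rewrite !inE negb_or => /andP[r1 r2] aG.
  by rewrite get_fill ?(negPf r2) ?m1g //; lia.
have m2lam : get G m2 2 0 = lam by rewrite get_fill //; lia.
apply: (attains_det_loop V2 GW (h := fun=> K) _ m2V wc3 we3 rG3).
- by rewrite (ltnW V2).
- by [].
- move=> b a; rewrite ltnS leqn0 => /eqP ->; rewrite fill0 !ev_mul !ev_num ev_get ev_num.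
  by rewrite m2lam.
- by move=> a _.
set m3 := fill _ _ _ _ _.
have m3V : forall x, absz (m3 x) <= V by apply: fill_bound.
have m3g a r : r \notin [:: 1; 2; 3] -> a < G -> get G m3 r a = get G mm r a.
  rewrite inE negb_or => /andP[r1]; rewrite inE negb_or => /andP[r2 r3] aG.
  rewrite inE in r3; rewrite get_fill // (negPf r3) m2g //.
  by rewrite !inE negb_or r1.
have m3lam : get G m3 2 0 = lam by rewrite get_fill //; lia.
have powV a : a < lam -> 2 ^ a <= V.
  by move=> al; apply: leq_trans lam_V; rewrite leq_exp2l // ltnW.
apply: (attains_det_loop V2 GW (h := fun a => 2 ^ a) _ m3V wc4 we4 rG4).
- by rewrite lam0; apply: leq_trans lam_V; apply/ltnW/ltn_expl.
- by rewrite ev_get ev_num.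
- move=> b a al; have aG : a < G by lia.
  rewrite ev_if ev_idx; case: posnP => [->//|a0].
  rewrite ev_mul ev_get ev_sub ev_idx !ev_num get_fill; [|lia|lia].
  by rewrite eqxx /= ifT; [rewrite subn1 -expnS prednK|lia].
- exact: powV.
set m4 := fill _ _ _ _ _.
have m4V : forall x, absz (m4 x) <= V by apply: fill_bound.
have m4g a r : r \notin [:: 1; 2; 3; 4] -> a < G -> get G m4 r a = get G mm r a.
  move=> r4 aG; rewrite get_fill //; last by lia.
  rewrite ifN; last by apply: contra r4 => /andP[/eqP -> _].
  by apply: m3g => //; apply: contra r4; rewrite !inE => /or3P[]->; rewrite ?orbT.
apply: vP.
  split=> //.
  - by rewrite m4g.
  - by rewrite m4g //; lia.
  - by rewrite m4g //; lia.
  - by move=> i k iN km; rewrite m4g ?GA ?IA.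
  - by move=> k j km jN; rewrite m4g ?GB ?IB.
  - by rewrite get_fill //; lia.
  - rewrite get_fill //; last by lia.
    by rewrite get_fill //; lia.
  - by move=> b bl; rewrite get_fill ?eqxx ?bl //; lia.
move=> x xG; rewrite /m4 fill_other; [|lia|lia].
rewrite /m3 fill_other; [|lia|lia]; rewrite /m2 fill_other; [|lia|lia].
by rewrite /m1 fill_other ?zero //; lia.
Qed.

Section Final.
Variables (D : nat -> nat -> nat) (vb : rat).
Hypotheses (nn_V : n * n <= V) (M2_V : 2 * M <= V) (K_nn : n * n * K <= V)
  (final_ok : forall s, halted Q s ->
     (forall a, a < n * n -> memory s a = D (a %/ n) (a %% n) :> int) -> F (Some s))
  (final_vb : vb = 0%R \/ vb = 1%R /\ forall s, halted Q s -> F (Some s)).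

Definition final_cmds : seq cmd := [:: Loop 0 (eMul pn pn) combine_val].

Definition final_time : nat := loop_time 0 (eMul pn pn) combine_val (n * n).

(** [vb] is the value granted when both rounds fail: 0 for the event of a correct output, 1 for
    termination. One derivation thus serves both events. *)
Lemma attains_final mm : all (fits V G) final_cmds -> inv mm ->
  (forall r p, r \in [:: 8; 13] -> p < n * n ->
     D (p %/ n) (p %% n) <= get G mm r (p * K + (K - 1)) <= 2 * M) ->
  attains final_cmds (final_time + 0) mm vb /\
  ((exists2 r, r \in [:: 8; 13] &
      forall p, p < n * n -> get G mm r (p * K + (K - 1)) = D (p %/ n) (p %% n)) ->
   attains final_cmds (final_time + 0) mm 1).
Proof.
move=> /andP[/and3P[wc we rG] _] I bounds.
pose h p := minn (get G mm 8 (p * K + (K - 1))) (get G mm 13 (p * K + (K - 1))).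
have K0 : 0 < K by rewrite !muln_gt0 lam0.
have loop v : attains [::] 0 (fill G mm 0 (n * n) h) v ->
    attains final_cmds (final_time + 0) mm v.
  apply: (attains_det_loop V2 GW _ (inv_bound I) wc we rG).
  - by rewrite muln_gt0 n0.
  - by rewrite ev_mul (ev_pn _ _ I).
  - move=> b a ann.
    have pKE : eval G (fill G mm 0 a h) a b pK = K.
      by rewrite ev_get ev_num get_fill ?(inv_K I) //; lia.
    rewrite ev_min !ev_get ev_add ev_mul ev_sub ev_idx ev_num pKE.
    have idx : a * K + (K - 1) < G.
      have : a.+1 * K <= n * n * K by rewrite leq_mul2r ann orbT.
      by rewrite mulSn; lia.
    by rewrite !get_fill //; lia.
  - by move=> a ann; rewrite geq_min (get_bound _ _ _ (inv_bound I)).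
split.
  apply: loop; case: final_vb => [->|[-> Fh]]; first by move=> s _ _ _; exact: pr_ge0.
  by apply: attains_nil => // s hs _; exact: Fh.
case=> r rin rE; apply/loop/attains_nil => // s hs sm; apply: final_ok => // a ann.
rewrite sm /fill mul0n add0n /= ann subn0 /h.
have /andP[b8 _] := bounds 8 a isT ann.
have /andP[b13 _] := bounds 13 a isT ann.
congr Posz; move: rin; rewrite !inE => /orP[/eqP E|/eqP E];
  by move: (rE a ann); rewrite E => ->; lia.
Qed.

Section Main.
Variables (tP BP : nat) (f : nat -> nat).
Hypotheses (NN_V : N * N + 1 <= V) (H_V : n * n * K * lam <= V)
  (Z_V : K * m <= V) (BP0 : 0 < BP) (BPV : BP <= V)
  (f1 : f 1 = 1) (f2 : f 2 != 1)
  (AM : forall i k, i < n -> k < m -> AA i k <= M)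
  (BM : forall k j, k < m -> j < n -> BB k j <= M)
  (D_le : forall i j k, i < n -> j < n -> k < m -> D i j <= AA i k + BB k j)
  (D_2M : forall i j, i < n -> j < n -> D i j <= 2 * M)
  (D_att : forall i j, i < n -> j < n -> exists2 k, k < m & D i j = AA i k + BB k j)
  (m_lam : 2 * m < 2 ^ lam)
  (small : ((n * n)%:R * (7 / 8) ^+ (12 * lam) <= 1 / 4 :> rat)%R)
  (P_term : forall E : 'M[bool]_N, @admissible (count_apsp f N) E ->
     forall z, size z = tP ->
     terminates P (run P BP (@Defs.input (count_apsp f N) E) z))
  (P_ok : forall E : 'M[bool]_N, @admissible (count_apsp f N) E ->
     (2 / 3 <= avg tP (fun z =>
        (outputs P (run P BP (@Defs.input (count_apsp f N) E) z)
           (@Defs.output (count_apsp f N) E))%:R))%R).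

Definition minplus_time : nat :=
  setup_time + (round_time n m M lam P 5 tP +
    (round_time n m M lam P 10 tP + (final_time + 0))).

(** Each round closes half of the gap to 1: the value is 3/4 for [vb = 0] and 1 for [vb = 1]. *)
Lemma attains_minplus mm : all (fits V G) minplus_cmds ->
  get G mm 0 0 = n -> get G mm 0 1 = m -> get G mm 0 3 = M ->
  (forall i k, i < n -> k < m -> get G mm 0 (4 + (i * m + k)) = AA i k) ->
  (forall k j, k < m -> j < n ->
    get G mm 0 (4 + (n * m + (k * n + j))) = BB k j) ->
  (forall x, absz (mm x) <= V) -> (forall x, G <= x -> mm x = 0%R) ->
  attains minplus_cmds minplus_time mm ((1 + (1 + vb) / 2) / 2).
Proof.
rewrite /minplus_cmds !all_cat => /and4P[fit_s fit1 fit2 fit_f] In Im IM IA IB mV zero.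
have vb01 : (0 <= vb <= 1)%R by case: final_vb => [->|[-> _]].
apply: attains_setup => // m1 I1 fresh1.
have mid v : (v = vb \/ v = 1)%R -> (0 <= (v + v) / 2 <= 1)%R by case=> ->; lra.
have rnd r := @attains_round V G n m M lam AA BB n0 m0 lam0 in_V lam_V VG P Q W F
  F_absorbing GW r tP BP f D.
have half : (0 <= (1 + vb) / 2 <= 1)%R by move: vb01; lra.
apply: (rnd _) => //.
  by move=> a aG; apply: fresh1; lia.
move=> m2 I2 m2E b2.
have fresh2 a : a < G -> m2 (11 * G + a) = 0%R.
  by move=> aG; rewrite m2E ?fresh1 //; lia.
(* The second round writes in the regions 10 to 13 only, so the minima of the first one are still in
   region 8. *)
have keep m3 : (forall x, ~~ (10 * G <= x < 14 * G) -> m3 x = m2 x) ->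
    forall p, p < n * n -> get G m3 8 (p * K + (K - 1)) = get G m2 8 (p * K + (K - 1)).
  move=> m3E p pnn; rewrite /get m3E //.
  have : p.+1 * K <= n * n * K by rewrite leq_mul2r pnn orbT.
  have K0 : 0 < K by rewrite !muln_gt0 lam0.
  by rewrite mulSn; lia.
have both m3 : (forall x, ~~ (10 * G <= x < 14 * G) -> m3 x = m2 x) ->
    (forall p, p < n * n ->
       D (p %/ n) (p %% n) <= get G m3 13 (p * K + (K - 1)) <= 2 * M) ->
    forall r p, r \in [:: 8; 13] -> p < n * n ->
      D (p %/ n) (p %% n) <= get G m3 r (p * K + (K - 1)) <= 2 * M.
  move=> m3E b3 r p; rewrite !inE => /orP[/eqP->|/eqP->] pnn; last exact: b3.
  by rewrite keep //; exact: b2.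
split.
  apply: (rnd _) => // m3 I3 m3E b3.
  have [p2 p1] := attains_final fit_f I3 (both m3 m3E b3).
  by split=> // e3; apply: p1; exists 13.
(* After a successful first round, both outcomes of the second have value 1. *)
move=> e2; rewrite -[X in attains _ _ _ X](_ : (1 + 1) / 2 = 1)%R; last by field.
apply: (rnd _) => // m3 I3 m3E b3.
have [p2 p1] := attains_final fit_f I3 (both m3 m3E b3).
have v1 : attains final_cmds (final_time + 0) m3 1.
  by apply: p1; exists 8 => // p pnn; rewrite keep ?e2.
by split.
Qed.

End Main.
End Final.

End Instance.

Definition cmd_weight (c : cmd) : nat :=
  match c with
  | Loop r cnt e => (r + (weight cnt + weight e))%N
  | Call r => r
  end.

Definition cmds_weight (cs : seq cmd) : nat := sumn (map cmd_weight cs).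

Lemma fits_weight V w cs : (1 < V)%N -> (cmds_weight cs <= w)%N ->
  all (fits V (V ^ w.+1)) cs.
Proof.
move=> V1; elim: cs => //= c cs IH; rewrite /cmds_weight /= -/(cmds_weight cs) => le.
rewrite IH ?andbT; last by apply: leq_trans le; exact: leq_addl.
have {}le : (cmd_weight c <= w)%N by apply: leq_trans le; exact: leq_addr.
have rV r : (r <= w)%N -> (r < V ^ w.+1)%N.
  by move=> rw; apply: leq_trans (ltn_expl _ V1); rewrite ltnS ltnW.
case: c le => [r cnt e|r] /= le; last exact: rV.
by rewrite !ltn_exp2l // rV ?andbT; lia.
Qed.

Lemma bitlenE a : (0 < a)%N -> bitlen a = (trunc_log 2 a).+1.
Proof. by case: a. Qed.

(** * Size bounds and the choice of constants *)

Section Sizes.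
Local Open Scope nat_scope.

Lemma bitlen_lo n : 0 < n -> 2 * n < 2 ^ bitlen (2 * n).
Proof. by case: n => // n _; rewrite mulnS; apply: trunc_log_ltn. Qed.

Lemma bitlen_hi n : 0 < n -> 2 ^ bitlen (2 * n) <= 4 * n.
Proof.
move=> n0; have n20 : 0 < 2 * n by rewrite muln_gt0.
by rewrite bitlenE // expnS; have := trunc_logP (isT : 1 < 2) n20; lia.
Qed.

Lemma bitlen_gt0 n : 0 < n -> 0 < bitlen (2 * n).
Proof. by case: n => // n _; rewrite mulnS. Qed.

Lemma copy_size_crude n m M : 0 < n -> m <= n -> M <= n ->
  copy_size n m M <= 8 * n ^ 2.
Proof.
move=> n0 m_n M_n; have : m * M <= n * n by rewrite leq_mul.
by rewrite /copy_size -mulnn; nia.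
Qed.

(** The chains have [4 * m * M + 2 * m] vertices in all; this is where [m * M <= n] keeps a copy
    linear in [n]. *)
Lemma copy_size_fine n m M : m <= n -> m * M <= n -> copy_size n m M <= 8 * n.
Proof. by rewrite /copy_size; nia. Qed.

End Sizes.

Section Bounds.
Local Open Scope nat_scope.
Variables (n m M : nat).
Let lam := bitlen (2 * n).
Let K := 12 * (lam * lam).
Let N := K * lam * copy_size n m M.
Hypotheses (n0 : 0 < n) (m0 : 0 < m) (m_n : m <= n) (M_n : M <= n).

Lemma N_fine : m * M <= n -> N <= 96 * lam ^ 3 * n.
Proof.
move=> mM; rewrite /N /K; have := copy_size_fine m_n mM.
set S := copy_size _ _ _ => S8.
have -> : 96 * lam ^ 3 * n = 12 * (lam * lam) * lam * (8 * n).
  by rewrite !expnS expn0; ring.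
by rewrite leq_mul2l S8 orbT.
Qed.

(** A polynomial bound is enough for word sizes; the constant 768 is absorbed by
    [(n + 1) ^ 10 >= 1024]. *)
Lemma N_crude : N < n.+1 ^ 16.
Proof.
have lam_2n : lam <= 2 * n by exact: bitlen_le.
have N_le : N <= 768 * n ^ 5.
  have -> : 768 * n ^ 5 = 12 * ((2 * n) * (2 * n)) * (2 * n) * (8 * n ^ 2).
    by rewrite !expnS expn0; ring.
  by rewrite /N /K !leq_mul ?copy_size_crude.
have n1 : 1 < n.+1 by [].
have n5 : n ^ 5 <= n.+1 ^ 5 by rewrite leq_exp2r.
have e10 : 1024 <= n.+1 ^ 10 by rewrite -[1024]/(2 ^ 10) leq_exp2r.
have : 1024 * n.+1 ^ 5 <= n.+1 ^ 15 by rewrite (expnD _ 10 5) leq_mul2r e10 orbT.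
have : n.+1 ^ 15 <= n.+1 ^ 16 by rewrite leq_exp2l.
have : 0 < n.+1 ^ 5 by rewrite expn_gt0.
move: N_le n5; clear.
by move: (n ^ 5) (n.+1 ^ 5) (n.+1 ^ 15) (n.+1 ^ 16) N => a b c d e; lia.
Qed.

End Bounds.

Lemma seven_eighths : (7 / 8) ^+ 12 <= 1 / 4 :> rat.
Proof.
have a : (7 / 8) ^+ 2 <= 77 / 100 :> rat by rewrite expr2; lra.
have a0 : 0 <= (7 / 8) ^+ 2 :> rat by rewrite exprn_ge0 // divr_ge0.
rewrite -[12%N]/(2 * (2 * 3))%N exprM exprM.
move: (_ ^+ 2 : rat) a a0 => x a a0.
have b : x ^+ 2 <= 3 / 5 by rewrite expr2; nra.
have b0 : 0 <= x ^+ 2 by rewrite exprn_ge0.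
move: (x ^+ 2) b b0 => y b b0.
have c : y * y <= 9 / 25 by nra.
by rewrite exprS expr2; nra.
Qed.

Lemma geometric_small (z q : rat) (a k : nat) : 0 <= z -> z ^+ 12 <= q ->
  q = 4^-1 -> (4 * a <= 4 ^ k)%N -> a%:R * z ^+ (12 * k) <= q.
Proof.
move=> z0 zq qE ak; have q0 : 0 < q by rewrite qE.
apply: (@le_trans _ _ (a%:R * q ^+ k)).
  rewrite exprM; apply: ler_wpM2l; first exact: ler0n.
  by rewrite lerXn2r ?nnegrE ?exprn_ge0 ?(ltW q0).
rewrite -(ler_nat rat) natrM natrX in ak.
have p0 : 0 < 4 ^+ k :> rat by rewrite exprn_gt0.
rewrite qE exprVn ler_pdivrMr //.
by move: ak; move: (_ ^+ k) => x; lra.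
Qed.

(** Origin of the constant 12 in the number of samples: twelve groups divide the failure probability
    of an entry by at least 4. As [2 * n <= 2 ^ lam] gives [4 * n ^ 2 <= 4 ^ lam], [12 * lam] groups
    suffice for all [n * n] entries. *)
Lemma isolation_small n : (0 < n)%N ->
  (n * n)%:R * (7 / 8) ^+ (12 * bitlen (2 * n)) <= 1 / 4 :> rat.
Proof.
move=> n0; apply: (@geometric_small (7 / 8) (1 / 4) _ _ _ seven_eighths).
- by rewrite divr_ge0.
- by rewrite mul1r.
have lo := ltnW (bitlen_lo n0).
by rewrite (expnMn 2 2); have := leq_mul lo lo; lia.
Qed.

Section Bounds2.
Local Open Scope nat_scope.
Variables (n m M c : nat).
Let lam := bitlen (2 * n).
Let K := 12 * (lam * lam).
Let N := K * lam * copy_size n m M.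
Hypotheses (n0 : 0 < n) (m0 : 0 < m) (m_n : m <= n) (M_n : M <= n).

(** The 40 leaves room for the sizes involved, in particular [N * N + 1 <= (n + 1) ^ 32]; the
    [16 * c] covers the word bound of the oracle, as [N + 1 <= (n + 1) ^ 16]. *)
Definition bound_exp : nat := 40 + 16 * c.
Let V := n.+1 ^ bound_exp.

Lemma pow_V k : k <= 40 -> n.+1 ^ k <= V.
Proof. by move=> k40; rewrite leq_exp2l // /bound_exp; lia. Qed.

Lemma le_pow_V (a b k : nat) : b + k <= 40 -> a <= 2 ^ b * n ^ k -> a <= V.
Proof.
move=> bk le; apply: leq_trans (pow_V bk); apply: leq_trans le _.
have e2 : 2 ^ b <= n.+1 ^ b by case: (b) => // b'; rewrite leq_exp2r.
have en : n ^ k <= n.+1 ^ k by case: (k) => // k'; rewrite leq_exp2r.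
by rewrite expnD leq_mul.
Qed.

Lemma V_bounds : [/\ 4 + (n * m + m * n) <= V, 2 ^ lam <= V, 2 * n + 1 <= V,
    K <= V & N * N + 1 <= V] /\
  [/\ n * n * K * lam <= V, K * m <= V, n * n <= V, 2 * M <= V & n * n * K <= V] /\
  (N.+1 ^ c <= V).
Proof.
have lam_2n : lam <= 2 * n by exact: bitlen_le.
have lam_hi := bitlen_hi n0.
have nm : n * m <= n * n by rewrite leq_mul2l m_n orbT.
have ll : lam * lam <= 2 * n * (2 * n) by rewrite leq_mul.
have nn1 : 1 <= n * n by rewrite muln_gt0 n0.
have K48 : K <= 48 * (n * n) by rewrite /K; lia.
split; [split|split; [split|]].
- by apply: (@le_pow_V _ 3 2) => //; rewrite -mulnn; lia.
- by apply: (@le_pow_V _ 2 1) => //; rewrite expn1; exact: lam_hi.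
- by apply: (@le_pow_V _ 2 1) => //; rewrite expn1; lia.
- by apply: (@le_pow_V _ 6 2) => //; rewrite -mulnn; lia.
- have N16 := N_crude n0 m_n M_n; apply: leq_trans (pow_V (isT : 32 <= 40)).
  by rewrite (expnD _ 16 16) addn1 (leq_ltn_trans (leq_mul (leqnn _) (ltnW N16))) // ltn_mul2r N16 expn_gt0.
- apply: (@le_pow_V _ 7 5) => //.
  have -> : 2 ^ 7 * n ^ 5 = n * n * (64 * (n * n)) * (2 * n) by rewrite !expnS expn0; ring.
  by rewrite leq_mul // leq_mul2l; apply/orP; right; lia.
- apply: (@le_pow_V _ 6 3) => //.
  have -> : 2 ^ 6 * n ^ 3 = 64 * (n * n) * n by rewrite !expnS expn0; ring.
  by rewrite leq_mul //; lia.
- by apply: (@le_pow_V _ 0 2) => //; rewrite -mulnn; lia.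
- by apply: (@le_pow_V _ 1 1) => //; rewrite expn1; lia.
- apply: (@le_pow_V _ 6 4) => //.
  have -> : 2 ^ 6 * n ^ 4 = n * n * (64 * (n * n)) by rewrite !expnS expn0; ring.
  by rewrite leq_mul2l; apply/orP; right; lia.
- have N16 := N_crude n0 m_n M_n.
  apply: (@leq_trans ((n.+1 ^ 16) ^ c)); first by case: (c) => // c'; rewrite leq_exp2r.
  by rewrite -expnM leq_exp2l // /bound_exp; lia.
Qed.

End Bounds2.

(** * Min-Plus instances as memory contents *)

Section MinPlusInstance.
Local Open Scope nat_scope.
Variables (n m M : nat) (x : instance (minplus_product n m n M)).
Hypotheses (n0 : 0 < n) (m0 : 0 < m).

Let xs : seq int := @Defs.input (minplus_product n m n M) x.

Definition left_entry (i k : nat) : nat := pospart (nth 0%R xs (4 + (i * m + k))).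
Definition right_entry (k j : nat) : nat :=
  pospart (nth 0%R xs (4 + (n * m + (k * n + j)))).
Definition minplus_entry (i j : nat) : nat :=
  \big[minn/(2 * M)]_(k < m) (left_entry i k + right_entry k j).

Lemma nth_left (i : 'I_n) (k : 'I_m) :
  nth 0%R xs (4 + (i * m + k)) = Posz (x.1 i k).
Proof.
rewrite /xs /= nth_cat size_row_major ifT.
  by rewrite nth_row_major mxE.
by have : i.+1 * m <= n * m by [rewrite leq_mul2r ltn_ord orbT]; rewrite mulSn; have := ltn_ord k; lia.
Qed.

Lemma nth_right (k : 'I_m) (j : 'I_n) :
  nth 0%R xs (4 + (n * m + (k * n + j))) = Posz (x.2 k j).
Proof.
rewrite /xs /= nth_cat size_row_major ifF; last by rewrite ltnNge leq_addr.
by rewrite add0n addKn nth_row_major mxE.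
Qed.

Lemma left_entry_le i k : i < n -> k < m -> left_entry i k <= M.
Proof.
move=> iN km; rewrite /left_entry (nth_left (Ordinal iN) (Ordinal km)) /=.
by rewrite -ltnS ltn_ord.
Qed.

Lemma right_entry_le k j : k < m -> j < n -> right_entry k j <= M.
Proof.
move=> km jN; rewrite /right_entry (nth_right (Ordinal km) (Ordinal jN)) /=.
by rewrite -ltnS ltn_ord.
Qed.

Lemma bigmin_le (I : eqType) (s : seq I) (F : I -> nat) y k : k \in s ->
  \big[minn/y]_(i <- s) F i <= F k.
Proof.
elim: s => // i s IH; rewrite inE big_cons geq_min => /orP[/eqP->|/IH ->].
  by rewrite leqnn.
by rewrite orbT.
Qed.

Lemma minplus_entry_le i j k : i < n -> j < n -> k < m ->
  minplus_entry i j <= left_entry i k + right_entry k j.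
Proof.
move=> _ _ km; rewrite /minplus_entry.
exact: (@bigmin_le _ _ (fun k : 'I_m => left_entry i k + right_entry k j) _
  (Ordinal km) (mem_index_enum _)).
Qed.

Lemma minplus_entry_attained i j : i < n -> j < n ->
  exists2 k, k < m & minplus_entry i j = left_entry i k + right_entry k j.
Proof.
move=> iN jN; have : minplus_entry i j = 2 * M \/
    exists2 k, k < m & minplus_entry i j = left_entry i k + right_entry k j.
  apply: (big_ind (fun y => y = 2 * M \/
    exists2 k, k < m & y = left_entry i k + right_entry k j)).
  - by left.
  - by move=> a b ha hb; rewrite /minn; case: ifP.
  - by move=> k _; right; exists k.
(* If the minimum is the initial value [2 * M], index 0 attains it, because no sum exceeds
   [2 * M]. *)
case=> // E; exists 0 => //; apply/eqP; rewrite eqn_leq minplus_entry_le // E.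
by have := left_entry_le iN m0; have := right_entry_le m0 jN; lia.
Qed.

Lemma minplus_entry_le_2M i j : i < n -> j < n -> minplus_entry i j <= 2 * M.
Proof.
move=> iN jN; apply: leq_trans (minplus_entry_le iN jN m0) _.
by have := left_entry_le iN m0; have := right_entry_le m0 jN; lia.
Qed.

Lemma nth_minplus_output a : a < n * n ->
  nth 0%R (@Defs.output (minplus_product n m n M) x) a =
  Posz (minplus_entry (a %/ n) (a %% n)).
Proof.
move=> ann; have iN : a %/ n < n by rewrite ltn_divLR.
have jN : a %% n < n by rewrite ltn_mod.
have := nth_row_major (map_mx Posz (minplus_mx x.1 x.2)) (Ordinal iN) (Ordinal jN).
rewrite /= -divn_eq => ->; rewrite !mxE; congr Posz.
apply: eq_bigr => k _; rewrite /left_entry /right_entry.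
by rewrite (nth_left (Ordinal iN) k) (nth_right k (Ordinal jN)).
Qed.

Lemma minplus_cell_le a : absz (nth 0%R xs (4 + a)) <= M.
Proof.
case: (ltnP a (n * m + m * n)) => [lt|ge]; last first.
  by rewrite nth_default // /xs /= size_cat !size_row_major.
have [an|na] := ltnP a (n * m).
  have iN : a %/ m < n by rewrite ltn_divLR.
  have km : a %% m < m by rewrite ltn_mod.
  have := nth_left (Ordinal iN) (Ordinal km); rewrite /= -divn_eq => ->.
  by rewrite /= -ltnS ltn_ord.
have km : (a - n * m) %/ n < m by rewrite ltn_divLR //; lia.
have jN : (a - n * m) %% n < n by rewrite ltn_mod.
have := nth_right (Ordinal km) (Ordinal jN); rewrite /= -divn_eq subnKC // => ->.
by rewrite /= -ltnS ltn_ord.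
Qed.

Lemma minplus_input_le V a : n <= V -> m <= V -> M <= V ->
  absz (nth 0%R xs a) <= V.
Proof.
move=> nV mV MV; case: a => [|[|[|[|a]]]] //=.
exact: leq_trans (minplus_cell_le a) MV.
Qed.

Lemma minplus_input_default a : 4 + (n * m + m * n) <= a -> nth 0%R xs a = 0%R.
Proof. by move=> le; rewrite nth_default // /xs /= size_cat !size_row_major. Qed.

End MinPlusInstance.

Definition space_exp (c : nat) : nat :=
  (bound_exp c * (cmds_weight minplus_cmds).+1)%N.

(** Twice the exponent of [G], plus one, so that [G ^ 2] is below the word bound. *)
Definition word_exp (c : nat) : nat := (space_exp c * 2).+1.

Definition minplus_program (P : program) (c : nat) : program :=
  assemble P (space_exp c) minplus_cmds.

Lemma space_expE c :
  space_exp c = (bound_exp c * (cmds_weight minplus_cmds).+1)%N.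
Proof. by []. Qed.

Lemma space_exp_gt1 c : (1 < space_exp c)%N.
Proof.
rewrite space_expE /bound_exp; move: (cmds_weight minplus_cmds) => w.
by rewrite mulnDl; lia.
Qed.

Opaque space_exp.

Lemma space_word n c : (0 < n)%N ->
  ((n.+1 ^ space_exp c) ^ 2 < n.+1 ^ word_exp c)%N.
Proof.
rewrite -expnM /word_exp => n0; move: (space_exp c * 2)%N => k.
by rewrite ltn_exp2l.
Qed.

Lemma lt_word n c : (0 < n)%N -> (n.+1 < n.+1 ^ word_exp c)%N.
Proof.
move=> n0; rewrite -{1}[n.+1]expn1 /word_exp.
have := space_exp_gt1 c; move: (space_exp c) => k k1.
by rewrite ltn_exp2l //; lia.
Qed.

Lemma avg_two_thirds t (Pz : seq bool -> bool) :
  (2 * 2 ^ t <= 3 * #|[set z : t.-tuple bool | Pz z]|)%N ->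
  2 / 3 <= avg t (fun z => (Pz z)%:R).
Proof.
have t0 : 0 < 2 ^+ t :> rat by rewrite exprn_gt0.
rewrite avg_card -(ler_nat rat) [leLHS]natrM [leRHS]natrM natrX => le.
by rewrite ler_pdivlMr // mulrAC ler_pdivrMr // [leRHS]mulrC.
Qed.

Lemma two_rounds : 2 / 3 <= (1 + (1 + 0) / 2) / 2 :> rat.
Proof. by lra. Qed.

Lemma two_sure_rounds : 1 <= (1 + (1 + 1) / 2) / 2 :> rat.
Proof. by lra. Qed.

Section Run.
Local Open Scope nat_scope.
Variables (P : program) (c : nat) (f : nat -> nat) (n m M tP : nat).
Let lam := bitlen (2 * n).
Let N := 12 * (lam * lam) * lam * copy_size n m M.
Hypotheses (f1 : f 1 = 1) (f2 : f 2 != 1)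
  (n0 : 0 < n) (m0 : 0 < m) (m_n : m <= n) (M_n : M <= n).
Hypothesis P_correct : forall E : 'M[bool]_N, @admissible (count_apsp f N) E ->
  (forall tape : tP.-tuple bool,
     terminates P (run P (N.+1 ^ c) (@Defs.input (count_apsp f N) E) tape)) /\
  2 * 2 ^ tP <= 3 * #|[set tape : tP.-tuple bool |
     outputs P (run P (N.+1 ^ c) (@Defs.input (count_apsp f N) E) tape)
       (@Defs.output (count_apsp f N) E)]|.

Let V := n.+1 ^ bound_exp c.

Lemma attains_minplus_input (x : instance (minplus_product n m n M)) G W Q
    (F : option state -> bool) (vb : rat) :
  (forall s b, F s -> F (step Q W s b)) -> V < G -> G ^ 2 < W ->
  all (fits V G) minplus_cmds ->
  (forall s, halted Q s -> (forall a, a < n * n ->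
     memory s a = minplus_entry x (a %/ n) (a %% n) :> int) -> F (Some s)) ->
  vb = 0%R \/ vb = 1%R /\ (forall s, halted Q s -> F (Some s)) ->
  attains P Q W G F minplus_cmds (minplus_time n m M lam P tP)
    (fun k => nth 0%R (@Defs.input (minplus_product n m n M) x) k)
    ((1 + (1 + vb) / 2) / 2)%R.
Proof.
move=> F_abs VG GW fit fin fvb.
have [[in_V lam_V n_V K_V NN_V] [[H_V Z_V nn_V M2_V Knn_V] BP_V]] :=
  V_bounds c n0 m0 m_n M_n.
have NE : 2 * m < 2 ^ lam.
  by apply: leq_ltn_trans (bitlen_lo n0); rewrite leq_mul2l m_n.
have P_term E : @admissible (count_apsp f N) E -> forall z, size z = tP ->
    terminates P (run P (N.+1 ^ c) (@Defs.input (count_apsp f N) E) z).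
  move=> adm z zt; have [term _] := P_correct adm.
  by have := term (tcast zt (in_tuple z)); rewrite val_tcast.
have P_ok E : @admissible (count_apsp f N) E ->
    (2 / 3 <= avg tP (fun z =>
       (outputs P (run P (N.+1 ^ c) (@Defs.input (count_apsp f N) E) z)
         (@Defs.output (count_apsp f N) E))%:R) :> rat)%R.
  by move=> adm; have [_ le] := P_correct adm; exact: avg_two_thirds le.
have BP0 : 0 < N.+1 ^ c by rewrite expn_gt0.
have xsV a : absz (nth 0%R (@Defs.input (minplus_product n m n M) x) a) <= V.
  by apply: minplus_input_le => //; rewrite -/V in n_V; lia.
have xs0 a : G <= a -> nth 0%R (@Defs.input (minplus_product n m n M) x) a = 0%R.
  by move=> le; apply: minplus_input_default; rewrite -/V in in_V; lia.
exact: (@attains_minplus V G n m M lam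
  (left_entry x) (right_entry x) n0 m0 erefl in_V lam_V VG n_V K_V P Q
  W F F_abs GW (minplus_entry x) vb nn_V M2_V Knn_V fin fvb
  tP (N.+1 ^ c) f NN_V H_V Z_V BP0 BP_V f1 f2
  (@left_entry_le n m M x n0 m0) (@right_entry_le n m M x)
  (@minplus_entry_le n m M x) (@minplus_entry_le_2M n m M x n0 m0)
  (@minplus_entry_attained n m M x n0 m0) NE (isolation_small n0) P_term P_ok
  (fun k => nth 0%R (@Defs.input (minplus_product n m n M) x) k) fit erefl erefl erefl (fun _ _ _ _ => erefl)
  (fun _ _ _ _ => erefl) xsV xs0).
Qed.

Lemma run_minplus (x : instance (minplus_product n m n M)) :
  let Q := minplus_program P c in
  let t := size (prelude (space_exp c)) + minplus_time n m M lam P tP in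
  (forall tape : t.-tuple bool,
     terminates Q (run Q (n.+1 ^ word_exp c)
       (@Defs.input (minplus_product n m n M) x) tape)) /\
  2 * 2 ^ t <= 3 * #|[set tape : t.-tuple bool |
     outputs Q (run Q (n.+1 ^ word_exp c)
       (@Defs.input (minplus_product n m n M) x) tape)
       (@Defs.output (minplus_product n m n M) x)]|.
Proof.
move=> Q t.
have V1 : 1 < V by rewrite -[1](exp1n (bound_exp c)) ltn_exp2r.
have fit : all (fits V (n.+1 ^ space_exp c)) minplus_cmds.
  by rewrite space_expE expnM; exact: fits_weight (leqnn _).
have VG : V < n.+1 ^ space_exp c.
  have /andP[/and3P[wG _ _] _] := fit.
  by apply: leq_ltn_trans wG; rewrite -[V in V <= _]expn1 leq_exp2l.
have GW := space_word c n0; have nW := lt_word c n0.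
apply: (@run_assemble P (space_exp c) minplus_cmds _ n
  (@Defs.input (minplus_product n m n M) x) _ (@Defs.output (minplus_product n m n M) x)
  ((1 + (1 + 1) / 2) / 2)%R ((1 + (1 + 0) / 2) / 2)%R GW nW erefl).
- exact: two_sure_rounds.
- apply: (attains_minplus_input _ VG GW fit).
  + by move=> s b; exact: terminates_absorbing.
  + by move=> s hs _; exact: hs.
  + by right; split; [exact: erefl|move=> s hs; exact: hs].
- exact: two_rounds.
- apply: (attains_minplus_input _ VG GW fit); last by left.
  + by move=> s b; exact: outputs_absorbing.
  move=> s hs sE; rewrite /outputs hs /=; apply/eqP/(@eq_from_nth _ 0%R).
    by rewrite size_mkseq.
  move=> a; rewrite size_mkseq => ann; rewrite (nth_mkseq _ _ ann).
  rewrite size_row_major in ann.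
  by rewrite (sE _ ann) (nth_minplus_output _ n0 m0 ann).
Qed.

End Run.

(** * Running time *)

Definition loop_cost (r : nat) (cnt e : expr) : nat :=
  (size (loop_pre cnt) + (size (compile_expr 4 e ++ loop_post r)).+2)%N.

Lemma loop_time_le r cnt e k X : (0 < k)%N -> (k <= X)%N ->
  (loop_time r cnt e k <= loop_cost r cnt e * X)%N.
Proof.
rewrite /loop_time /loop_cost.
move: (size (loop_pre _)) (size (_ ++ _)).+2 => a b k0 kX.
apply: (@leq_trans ((a + b) * k)); last by rewrite leq_mul2l kX orbT.
by rewrite mulnDl [(k * b)%N]mulnC leq_add2r leq_pmulr.
Qed.

Lemma sum_le_total p l l' q s s' t Y X a b c d : X = (200 * (100 * Y))%N ->
  (0 < Y)%N -> (a <= p * X)%N -> (b <= l * X + (s + 2 * t))%N ->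
  (c <= l' * X + (s' + 2 * t))%N -> (d <= q * X)%N ->
  (a + (b + (c + (d + 0))) <= (200 * (100 * (p + l + l' + q)) + (s + s')) * Y + 4 * t)%N.
Proof.
move=> XE Y0; rewrite mulnDl.
have -> : (200 * (100 * (p + l + l' + q)) * Y = (p + l + l' + q) * X)%N by rewrite XE; ring.
have : (s + s' <= (s + s') * Y)%N by rewrite leq_pmulr.
rewrite !(mulnDl _ _ X).
move: (p * X)%N (l * X)%N (l' * X)%N (q * X)%N ((s + s') * Y)%N => *; lia.
Qed.

Opaque loop_cost loop_time.

(** Apart from the oracle, the dominant cost is writing the [N * N] adjacency matrix, where
    [N <= 96 * lam ^ 3 * n]. The term [4 * tP] stands for two calls, each simulated with two steps
    per oracle step. *)
Lemma minplus_time_le (P : program) : exists C, forall n m M tP,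
  (0 < n)%N -> (0 < m)%N -> (m <= n)%N -> (m * M <= n)%N ->
  (minplus_time n m M (bitlen (2 * n)) P tP
     <= C * (bitlen (2 * n) ^ 6 * n ^ 2) + 4 * tP)%N.
Proof.
pose loops r := (loop_cost r (eMul pK pm) (sample_val r) +
  (loop_cost r.+1 (eAdd (eMul pN pN) (Num 1)) (graph_val r) +
  (loop_cost r.+2 (eMul (eMul (eMul pn pn) pK) plam) (digit_val r) +
   loop_cost r.+3 (eMul (eMul pn pn) pK) (best_val r))))%N.
pose pre := (loop_cost 1 (eAdd p2n (Num 1))
    (eMul (ePos Idx) (eAdd (Num 1) (Get 1 (eDiv Idx (Num 2))))) +
  (loop_cost 2 (Num 1) (Get 1 p2n) +
  (loop_cost 3 (Num 1) (eMul (Num 12) (eMul plam plam)) +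
   loop_cost 4 plam (eIf Idx (eMul (Num 2) (Get 4 (eSub Idx (Num 1)))) (Num 1)))))%N.
pose total := (pre + loops 5 + loops 10 + loop_cost 0 (eMul pn pn) combine_val)%N.
exists (200 * (100 * total) + (size (call_pre P 6) + size (call_pre P 11)))%N.
move=> n m M tP n0 m0 mn mM; set lam := bitlen (2 * n).
have [Y YE] : exists Y, Y = (lam ^ 6 * n ^ 2)%N by exists (lam ^ 6 * n ^ 2)%N.
(* [X] bounds the lengths of all loops; the largest constant required is [96 * 96 + 1], below
   20000. *)
have [X XE] : exists X, X = (200 * (100 * Y))%N by exists (200 * (100 * Y))%N.
rewrite -YE.
have lam0 : (0 < lam)%N := bitlen_gt0 n0.
have [N NE] : exists N, N = (12 * (lam * lam) * lam * copy_size n m M)%N by eexists.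
have NX := N_fine mn mM; rewrite -/lam -NE in NX.
have Y_ge a b : (a <= 6)%N -> (b <= 2)%N -> (lam ^ a * n ^ b <= Y)%N.
  by move=> a6 b2; rewrite YE leq_mul // leq_pexp2l.
have Y0 : (0 < Y)%N by rewrite YE muln_gt0 !expn_gt0 lam0 n0.
have NN_X : (N * N + 1 <= X)%N.
  have : (N * N <= 96 * (96 * Y))%N.
    have -> : (96 * (96 * Y) = 96 * lam ^ 3 * n * (96 * lam ^ 3 * n))%N.
      by rewrite YE !expnS !expn0; ring.
    exact: leq_mul.
  by rewrite XE; move: (N * N)%N => z; lia.
have c1 : (2 * n + 1 <= X)%N.
  by have := Y_ge 0 1 isT isT; rewrite expn0 expn1 mul1n XE; lia.
have c2 : (1 <= X)%N by rewrite XE; lia.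
have c3 : (lam <= X)%N.
  by have := Y_ge 1 0 isT isT; rewrite expn0 expn1 muln1 XE; lia.
have nn_X : (n * n <= X)%N.
  by have := Y_ge 0 2 isT isT; rewrite expn0 mul1n -mulnn XE; lia.
have nnK_X : (n * n * (12 * (lam * lam)) <= X)%N.
  have := Y_ge 2 2 isT isT; rewrite -!mulnn XE.
  by rewrite (_ : n * n * (12 * (lam * lam)) = 12 * (lam * lam * (n * n)))%N; [lia|ring].
have H_X : (n * n * (12 * (lam * lam)) * lam <= X)%N.
  have := Y_ge 3 2 isT isT; rewrite XE.
  rewrite (_ : n * n * (12 * (lam * lam)) * lam = 12 * (lam ^ 3 * n ^ 2))%N; first by lia.
  by rewrite !expnS !expn0; ring.
have Km_X : (12 * (lam * lam) * m <= X)%N.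
  have := Y_ge 2 1 isT isT; rewrite expn1 -mulnn.
  have : (lam * lam * m <= lam * lam * n)%N by rewrite leq_mul2l mn orbT.
  by rewrite XE -mulnA; lia.
have K0 : (0 < 12 * (lam * lam))%N by rewrite !muln_gt0 lam0.
have nnK0 : (0 < n * n * (12 * (lam * lam)))%N by rewrite muln_gt0 K0 muln_gt0 n0.
have H0 : (0 < n * n * (12 * (lam * lam)) * lam)%N by rewrite muln_gt0 nnK0.
have Km0 : (0 < 12 * (lam * lam) * m)%N by rewrite muln_gt0 K0.
have nn0 : (0 < n * n)%N by rewrite muln_gt0 n0.
have NN0 : (0 < N * N + 1)%N by rewrite addn1.
have setupX : (setup_time n lam <= pre * X)%N.
  have n1 : (0 < 2 * n + 1)%N by rewrite addn1.
  have := loop_time_le 1 (eAdd p2n (Num 1))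
    (eMul (ePos Idx) (eAdd (Num 1) (Get 1 (eDiv Idx (Num 2))))) n1 c1.
  have := loop_time_le 2 (Num 1) (Get 1 p2n) (ltn0Sn 0) c2.
  have := loop_time_le 3 (Num 1) (eMul (Num 12) (eMul plam plam)) (ltn0Sn 0) c2.
  have := loop_time_le 4 plam
    (eIf Idx (eMul (Num 2) (Get 4 (eSub Idx (Num 1)))) (Num 1)) lam0 c3.
  rewrite /setup_time /pre.
  move: (loop_time 1 _ _ _) (loop_time 2 _ _ _) (loop_time 3 _ _ _) (loop_time 4 _ _ _).
  move: (loop_cost 1 _ _) (loop_cost 2 _ _) (loop_cost 3 _ _) (loop_cost 4 _ _).
  by move=> a b c d e f g h h1 h2 h3 h4; rewrite !mulnDl !leq_add.
have roundX r : (round_time n m M lam P r tP <=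
    loops r * X + (size (call_pre P r.+1) + 2 * tP))%N.
  rewrite /round_time -NE /loops /call_time.
  have := loop_time_le r (eMul pK pm) (sample_val r) Km0 Km_X.
  have := loop_time_le r.+1 (eAdd (eMul pN pN) (Num 1)) (graph_val r) NN0 NN_X.
  have := loop_time_le r.+2 (eMul (eMul (eMul pn pn) pK) plam) (digit_val r) H0 H_X.
  have := loop_time_le r.+3 (eMul (eMul pn pn) pK) (best_val r) nnK0 nnK_X.
  move: (loop_time _ _ _ _) (loop_time _ _ _ _) (loop_time _ _ _ _) (loop_time _ _ _ _).
  move: (loop_cost _ _ _) (loop_cost _ _ _) (loop_cost _ _ _) (loop_cost _ _ _).
  move: (size _) => s a b c d e f g h h1 h2 h3 h4; rewrite !mulnDl.
  move: h1 h2 h3 h4.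
  move: (a * X)%N (b * X)%N (c * X)%N (d * X)%N => *; lia.
have finalX : (final_time n <= loop_cost 0 (eMul pn pn) combine_val * X)%N.
  exact: loop_time_le.
exact: (sum_le_total XE Y0 setupX (roundX 5) (roundX 10) finalX).
Qed.

(** * Asymptotic bounds with real exponents *)

Section Asymptotics.
Variable R : realType.
Implicit Types (a e eps rho : R) (F : nat -> problem).

(** [2 ^ lam <= 4 * n] gives [lam * ln 2 <= ln (4 * n)]; then [ln y <= y] is applied with [y] the
    power of exponent [eps] of [4 * n]. *)
Lemma bitlen_powR eps : 0 < eps -> exists2 C : R, 0 <= C &
  forall n, (0 < n)%N -> (bitlen (2 * n))%:R <= C * n%:R `^ eps.
Proof.
move=> eps0; have ln2 : 0 < ln 2 :> R by rewrite ln_gt0 // ltr1n.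
exists (4 `^ eps / (eps * ln 2)); first by rewrite divr_ge0 ?powR_ge0 // mulr_ge0 // ltW.
move=> n n0; have n0' : 0 < n%:R :> R by rewrite ltr0n.
rewrite mulrAC -powRM ?ler0n // ler_pdivlMr ?mulr_gt0 //.
have x0 : 0 < (4 * n%:R) `^ eps :> R by rewrite powR_gt0 // mulr_gt0.
have : ln ((4 * n%:R) `^ eps) <= (4 * n%:R) `^ eps :> R.
  by rewrite -[in leRHS](lnK x0); apply: le_trans (expR_ge1Dx _); rewrite lerDr.
apply: le_trans; rewrite ln_powR mulrCA ler_pM2l // [leLHS]mulr_natl -lnXn //.
rewrite ler_ln ?posrE ?exprn_gt0 ?mulr_gt0 //.
by rewrite -natrX -natrM ler_nat bitlen_hi.
Qed.

Lemma npow_gt0 n a : (0 < n)%N -> 0 <= a -> (0 < npow n a)%N.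
Proof.
move=> n0 a0; rewrite /npow truncn_gt0 -[leLHS](powRr0 n%:R).
by apply: ler_powR => //; rewrite ler1n.
Qed.

Lemma npow_le n a : (npow n a)%:R <= n%:R `^ a :> R.
Proof. by rewrite truncn_le powR_ge0. Qed.

Lemma npow_leq n a : (0 < n)%N -> a <= 1 -> (npow n a <= n)%N.
Proof.
move=> n0 a1; rewrite -(ler_nat R); apply: le_trans (npow_le _ _) _.
by apply: ler1_powR => //; rewrite ler1n.
Qed.

Lemma npow_mul_leq n a : (0 < n)%N -> (npow n a * npow n (1 - a) <= n)%N.
Proof.
move=> n0; rewrite -(ler_nat R) natrM.
apply: le_trans (ler_pM _ _ (npow_le _ _) (npow_le _ _)) _; rewrite ?ler0n //.
rewrite -powRD; last by rewrite pnatr_eq0 -lt0n n0 implybT.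
by rewrite addrC subrK powRr1.
Qed.

Lemma rand_time_le F e e' : e <= e' -> rand_time F e -> rand_time F e'.
Proof.
(* Nothing in [rand_time] forces [K] to be nonnegative, hence its absolute value. *)
move=> ee [p [c [K H]]]; exists p, c, `|K| => n n0.
have [t tK ok] := H n n0; exists t => //; apply: le_trans tK _.
apply: (@le_trans _ _ (`|K| * n%:R `^ e)).
  by rewrite ler_wpM2r ?powR_ge0 ?ler_norm.
by rewrite ler_wpM2l // ler_powR // ler1n.
Qed.

(** [e <= 3] turns the logarithmic factor [lam ^ 3] of [N] into the fixed power [lam ^ 9]. *)
Lemma size_powR n lam N e : (0 < n)%N -> (0 < lam)%N -> (0 < N)%N ->
  0 <= e <= 3 -> (N <= 96 * lam ^ 3 * n)%N ->
  N%:R `^ e <= 96 ^+ 3 * (lam%:R ^+ 9 * n%:R `^ e) :> R.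
Proof.
move=> n0 l0 N0 /andP[e0 e3] le.
apply: (@le_trans _ _ ((96 * lam ^ 3 * n)%:R `^ e)).
  by rewrite ge0_ler_powR ?nnegrE ?ler0n // ler_nat.
rewrite natrM powRM ?ler0n // mulrA ler_wpM2r ?powR_ge0 //.
have c1 : 1 <= (96 * lam ^ 3)%:R :> R by rewrite ler1n muln_gt0 expn_gt0 l0.
apply: le_trans (ler_powR c1 e3) _.
by rewrite powR_mulrn // natrM natrX exprMn -exprM.
Qed.

(** [2 <= e] lets the oracle time dominate the quadratic work around it. The remaining factor
    [lam ^ 9] is paid for by [eps], each [lam] costing [eps / 9]. *)
Lemma count_apsp_to_minplus f rho e eps : f 1%N = 1%N -> f 2%N != 1%N ->
  0 < rho <= 1 -> 2 <= e <= 3 -> 0 < eps -> rand_time (count_apsp f) e ->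
  rand_time (fun n => minplus_product n (npow n rho) n (npow n (1 - rho))) (e + eps).
Proof.
move=> f1 f2 /andP[rho0 rho1] /andP[e2 e3] eps0 [P [c [K H]]].
have [C HC] := minplus_time_le P.
have [L L0 HL] : exists2 C : R, 0 <= C &
    forall n, (0 < n)%N -> (bitlen (2 * n))%:R <= C * n%:R `^ (eps / 9).
  by apply: bitlen_powR; rewrite divr_gt0.
exists (minplus_program P c), (word_exp c).
have [S SE] : exists S, S = size (prelude (space_exp c)) by eexists.
exists ((S%:R + C%:R + 4 * (`|K| * 96 ^+ 3)) * L ^+ 9) => n n0.
set m := npow n rho; set M := npow n (1 - rho).
have m0 : (0 < m)%N by rewrite npow_gt0 // ltW.
have mn : (m <= n)%N by rewrite npow_leq.
have Mn : (M <= n)%N by rewrite npow_leq // lerBlDr lerDl ltW.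
have mM : (m * M <= n)%N by exact: npow_mul_leq.
have l0 := bitlen_gt0 n0; have le_time := HC n m M _ n0 m0 mn mM.
have N_le := N_fine mn mM; have l_le := HL n n0.
move: l0 le_time N_le l_le.
have [lam lamE] : exists lam, lam = bitlen (2 * n) by eexists.
rewrite -lamE; set N := (_ * copy_size n m M)%N => l0 le_time N_le l_le.
have N0 : (0 < N)%N.
  by rewrite !muln_gt0 l0 /copy_size !addn_gt0 muln_gt0 n0.
have [tP tPK ok] := H N N0.
exists (S + minplus_time n m M lam P tP)%N; last first.
  move=> x _; rewrite SE lamE.
  have ok' := ok; rewrite /N lamE in ok'.
  exact: (@run_minplus P c f n m M tP f1 f2 n0 m0 mn Mn ok' x).
have n1 : 1 <= n%:R :> R by rewrite ler1n.
have Z0 : 0 <= lam%:R ^+ 9 * n%:R `^ e :> R by rewrite mulr_ge0 ?exprn_ge0 ?powR_ge0.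
have l1 : 1 <= lam%:R :> R by rewrite ler1n.
have n2e : n%:R ^+ 2 <= n%:R `^ e :> R by rewrite -powR_mulrn ?ler_powR.
have e1 : 1 <= n%:R `^ e :> R by apply: le_trans n2e; rewrite exprn_ege1.
have S_le : S%:R <= S%:R * (lam%:R ^+ 9 * n%:R `^ e) :> R.
  by rewrite ler_peMr // mulr_ege1 // exprn_ege1.
have Y_le : (C * (lam ^ 6 * n ^ 2))%:R <= C%:R * (lam%:R ^+ 9 * n%:R `^ e) :> R.
  rewrite natrM ler_wpM2l // natrM !natrX ler_pM ?exprn_ge0 //.
  by rewrite ler_weXn2l.
have P_le : tP%:R <= `|K| * 96 ^+ 3 * (lam%:R ^+ 9 * n%:R `^ e).
  apply: le_trans tPK _; apply: (@le_trans _ _ (`|K| * N%:R `^ e)).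
    by rewrite ler_wpM2r ?powR_ge0 ?ler_norm.
  rewrite -mulrA ler_wpM2l // size_powR // e3 andbT.
  by apply: le_trans e2; rewrite ler0n.
have total : (S + minplus_time n m M lam P tP)%:R <=
    (S%:R + C%:R + 4 * (`|K| * 96 ^+ 3)) * (lam%:R ^+ 9 * n%:R `^ e) :> R.
  rewrite natrD [in leRHS]mulrDl [in leRHS]mulrDl -addrA lerD //.
  apply: le_trans (_ : (C * (lam ^ 6 * n ^ 2) + 4 * tP)%:R <= _).
    by rewrite ler_nat.
  by rewrite natrD -[in leRHS]mulrA lerD // natrM ler_wpM2l.
apply: le_trans total _.
have -> : n%:R `^ (e + eps) = n%:R `^ eps * n%:R `^ e :> R.
  by rewrite addrC powRD // pnatr_eq0 -lt0n n0 implybT.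
rewrite -[in leRHS]mulrA ler_wpM2l //.
  by rewrite !addr_ge0 ?mulr_ge0 ?exprn_ge0.
rewrite mulrA ler_wpM2r ?powR_ge0 //.
have -> : n%:R `^ eps = (n%:R `^ (eps / 9)) ^+ 9 :> R.
  by rewrite -powR_mulrn ?powR_ge0 // -powRrM divfK // pnatr_eq0.
by rewrite -exprMn lerXn2r ?nnegrE ?mulr_ge0 ?powR_ge0.
Qed.

End Asymptotics.

(** * Large exponents *)

(** The cells 4 and 5 contain 0 when [M = 0], and the only entries of the two matrices when
    [n = m = 1]. The loop overwrites the region that it reads, which is harmless in both cases. *)
Definition constant_val := eAdd (Get 0 (Num 4)) (Get 0 (Num 5)).
Definition constant_cmds : seq cmd := [:: Loop 0 (eMul pn pn) constant_val].

Section Constant.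
Local Open Scope nat_scope.
Variables (n m M k : nat) (x : instance (minplus_product n m n M)).
Hypotheses (n0 : 0 < n) (m0 : 0 < m) (k2 : 2 < k) (mV : m <= n.+1 ^ k)
  (trivial : M = 0 \/ [/\ n = 1, m = 1 & M <= 1]).

Let c := k * (cmds_weight constant_cmds).+1.
Let xs : seq int := @Defs.input (minplus_product n m n M) x.
Let mm := fun a => nth 0%R xs a.
Let z := pospart (nth 0%R xs 4) + pospart (nth 0%R xs 5).

Lemma cell0 i : M = 0 -> pospart (nth 0%R xs (4 + i)) = 0.
Proof.
move=> M0; have := minplus_cell_le x n0 m0 i; rewrite [X in _ <= X]M0 /xs.
by case: (nth _ _ _) => [[|l]|l].
Qed.

Lemma constant_entry a : a < n * n -> minplus_entry x (a %/ n) (a %% n) = z.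
Proof.
move=> ann; have iN : a %/ n < n by rewrite ltn_divLR.
have jN : a %% n < n by rewrite ltn_mod.
case: trivial => [M0|[n1 m1 M1]].
  have := minplus_entry_le_2M x n0 m0 iN jN.
  have E : 2 * M = 0 by rewrite M0.
  rewrite [X in _ <= X]E leqn0 => /eqP ->.
  by rewrite /z (cell0 0 M0) (cell0 1 M0).
have [j] := minplus_entry_attained x n0 m0 iN jN.
rewrite [X in _ < X]m1 ltnS leqn0 => /eqP -> ->.
have -> : a %/ n = 0 by move: iN; rewrite [X in _ < X]n1; case: (_ %/ _).
have -> : a %% n = 0 by move: jN; rewrite [X in _ < X]n1; case: (_ %% _).
rewrite /left_entry /right_entry /z /xs !mul0n !addn0.
by rewrite [in 4 + n * m]n1 [in 1 * m]m1.
Qed.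

Lemma constant_entry_le : z <= n.+1 ^ k.
Proof.
have c0 := minplus_cell_le x n0 m0 0; have c1 := minplus_cell_le x n0 m0 1.
have zM : z <= M + M.
  by apply: leq_add; [move: c0|move: c1]; rewrite /xs; case: (nth _ _ _).
have n1k : n.+1 <= n.+1 ^ k by rewrite -[leqLHS]expn1 leq_exp2l //; lia.
by apply: leq_trans zM _; case: trivial => [->|[_ _ M1]]; lia.
Qed.

Lemma attains_constant (P Q : program) B (F : option state -> bool) :
  (n.+1 ^ c) ^ 2 < B ->
  (forall s, halted Q s -> (forall a, a < n * n ->
     memory s a = minplus_entry x (a %/ n) (a %% n) :> int) -> F (Some s)) ->
  (forall s b, F s -> F (step Q B s b)) ->
  attains P Q B (n.+1 ^ c) F constant_cmds
    (loop_time 0 (eMul pn pn) constant_val (n * n) + 0) mm 1%R.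
Proof.
move=> GB Fm F_abs.
have V1 : 1 < n.+1 ^ k by rewrite -[1](exp1n k) ltn_exp2r //; lia.
have fit : all (fits (n.+1 ^ k) (n.+1 ^ c)) constant_cmds.
  by rewrite /c expnM; exact: fits_weight (leqnn _).
have /andP[/and3P[wc we rG] _] := fit.
have nnV : n.+1 * n.+1 <= n.+1 ^ k by rewrite -[n.+1 * n.+1]/(n.+1 ^ 2) leq_exp2l // ltnW.
have VG : n.+1 ^ k < n.+1 ^ c.
  by apply: leq_ltn_trans wc; rewrite -[leqLHS]expn1 leq_exp2l.
have nn1 : 0 < n * n by rewrite muln_gt0 n0.
have G5 : 5 < n.+1 ^ c.
  apply: leq_ltn_trans VG; apply: (@leq_trans (2 ^ 3)) => //.
  by apply: leq_trans (_ : n.+1 ^ 3 <= _); rewrite ?leq_exp2r ?leq_exp2l.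
have nnG : n * n <= n.+1 ^ c by lia.
have nV : n <= n.+1 ^ k by lia.
apply: (@attains_det_loop P Q B (n.+1 ^ c) (n.+1 ^ k) F V1 GB 0 _ _ _ (n * n) 0 mm (fun=> z) 1%R _ _ wc we rG).
- rewrite nn1; lia.
- move=> i; apply: (minplus_input_le x n0 m0) => //; case: trivial => [->//|[_ _ M1]].
  exact: leq_trans M1 (ltnW V1).
- by rewrite ev_mul.
- move=> b a ann; rewrite ev_add !ev_get !ev_num.
  rewrite !get_fill ?(ltnW G5) //; try lia.
  rewrite /get /mm /z !mul0n !add0n /=; case: trivial => [M0|[n1 _ _]].
    by rewrite (cell0 0 M0) (cell0 1 M0) !if_same.
  have -> : a = 0 by clear -ann n1; rewrite n1 in ann; case: a ann.
  by [].
- by move=> a _; exact: constant_entry_le.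
apply: attains_nil => // s hs sm; apply: Fm => // a ann.
by rewrite sm /fill mul0n add0n ann (constant_entry ann).
Qed.

Lemma run_constant (P : program) :
  let Q := assemble P c constant_cmds in
  let t := size (prelude c) + (loop_time 0 (eMul pn pn) constant_val (n * n) + 0) in
  (forall tape : t.-tuple bool, terminates Q (run Q (n.+1 ^ (c * 2).+1) xs tape)) /\
  2 * 2 ^ t <= 3 * #|[set tape : t.-tuple bool |
     outputs Q (run Q (n.+1 ^ (c * 2).+1) xs tape)
       (@Defs.output (minplus_product n m n M) x)]|.
Proof.
move=> Q t.
have c0 : 0 < c by rewrite muln_gt0 (ltnW (ltnW k2)).
have GW : (n.+1 ^ c) ^ 2 < n.+1 ^ (c * 2).+1 by rewrite -expnM ltn_exp2l.
have nW : n.+1 < n.+1 ^ (c * 2).+1 by rewrite -[ltnLHS]expn1 ltn_exp2l // ltnS muln_gt0 c0.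
apply: (@run_assemble P c constant_cmds _ n xs _
  (@Defs.output (minplus_product n m n M) x) 1%R 1%R GW nW erefl (lexx _)).
- apply: attains_constant => //; first by move=> s b; exact: terminates_absorbing.
- lra.
apply: attains_constant => //; last by move=> s b; exact: outputs_absorbing.
move=> s hs sE; rewrite /outputs hs /=; apply/eqP/(@eq_from_nth _ 0%R).
  by rewrite size_mkseq.
move=> a; rewrite size_mkseq => ann; rewrite (nth_mkseq _ _ ann).
rewrite size_row_major in ann.
by rewrite (sE _ ann) (nth_minplus_output _ n0 m0 ann).
Qed.

End Constant.

Section LargeExponent.
Variable R : realType.
Implicit Types rho : R.

Lemma npow_eq0 n rho : (1 < n)%N -> rho < 0 -> npow n rho = 0%N.
Proof.
move=> n1 r0; apply/eqP; rewrite -leqn0 leqNgt truncn_gt0 -ltNge.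
rewrite -[rho]opprK powRN invf_lt1 ?powR_gt0 ?ltr0n ?(ltnW n1) //.
have one : 1 = 1 `^ (- rho) :> R by rewrite powR1.
by rewrite [ltLHS]one; apply: gt0_ltr_powR; rewrite ?nnegrE ?oppr_gt0 // ltr1n.
Qed.

Lemma npow_exp n rho : 0 <= rho -> (npow n rho <= n.+1 ^ (Num.truncn rho).+1)%N.
Proof.
move=> r0; rewrite -(ler_nat R); apply: le_trans (npow_le _ _) _.
apply: (@le_trans _ _ (n.+1%:R `^ rho)).
  by rewrite ge0_ler_powR ?nnegrE // ler_nat.
rewrite natrX -powR_mulrn // ler_powR ?ler1n //.
by have /andP[_ /ltW] := truncn_itv r0.
Qed.

Lemma rand_time_minplus_large rho : 1 < rho ->
  rand_time (fun n => minplus_product n (npow n rho) n (npow n (1 - rho))) (2 : R).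
Proof.
move=> rho1; have rho0 : 0 <= rho by apply: ltW; apply: lt_trans rho1.
pose k := (Num.truncn rho).+3.
pose c := (k * (cmds_weight constant_cmds).+1)%N.
exists (assemble [::] c constant_cmds), (c * 2).+1.
exists (size (prelude c) + loop_cost 0 (eMul pn pn) constant_val)%:R => n n0.
exists (size (prelude c) + (loop_time 0 (eMul pn pn) constant_val (n * n) + 0))%N.
  rewrite powR_mulrn // -natrX -natrM ler_nat mulnDl addn0 -mulnn.
  have nn : (0 < n * n)%N by rewrite muln_gt0 n0.
  by apply: leq_add; [rewrite leq_pmulr|exact: loop_time_le].
move=> x _; apply: run_constant => //.
- exact: npow_gt0.
- by apply: leq_trans (npow_exp n rho0) _; rewrite leq_exp2l //; apply: leqW.
have [n1|n1] := leqP n 1; last by left; rewrite npow_eq0 // subr_lt0.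
(* Powers of 1 are 1 for any exponent, so here [m = 1] and [M = 1]. *)
have nE : n = 1%N by apply/eqP; rewrite eqn_leq n1.
by rewrite nE /npow !powR1 truncn1; right.
Qed.

End LargeExponent.

(** * Small exponents *)

Lemma count_edge n (E : 'M[bool]_n) (u v : 'I_n) : E u v -> u != v ->
  count_shortest_paths E u v = 1%N.
Proof.
move=> Euv uv; have n1 : (size [:: v] <= n)%N := leq_trans (ltn0Sn _) (ltn_ord u).
have edge : is_path E u v [:: v] by rewrite /is_path /= Euv eqxx inE uv.
apply/eqP/cards1P; exists (Bseq n1); apply/setP => p; rewrite !inE.
apply/idP/eqP => [/andP[pP /forallP/(_ (Bseq n1))/implyP/(_ edge) sz]|->].
  apply: val_inj; move: pP sz => /=; case: (bseqval p) => [|x [|//]] /and3P[_ /eqP] /=.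
    by move=> E0; rewrite E0 eqxx in uv.
  by move=> ->.
rewrite /is_shortest_path edge; apply/forallP => q; apply/implyP => /and3P[_ + _].
by case: (bseqval q) => //= /eqP E0; rewrite E0 eqxx in uv.
Qed.

(** A step changes at most one memory cell; [W] collects these cells. *)
Lemma run_support (P : program) B tape s s' :
  foldl (step P B) (Some s) tape = Some s' ->
  exists2 W : seq nat, (size W <= size tape)%N &
    forall k, k \notin W -> memory s' k = memory s k.
Proof.
have none z : foldl (step P B) None z = None by elim: z.
elim: tape s => [|b z IH] s /=; first by case=> ->; exists [::].
rewrite /step -/(step P B); case: ifP => [_|_] /=.
  by move/IH => [W sz HW]; exists W => //; apply: leqW.
case E: (exec _ _ _ _) => [s1|]; last by rewrite none.
move/IH => [W sz HW].
have [k0 Hk0] : exists k0, forall k, k != k0 -> memory s1 k = memory s k.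
  case: (nth _ _ _) E => [r x|o r r1 r2|r r1|r1 r2|r|r l] /=; rewrite /set_reg.
  - by case: ifP => // _ [<-]; exists 0%N.
  - by case: ifP => // _ [<-]; exists 0%N.
  - by case: (reg s r1) => // a; case: ifP => // _ [<-]; exists 0%N.
  - case: (reg s r1) => // a [<-]; exists a => k ka /=.
    by rewrite /upd (negbTE ka).
  - by case: ifP => // _ [<-]; exists 0%N.
  - by case=> <-; exists 0%N.
exists (k0 :: W) => // k; rewrite inE negb_or => /andP[kk kW].
by rewrite HW // Hk0.
Qed.

Definition bipartite_mx n : 'M[bool]_n := \matrix_(u, v) (~~ odd u && odd v).

(** Output address of the entry in row [2 * a] and column [2 * b + 1], where [a] and [b] are the
    quotient and the remainder of [k] by [h]. *)
Definition edge_cell (h k : nat) : nat :=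
  ((2 * (k %/ h)) * (2 * h) + (2 * (k %% h)).+1)%N.

Lemma edge_cell_inj h : (0 < h)%N -> injective (edge_cell h).
Proof.
move=> h0 k k' E.
have cellE a : edge_cell h a = (a %/ h * (4 * h) + (2 * (a %% h)).+1)%N.
  by rewrite /edge_cell; ring.
have small a : ((2 * (a %% h)).+1 < 4 * h)%N by have := ltn_pmod a h0; lia.
have h4 : (0 < 4 * h)%N by rewrite muln_gt0.
have q a : (edge_cell h a %/ (4 * h) = a %/ h)%N.
  by rewrite cellE divnMDl // (divn_small (small a)) addn0.
have r a : (edge_cell h a %% (4 * h) = (2 * (a %% h)).+1)%N.
  by rewrite cellE modnMDl (modn_small (small a)).
have := q k; have := r k; rewrite E q r => r' q'.
by rewrite (divn_eq k h) (divn_eq k' h) q'; congr addn; lia.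
Qed.

(** The input is preceded by the number of vertices, the output is not. The address that must
    finally hold the entry [(2 * a, 2 * b + 1)], which is 1, thus initially holds the adjacency
    entry [(2 * a, 2 * b)], which is 0: all these [h * h] cells have to be written. *)
Lemma count_apsp_writes (f : nat -> nat) h (P : program) B t :
  f 1%N = 1%N -> (0 < h)%N ->
  (forall x : instance (count_apsp f (2 * h)), admissible x ->
     (2 * 2 ^ t <= 3 * #|[set tape : t.-tuple bool |
        outputs P (run P B (@Defs.input (count_apsp f (2 * h)) x) tape)
          (@Defs.output (count_apsp f (2 * h)) x)]|)%N) ->
  (h * h <= t)%N.
Proof.
move=> f1 h0 ok; set n := (2 * h)%N.
pose E := bipartite_mx n.
have loopless : @admissible (count_apsp f n) E.
  by apply/forallP => u; rewrite mxE; case: (odd u).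
have : (0 < #|[set tape : t.-tuple bool |
    outputs P (run P B (@Defs.input (count_apsp f n) E) tape)
      (@Defs.output (count_apsp f n) E)]|)%N.
  by rewrite lt0n; apply: contraTneq (ok E loopless) => ->; rewrite muln0 -ltnNge muln_gt0 expn_gt0.
case/card_gt0P => tape; rewrite inE; rewrite /run.
case run_eq: (foldl _ _ _) => [s|] //= /andP[_ /eqP out].
have [W szW HW] := run_support run_eq; rewrite size_tuple in szW.
apply: leq_trans szW; rewrite -(size_iota 0 (h * h)) -(size_map (edge_cell h)).
apply: uniq_leq_size; first by rewrite map_inj_uniq ?iota_uniq //; exact: edge_cell_inj.
move=> _ /mapP[k + ->]; rewrite mem_iota add0n => /andP[_ khh].
have q : (2 * (k %/ h) < n)%N by rewrite ltn_pmul2l // ltn_divLR.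
have r : (2 * (k %% h) < n)%N by rewrite ltn_pmul2l // ltn_mod.
have r1 : ((2 * (k %% h)).+1 < n)%N by have := ltn_pmod k h0; rewrite /n; lia.
apply: contraT => /HW; rewrite /edge_cell -/n.
have := congr1 (fun z => nth 0 z (edge_cell h k)) out.
rewrite (nth_row_major _ (Ordinal q) (Ordinal r1)) mxE.
rewrite count_edge; last 2 first.
- by rewrite mxE /= !oddM.
- by rewrite -val_eqE /=; apply/eqP; lia.
rewrite f1 nth_mkseq => [->|]; last first.
  by rewrite size_row_major /edge_cell; nia.
rewrite /init /= addnS /= (nth_row_major _ (Ordinal q) (Ordinal r)) !mxE /=.
by rewrite !oddM.
Qed.

Lemma count_apsp_quadratic (R : realType) (f : nat -> nat) (e : R) :
  f 1%N = 1%N -> e < 2 -> ~ rand_time (count_apsp f) e.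
Proof.
move=> f1 e2 [P [c [K H]]].
have r0 : 0 < 2 - e by rewrite subr_gt0.
have bound h : (0 < h)%N -> h%:R `^ (2 - e) <= K * 2 `^ e.
  move=> h0; have h20 : (0 < 2 * h)%N by rewrite muln_gt0.
  have [t tK ok] := H _ h20.
  have : (h * h <= t)%N by apply: (count_apsp_writes f1 h0) => x /ok[_]; exact.
  rewrite -(ler_nat R) => /le_trans/(_ tK).
  have h0' : 0 < h%:R :> R by rewrite ltr0n.
  rewrite powRB ?gt_eqF ?implybT // ler_pdivrMr ?powR_gt0 //.
  by rewrite powR_mulrn // expr2 -natrM -mulrA -powRM // -natrM.
(* The power of [D] with exponent [2 - e] is the absolute value of the bound, so any [h > D]
   contradicts it. *)
pose D := `|K * 2 `^ e| `^ (2 - e)^-1.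
have := bound (Num.truncn D).+1 isT; apply/negP; rewrite -ltNge.
apply: le_lt_trans (ler_norm _) _.
have -> : `|K * 2 `^ e| = D `^ (2 - e).
  by rewrite /D -powRrM mulVf ?powRr1 // lt0r_neq0.
by apply: gt0_ltr_powR; rewrite ?nnegrE ?powR_ge0 ?truncnS_gt.
Qed.

Lemma count_apsp_hard (R : realType) (rho : R) (f : nat -> nat) :
  f 1%N = 1%N -> f 2%N != 1%N ->
  requires_time
    (fun n => minplus_product n (npow n rho) n (npow n (1 - rho))) (2 + rho) ->
  requires_time (count_apsp f) (2 + rho).
Proof.
move=> f1 f2 hard delta delta0 fast.
have [rho0|rho0] := leP rho 0.
  by apply: count_apsp_quadratic f1 _ fast; lra.
have [rho1|rho1] := leP rho 1; last first.
  (* Time [n ^ 2] contradicts the assumption with the gain [delta = rho]. *)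
  by apply: hard rho0 _; rewrite addrK; exact: rand_time_minplus_large.
(* Capping the gain at [rho] keeps the exponent in [2, 3]; half of the gain is spent on logarithmic
   factors. *)
pose d := Num.min delta rho.
have d0 : 0 < d by rewrite lt_min delta0.
have d_delta : d <= delta by rewrite ge_min lexx.
have d_rho : d <= rho by rewrite ge_min lexx orbT.
apply: (hard (d / 2)); first by rewrite divr_gt0.
have -> : 2 + rho - d / 2 = 2 + rho - d + d / 2 by lra.
apply: (@count_apsp_to_minplus R f rho (2 + rho - d)) => //.
- by rewrite rho0.
- by apply/andP; split; lra.
- by rewrite divr_gt0.
by apply: rand_time_le fast; lra.
Qed.

Theorem theorem16 (R : realType) (rho : R)
  (homega : is_omega 1 rho 1 (1 + 2 * rho))
  (hminplus : requires_time
     (fun n => minplus_product n (npow n rho) n (npow n (1 - rho))) (2 + rho)) :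
  forall U : nat, (2 <= U)%N ->
    requires_time (count_apsp_mod U) (2 + rho) /\
    requires_time (count_apsp_le U) (2 + rho).
Proof.
move=> U U2; split; apply: count_apsp_hard hminplus.
- by rewrite modn_small.
(* Two paths are read as 0 if [U = 2] and as 2 if [U > 2], never as 1. *)
- by case: U U2 => [|[|[|U]]].
- by apply/minn_idPl; apply: ltnW.
- by rewrite (minn_idPl U2).
Qed.
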